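(* For every $n\in\mathbb{N}$ and every real $r\ge 0$, $$\mathbb{P}\left(\frac{1}{n}L_n(n)\ge 2(1+r)\right)\le e^{-nJ_{GUE}(r)},\qquad\text{where } J_{GUE}(r)=4\int_0^r\sqrt{x(x+2)}\,dx .$$
   Context: Let $\{B_i\}_{i=0}^\infty$ be i.i.d. standard two-sided Brownian motions on $\mathbb{R}$ (with $B_i(0)=0$), and write $B_k(s,t)=B_k(t)-B_k(s)$. For $n\in\mathbb{N}=\{1,2,\dots\}$ and $t>0$, the Brownian last passage time from $(0,1)$ to $(t,n)$ is $$L_n(t)=\sup_{0=s_0<s_1<\dots<s_{n-1}<s_n=t}\ \sum_{j=1}^n B_j(s_{j-1},s_j).$$ $L_n(n)$ denotes $L_n(t)$ at $t=n$. *)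

(* Defs.v *)
From HB Require Import structures.
From mathcomp Require Import all_boot all_order all_algebra.
From mathcomp Require Import all_classical all_reals all_analysis.
(* [all_analysis] alone does not make the ring structure of {mfun T >-> R}
   available for inference. *)
From mathcomp Require Import measurable_realfun.

Set Implicit Arguments.
Unset Strict Implicit.
Unset Printing Implicit Defensive.

Import Order.TTheory GRing.Theory Num.Theory.
Import numFieldNormedType.Exports.

Local Open Scope classical_set_scope.
Local Open Scope ring_scope.

Section independence.
Context d (T : measurableType d) (R : realType) (P : probability T R).

(* Mutual independence of a family [F] of classes of events: the product rule
   holds over every finite set of distinct indices. *)
Definition mutually_independent (I : eqType) (F : I -> set_system T) : Prop :=
  forall (J : seq I) (E : I -> set T), uniq J ->
    (forall i, i \in J -> F i (E i)) ->
    P (\big[setI/setT]_(i <- J) E i) = (\prod_(i <- J) P (E i))%E.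

Definition sigma_process (I : Type) (X : I -> {RV P >-> R}) : set_system T :=
  <<s [set A | exists (i : I) (V : set R), measurable V /\ A = X i @^-1` V] >>.

Definition independent_RVs (I : eqType) (X : I -> {RV P >-> R}) : Prop :=
  mutually_independent (fun i => sigma_process (fun _ : unit => X i)).

Definition independent_processes (I : eqType) (K : Type)
    (X : I -> K -> {RV P >-> R}) : Prop :=
  mutually_independent (fun i => sigma_process (X i)).

End independence.

Section brownian_motion.
Context d (T : measurableType d) (R : realType) (P : probability T R).

Definition process_incr (X : R -> {RV P >-> R}) (s t : R) : {RV P >-> R} :=
  X t - X s.

(* Sample paths are continuous surely, not just almost surely.  The time
   points [u 0 < u 1 < ... < u k] range over the whole line, so the increments
   over negative times are independent of those over positive times.  The
   second parameter of [normal_prob] is the standard deviation. *)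
Definition two_sided_brownian_motion (X : R -> {RV P >-> R}) : Prop :=
  [/\ forall w, X 0 w = 0,
      forall w, continuous (fun t : R => X t w),
      forall (k : nat) (u : nat -> R),
        (forall i, (i < k)%N -> u i < u i.+1) ->
        independent_RVs (fun i : 'I_k => process_incr X (u i) (u i.+1))
    & forall s t : R, s < t -> forall V : set R, measurable V ->
        distribution P (process_incr X s t) V =
        normal_prob 0 (Num.sqrt (t - s)) V].

Definition iid_two_sided_brownian_motions (B : nat -> R -> {RV P >-> R}) :
    Prop :=
  (forall i, two_sided_brownian_motion (B i)) /\ independent_processes B.

(* Only the values [s 0, ..., s n] matter.  The supremum is taken in the
   extended reals, so no boundedness has to be established beforehand. *)
Definition last_passage_time (B : nat -> R -> {RV P >-> R}) (n : nat) (t : R)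
    (w : T) : \bar R :=
  ereal_sup [set (\sum_(1 <= j < n.+1) process_incr (B j) (s j.-1) (s j) w)%:E
            | s in [set s : nat -> R | [/\ s 0%N = 0, s n = t
                & forall j, (j < n)%N -> s j < s j.+1]]].

End brownian_motion.

Definition J_GUE (R : realType) (r : R) : R :=
  4 * \int[lebesgue_measure]_(x in `[0, r]) Num.sqrt (x * (x + 2)).

(* Main.v *)
(** For [0 < b < a] one has
    [P(L_n(t) >= x) <= (a / b)^n exp((a^2 - b^2) t / 2 - (a - b) x)], and the theorem is
    the optimal choice [a = 1 / b = 1 + r + sqrt(r (r + 2))] at [t = n], [x = 2 (1 + r) n].
    Heuristically this is Markov's inequality for [exp((a - b) L)], where [L] is the
    passage time started from a boundary profile which is stationary by Burke's theorem.

    Stochastic calculus is avoided by a discrete polymer: Brownian motion is sampled at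
    [N] times, the supremum over paths becomes a partition function at inverse
    temperature [beta], and [exp((a - b) L)] its power of exponent [v = (a - b) / beta].
    When the noise takes only the values [h] and [-h], Burke's stationarity survives as an
    exact inequality for one lattice cell ([cell_le]), which propagates to all columns
    and time steps because only positive combinations of functions [(r + A . S)^v] occur.
    On such functions a Gaussian increment exceeds the two-point one by a factor
    [1 + O(h^3)] only (Lindeberg's exchange argument), and [N h^3] tends to [0] while
    [beta] and [N] tend to infinity, where the partition function dominates the last
    passage time along grid paths. *)

Require Import Defs.
From HB Require Import structures.
From mathcomp Require Import all_boot all_order all_algebra.
From mathcomp Require Import all_classical all_reals all_analysis.
From mathcomp Require Import measurable_realfun.
From mathcomp Require Import ring lra.

Set Implicit Arguments.
Unset Strict Implicit.
Unset Printing Implicit Defensive.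

Import Order.TTheory GRing.Theory Num.Theory.
Import numFieldNormedType.Exports.

Local Open Scope classical_set_scope.
Local Open Scope ring_scope.

(** * One lattice cell *)

(** In a lattice cell let [w] be the ratio of two neighbouring levels, [x] the multiplicative
    increment of the lower level, [e] the noise of the upper one and [c] the jump weight. A time
    step yields [w' = e * w / x + c] and [x' = w' * x / w], and exact stationarity would say that
    [(x', w')] has the law of [(x, w)]. This fails because adding [c] leaves the lattice of powers
    of [E]. With [c = 0] the geometric law of [w] is preserved except at its lower end, where mass
    escapes below [1]; for increasing functions that is a strict loss, and a sufficiently small [c]
    is paid for out of it. Smallness of [c] is harmless: it enters the final bound only as
    [c ^ (n * v)], where [v] tends to [0] and [c] decreases only like a power of [1 / beta]. Powers
    with exponent at most [1] are the right test functions for two reasons: concavity controls the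
    increment caused by [c], and positive affine functions of the profile are stable under a time
    step. Homogeneity makes all errors multiplicative, so that they accumulate as powers of factors
    close to [1]. *)

Lemma powR_bernoulli (R : realType) (v u : R) :
  0 < v <= 1 -> -1 <= u -> (1 + u) `^ v <= 1 + v * u.
Proof.
move=> /andP[v0 v1] u1.
have [u0|u0] := eqVneq (1 + u) 0.
  by rewrite u0 powR0 ?gt_eqF//; nra.
have up : 0 < 1 + u by rewrite lt_def u0/=; lra.
rewrite /powR (negbTE u0); set z := ln (1 + u).
have ez : expR z = 1 + u by rewrite lnK.
have -> : 1 + v * u = 1 - v + v * expR z by rewrite ez; ring.
(* Convexity of the exponential between [0] and [z], obtained from its tangent at [v * z]. *)
have -> : expR z = expR (v * z) * expR ((1 - v) * z).
  by rewrite -expRD; congr expR; ring.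
have h1 := expR_ge1Dx (- (v * z)); have h2 := expR_ge1Dx ((1 - v) * z).
have e0 := expR_gt0 (v * z).
have ee : expR (v * z) * expR (- (v * z)) = 1 by rewrite expRxMexpNx_1.
move: h1 h2 e0 ee.
move: (expR (v * z)) (expR (- (v * z))) (expR ((1 - v) * z)) => A B C h1 h2 e0 ee.
have : A * ((1 - v) * B + v * C) >= A * 1.
  apply: ler_wpM2l; first exact: ltW.
  have : (1 - v) * (1 + - (v * z)) <= (1 - v) * B by apply: ler_wpM2l => //; lra.
  have : v * (1 + (1 - v) * z) <= v * C by apply: ler_wpM2l => //; exact: ltW.
  move=> hC hB; have := lerD hB hC.
  have -> : (1 - v) * (1 + - (v * z)) + v * (1 + (1 - v) * z) = 1 by ring.
  by [].
have -> : A * ((1 - v) * B + v * C) = (1 - v) * (A * B) + v * (A * C) by ring.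
by rewrite ee !mulr1.
Qed.

Lemma powR_tangent (R : realType) (v x y : R) :
  0 < v <= 1 -> 0 <= x -> 0 < y ->
  x `^ v <= y `^ v + v * y `^ (v - 1) * (x - y).
Proof.
move=> v01 x0 y0; have /andP[v0 v1] := v01.
have e : x = y * (1 + (x / y - 1)) by field; rewrite gt_eqF.
have xy : 0 <= x / y by rewrite divr_ge0// ltW.
have yv : y `^ (v - 1) = y `^ v / y by rewrite powRB ?powRr1 ?ltW//; rewrite (gt_eqF y0) implybT.
rewrite {1}e powRM; [|exact: ltW|by rewrite addrC subrK].
have b := @powR_bernoulli R v (x / y - 1) v01.
apply: (le_trans (ler_wpM2l (powR_ge0 _ _) (b _))); first by lra.
by rewrite yv le_eqVlt; apply/orP; left; apply/eqP; field; rewrite gt_eqF.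
Qed.

Lemma sum_shift2 (R : realType) (rho : R) (g : nat -> R) M :
  \sum_(j < M) rho ^+ j.+2 * g j.+2 =
  \sum_(j < M) rho ^+ j * g j - g 0%N - rho * g 1%N + rho ^+ M * g M
    + rho ^+ M.+1 * g M.+1.
Proof.
elim: M => [|M IH]; first by rewrite !big_ord0 expr0 expr1; ring.
by rewrite !big_ord_recr /= IH; ring.
Qed.

(** The jump costs each of the four sums at most a quarter of [fa - ft], while shifting the second
    and third sums leaves [ft - fa]. The two cancel, and only the truncation term [top] survives. *)
Lemma cell_arith (R : realType) (S1 S2 S3 S4 T1 Tb Tt T3 fa ft Ga1 Gt1 top r2 ce : R) :
  S1 <= T1 + 4^-1 * (fa - ft) -> S2 <= Tt + 4^-1 * (fa - ft) ->
  S3 <= r2 * (T3 + 4^-1 * (fa - ft)) -> S4 <= Tb + 4^-1 * (fa - ft) ->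
  r2 * T3 = T1 - fa - Ga1 + top -> Tt <= r2 * Tb + ft + Gt1 -> Gt1 <= Ga1 ->
  top <= 2 * (ce * fa) -> ce * fa <= ce * T1 -> 0 <= ce * (r2 * Tb) ->
  0 <= r2 -> r2 * (fa - ft) <= fa - ft ->
  2^-1 * (S1 + S2 + S3 + r2 * S4) <= (1 + ce) * (T1 + r2 * Tb).
Proof.
move=> h1 h2 h3 /[swap] h5 h4 h6 h7 h8 h9 h10 h11 h12.
have {}h4 := ler_wpM2l h11 h4.
have e1 : r2 * (T3 + 4^-1 * (fa - ft)) = r2 * T3 + 4^-1 * (r2 * (fa - ft)) by ring.
have e2 : r2 * (Tb + 4^-1 * (fa - ft)) = r2 * Tb + 4^-1 * (r2 * (fa - ft)) by ring.
have -> : (1 + ce) * (T1 + r2 * Tb) = T1 + r2 * Tb + ce * T1 + ce * (r2 * Tb) by ring.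
rewrite e1 h5 in h3; rewrite e2 in h4.
move: (r2 * S4) (r2 * (fa - ft)) (ce * (r2 * Tb)) (r2 * Tb) (ce * fa) (ce * T1) h3 h4 h6 h8 h9 h10 h12.
move=> x1 x2 x3 x4 x5 x6 h3 h4 h6 h8 h9 h10 h12.
clear h11 h5 e1 e2.
lra.
Qed.

Section cell.
Context {R : realType} (v E rho : R) (M : nat).
Hypotheses (v01 : 0 < v <= 1) (E1 : 1 < E) (rho01 : 0 < rho < 1).

Definition bias_up := (1 + rho ^+ 2)^-1.
Definition bias_down := rho ^+ 2 / (1 + rho ^+ 2).
(** [1 - rho] cancels the mass of the geometric law, [1 - E ^- 2] is the width of the drop that pays
    for the jump, [E ^+ 2] bounds the ratio of the slopes at the two ends of this drop, and [4]
    counts the sums that share it. *)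
Definition jump := (1 - rho) * (1 - E ^- 2) / E ^+ 2 / 4.
(** Bounds, relative to the term of index [0], what is left at the upper end of the truncated
    geometric sum after a shift by two. *)
Definition cutoff_err := rho ^+ M * E `^ (M.+1%:R * v).

Let f (x : R) := x `^ v.

Let E0 : 0 < E. Proof. exact: lt_trans E1. Qed.
Let Ei0 : 0 < E^-1. Proof. by rewrite invr_gt0. Qed.
Let Ei1 : E^-1 < 1. Proof. by rewrite invf_lt1. Qed.
Let EE : E * E^-1 = 1. Proof. by rewrite mulfV ?gt_eqF. Qed.
Let f_le x y : 0 <= x -> x <= y -> f x <= f y.
Proof.
move=> x0 xy; apply: ge0_ler_powR => //; rewrite ?nnegrE//.
- by case/andP: v01 => /ltW.
- exact: le_trans xy.
Qed.
Let f_ge0 x : 0 <= f x. Proof. exact: powR_ge0. Qed.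

Let bias_up_ge : 2^-1 <= bias_up.
Proof.
have /andP[r0 r1] := rho01.
rewrite /bias_up lef_pV2 ?posrE//; last by rewrite addr_gt0// exprn_gt0.
have : rho ^+ 2 <= 1 by rewrite exprn_ile1// ltW.
by lra.
Qed.
Let bias_downE : bias_down = bias_up * rho ^+ 2.
Proof. by rewrite /bias_down /bias_up mulrC. Qed.

Lemma jump_gt0 : 0 < jump.
Proof.
have := E1 => E1'; have := Ei0 => Ei0'; have := Ei1 => Ei1'.
have /andP[r0 r1] := rho01.
rewrite /jump; apply: divr_gt0 => //; apply: divr_gt0; last by rewrite exprn_gt0.
apply: mulr_gt0; first by lra.
by rewrite subr_gt0 -exprVn exprn_ilt1// ltW.
Qed.

Let geo_le : \sum_(j < M) rho ^+ j <= (1 - rho)^-1.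
Proof.
have /andP[r0 r1] := rho01.
have h : (1 - rho) * \sum_(j < M) rho ^+ j <= 1.
  rewrite -[X in (X - _) * _](expr1n _ M).
  have := subrX1 rho M; rewrite expr1n => hh.
  have : 0 <= rho ^+ M by rewrite exprn_ge0// ltW.
  move: hh; move: (\sum_(i < M) _) => S; move: (rho ^+ M) => X hh X0.
  by nra.
by rewrite -[leRHS]mul1r ler_pdivlMr; [rewrite mulrC|lra].
Qed.

(* [t] is the smallest value of the free part of the argument; the increment
   paid for the jump is absorbed by the drop from [t + q (1 - E^-2)] to [t]. *)
Let jump_absorbed (q t : R) : 0 <= q -> q / E ^+ 2 <= t ->
  forall (x : nat -> R), (forall j, t <= x j) ->
  \sum_(j < M) rho ^+ j * (f (x j + jump * q) - f (x j))
  <= 4^-1 * (f (t + q * (1 - E ^- 2)) - f t).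
Proof.
have := E1 => E1'; have := Ei0 => Ei0'; have := Ei1 => Ei1'.
move=> q0 qt x tx; have /andP[r0 r1] := rho01.
have [->|qn0] := eqVneq q 0.
  rewrite mul0r addr0 subrr mulr0 big1 // => i _.
  by rewrite addr0 subrr mulr0.
have qp : 0 < q by rewrite lt_def qn0.
have D0 : 0 < 1 - E ^- 2 by rewrite subr_gt0 -exprVn exprn_ilt1// ltW.
have t0 : 0 < t by apply: lt_le_trans qt; rewrite divr_gt0// exprn_gt0.
have J0 := jump_gt0.
have /andP[v0 v1] := v01.
have k0 : 0 <= v * t `^ (v - 1) by rewrite mulr_ge0 ?powR_ge0// ltW.
set Y := t + q * (1 - E ^- 2).
have Y0 : 0 < Y by rewrite addr_gt0// mulr_gt0.
(* By [q / E ^+ 2 <= t] the ends [t] and [Y] of the drop are comparable, hence so are the slopes of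
   [f] there. *)
have YE : Y <= E ^+ 2 * t.
  have : E ^+ 2 * (1 - E ^- 2) = E ^+ 2 - 1.
    by rewrite mulrBr mulr1 divff// expf_neq0// gt_eqF.
  move=> h; rewrite /Y.
  have qt' : q <= E ^+ 2 * t.
    by rewrite mulrC -ler_pdivrMr// exprn_gt0.
  have : q * (1 - E ^- 2) <= E ^+ 2 * t * (1 - E ^- 2) by apply: ler_wpM2r => //; exact: ltW.
  by rewrite mulrAC h; lra.
have slope s : t <= s -> s `^ (v - 1) <= t `^ (v - 1).
  move=> ts; have -> : v - 1 = - (1 - v) by ring.
  rewrite !powRN lef_pV2 ?posrE ?powR_gt0//; last exact: lt_le_trans ts.
  by apply: ge0_ler_powR; rewrite ?nnegrE; lra.
have slopeY : t `^ (v - 1) <= E ^+ 2 * Y `^ (v - 1).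
  have E20 : 0 < E ^+ 2 by rewrite exprn_gt0.
  have -> : v - 1 = - (1 - v) by ring.
  rewrite !powRN -ler_pdivrMl// -invfM lef_pV2 ?posrE ?powR_gt0 ?mulr_gt0 ?powR_gt0//.
  apply: (@le_trans _ _ ((E ^+ 2 * t) `^ (1 - v))).
    by apply: ge0_ler_powR; rewrite ?nnegrE ?subr_ge0// ?mulr_ge0// ltW.
  rewrite powRM; [|exact: ltW|exact: ltW].
  apply: ler_wpM2r; first exact: powR_ge0.
  by apply: ler1_powR; [rewrite exprn_ege1// ltW|rewrite gerBl ltW].
have incr j : f (x j + jump * q) - f (x j) <= v * t `^ (v - 1) * (jump * q).
  have xj0 : 0 < x j by apply: lt_le_trans (tx j).
  have := @powR_tangent R v (x j + jump * q) (x j) v01.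
  rewrite addrAC subrr add0r => h.
  have {}h := h _ xj0.
  rewrite lerBlDl; apply: (le_trans (h _)); first by rewrite addr_ge0// ltW// mulr_gt0.
  rewrite lerD2l; apply: ler_wpM2r; first by rewrite ltW// mulr_gt0.
  by apply: ler_wpM2l; [exact: ltW|exact: slope].
apply: (@le_trans _ _ ((1 - rho)^-1 * (v * t `^ (v - 1) * (jump * q)))).
  apply: (@le_trans _ _ (\sum_(j < M) rho ^+ j * (v * t `^ (v - 1) * (jump * q)))).
    by apply: ler_sum => i _; apply: ler_wpM2l; [rewrite exprn_ge0// ltW|].
  rewrite -mulr_suml; apply: ler_wpM2r; last exact: geo_le.
  by rewrite mulr_ge0// mulr_ge0// ltW.
have gain : v * Y `^ (v - 1) * (q * (1 - E ^- 2)) <= f Y - f t.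
  have := @powR_tangent R v t Y v01 (ltW t0) Y0.
  have -> : t - Y = - (q * (1 - E ^- 2)) by rewrite /Y; ring.
  by rewrite /f; lra.
apply: le_trans (ler_wpM2l _ gain); last by lra.
have -> : (1 - rho)^-1 * (v * t `^ (v - 1) * (jump * q)) =
    4^-1 * (v * (E ^- 2 * t `^ (v - 1)) * (q * (1 - E ^- 2))).
  by rewrite /jump; field; apply/andP; split; rewrite gt_eqF; lra.
apply: ler_wpM2l; first lra.
apply: ler_wpM2r; first by rewrite ltW// mulr_gt0.
apply: ler_wpM2l; first lra.
by rewrite mulrC ler_pdivrMr ?exprn_gt0// mulrC.
Qed.

(* Both laws tilt by [rho ^ 2] over two lattice steps, so that the two mixed
   terms of the left-hand side are exact shifts of the right-hand side. *)
Lemma cell_le (p q r : R) : 0 <= p -> 0 <= q -> 0 <= r -> (0 < M)%N ->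
  \sum_(j < M) rho ^+ j *
    (bias_up * (2^-1 * (r + (p + q * E) * E ^+ j / E + jump * q) `^ v
              + 2^-1 * (r + (p + q * E^-1) * E ^+ j / E + jump * q) `^ v)
   + bias_down * (2^-1 * (r + (p + q * E) * E ^+ j / E^-1 + jump * q) `^ v
              + 2^-1 * (r + (p + q * E^-1) * E ^+ j / E^-1 + jump * q) `^ v))
  <= (1 + cutoff_err) * \sum_(j < M) rho ^+ j *
      (bias_up * (r + (p / E + q) * E ^+ j) `^ v
     + bias_down * (r + (p / E^-1 + q) * E ^+ j) `^ v).
Proof.
have := E1 => E1'; have := Ei0 => Ei0'; have := Ei1 => Ei1'; have := EE => EE'.
move=> p0 q0 r0 M0; have /andP[rh0 rh1] := rho01.
have /andP[v0 v1] := v01.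
(* The pairs [(x, e)] produce the coefficients [al], [ta], [al * E ^+ 2] and [be], whereas the
   right-hand side has [al] and [be]. Since [be = ta * E ^+ 2], the terms of [(E, E^-1)] and
   [(E^-1, E)] are shifts by two of those of [be] and [al]. *)
pose al := p / E + q; pose be := p * E + q; pose ta := p / E + q / E ^+ 2.
have En0 : E != 0 by rewrite gt_eqF.
have Ej j : 1 <= E ^+ j by rewrite exprn_ege1// ltW.
have al0 : 0 <= al by rewrite addr_ge0// divr_ge0// ltW.
have be0 : 0 <= be by rewrite addr_ge0// mulr_ge0// ltW.
have E2i : E ^- 2 = E^-1 * E^-1 by rewrite expr2 invfM.
have ta0 : 0 <= ta by rewrite addr_ge0// divr_ge0// ?exprn_ge0// ltW.
have E2i1 : E ^- 2 <= 1 by rewrite E2i mulr_ile1// ltW.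
have taal : ta <= al by rewrite /ta /al lerD2l ler_piMr.
pose G (x : R) j := f (r + x * E ^+ j).
pose G' (x : R) j := f (r + x * E ^+ j + jump * q).
have J0 := jump_gt0.
have absorb x : ta <= x ->
  \sum_(j < M) rho ^+ j * G' x j <= \sum_(j < M) rho ^+ j * G x j
     + 4^-1 * (f (r + al) - f (r + ta)).
  move=> tx.
  have h := @jump_absorbed q (r + ta) q0 _ (fun j => r + x * E ^+ j).
  have {}h := h _ _; rewrite -lerBlDl -sumrB.
  under eq_bigr do rewrite -mulrBr.
  have -> : r + al = r + ta + q * (1 - E ^- 2) by rewrite /al /ta; ring.
  apply: h.
    rewrite /ta; have : 0 <= p / E by rewrite divr_ge0// ltW.
    by move: (p / E) (q / E ^+ 2) => A B; lra.
  by move=> j; rewrite lerD2l (le_trans tx)// ler_peMr// (le_trans ta0).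
have T1 j : (r + (p + q * E) * E ^+ j / E + jump * q) `^ v = G' al j.
  by rewrite /G' /f /al; congr (_ `^ _); field.
have T2 j : (r + (p + q * E^-1) * E ^+ j / E + jump * q) `^ v = G' ta j.
  by rewrite /G' /f /ta; congr (_ `^ _); field.
have T3 j : (r + (p + q * E) * E ^+ j / E^-1 + jump * q) `^ v = G' al j.+2.
  by rewrite /G' /f /al; congr (_ `^ _); rewrite !exprS; field.
have T4 j : (r + (p + q * E^-1) * E ^+ j / E^-1 + jump * q) `^ v = G' be j.
  by rewrite /G' /f /be; congr (_ `^ _); field.
have T5 j : (r + (p / E^-1 + q) * E ^+ j) `^ v = G be j.
  by rewrite /G /f /be invrK.
have T6 j : (r + (p / E + q) * E ^+ j) `^ v = G al j by [].
under eq_bigr do rewrite T1 T2 T3 T4.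
under [X in _ <= _ * X]eq_bigr do rewrite T5 T6.
have bu0 : 0 < bias_up by apply: lt_le_trans bias_up_ge.
set bu := bias_up in bu0 *.
rewrite bias_downE -/bu.
have L : \sum_(j < M) rho ^+ j * (bu * (2^-1 * G' al j + 2^-1 * G' ta j) +
       bu * rho ^+ 2 * (2^-1 * G' al j.+2 + 2^-1 * G' be j)) =
   2^-1 * bu * (\sum_(j < M) rho ^+ j * G' al j + \sum_(j < M) rho ^+ j * G' ta j
    + \sum_(j < M) rho ^+ j.+2 * G' al j.+2 + rho ^+ 2 * \sum_(j < M) rho ^+ j * G' be j).
  rewrite [rho ^+ 2 * _]mulr_sumr -!big_split/= mulr_sumr; apply: eq_bigr => j _.
  by rewrite !exprS; ring.
have Rr : \sum_(j < M) rho ^+ j * (bu * G al j + bu * rho ^+ 2 * G be j) =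
  bu * (\sum_(j < M) rho ^+ j * G al j + rho ^+ 2 * \sum_(j < M) rho ^+ j * G be j).
  by rewrite [rho ^+ 2 * _]mulr_sumr -big_split/= mulr_sumr; apply: eq_bigr => j _; ring.
rewrite L Rr.
have al2 : ta <= al * E ^+ 2 by rewrite (le_trans taal)// ler_peMr.
have A1 := absorb al taal.
have A2 := absorb ta (lexx _).
have A3 : \sum_(j < M) rho ^+ j.+2 * G' al j.+2 <=
    rho ^+ 2 * (\sum_(j < M) rho ^+ j * G (al * E ^+ 2) j
      + 4^-1 * (f (r + al) - f (r + ta))).
  apply: le_trans (ler_wpM2l _ (absorb _ al2)); last by rewrite exprn_ge0// ltW.
  rewrite mulr_sumr le_eqVlt; apply/orP; left; apply/eqP; apply: eq_bigr => j _.
  rewrite mulrA -exprD /G'; congr (_ * f (_ + _ + _)).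
  by rewrite -mulrA -exprD.
have tabe : ta <= be.
  rewrite /ta /be lerD ?ler_piMr// ler_wpM2l//.
  by rewrite (le_trans (ltW Ei1'))// ltW.
have A4 := absorb be tabe.
have B3 : rho ^+ 2 * \sum_(j < M) rho ^+ j * G (al * E ^+ 2) j =
    \sum_(j < M) rho ^+ j.+2 * G al j.+2.
  rewrite mulr_sumr; apply: eq_bigr => j _.
  by rewrite mulrA -exprD /G -mulrA -exprD.
rewrite (sum_shift2 rho (G al) M) in B3.
(* In this shift the terms at the upper end have the favourable sign and are dropped; those of [B3]
   have the other sign and are the source of [cutoff_err]. *)
have B2 : \sum_(j < M) rho ^+ j * G ta j <=
   rho ^+ 2 * (\sum_(j < M) rho ^+ j * G be j) + G ta 0%N + rho * G ta 1%N.
  have := sum_shift2 rho (G ta) M.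
  have -> : \sum_(j < M) rho ^+ j.+2 * G ta j.+2 = rho ^+ 2 * (\sum_(j < M) rho ^+ j * G be j).
    rewrite mulr_sumr; apply: eq_bigr => j _.
    rewrite mulrA -exprD /G; congr (_ * f (_ + _)).
    by rewrite /ta /be !exprS; field.
  move=> ->; rewrite -!addrA.
  have : 0 <= rho ^+ M * G ta M by rewrite mulr_ge0 ?f_ge0// exprn_ge0// ltW.
  have : 0 <= rho ^+ M.+1 * G ta M.+1 by rewrite mulr_ge0 ?f_ge0// exprn_ge0// ltW.
  by lra.
have F1 : G ta 1%N <= G al 1%N.
  rewrite /G expr1; apply: f_le; first by rewrite addr_ge0// mulr_ge0// ltW.
  by rewrite lerD2l ler_wpM2r// ltW.
have Gal0 : G al 0%N = f (r + al) by rewrite /G expr0 mulr1.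
have Gta0 : G ta 0%N = f (r + ta) by rewrite /G expr0 mulr1.
have top k : (k <= M.+1)%N -> G al k <= E `^ (M.+1%:R * v) * f (r + al).
  move=> kM.
  apply: (@le_trans _ _ (f (E ^+ M.+1 * (r + al)))).
    apply: f_le; first by rewrite addr_ge0// mulr_ge0// exprn_ge0// ltW.
    have : E ^+ k <= E ^+ M.+1 by apply: ler_weXn2l => //; exact: ltW.
    move=> kM'; rewrite mulrDr lerD//; first by rewrite ler_peMl.
    by rewrite mulrC ler_wpM2r.
  rewrite /f powRM; [|by rewrite exprn_ge0// ltW|by rewrite addr_ge0].
  by rewrite -powR_mulrn -?powRrM//; exact: ltW.
have tM := top M (leqnSn _); have tM1 := top M.+1 (leqnn _).
have falR : f (r + al) <= \sum_(j < M) rho ^+ j * G al j.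
  rewrite -Gal0 (bigD1 (Ordinal M0))//= expr0 mul1r lerDl sumr_ge0// => j _.
  by rewrite mulr_ge0 ?f_ge0// exprn_ge0// ltW.
have Sbe0 : 0 <= \sum_(j < M) rho ^+ j * G be j.
  by rewrite sumr_ge0// => j _; rewrite mulr_ge0 ?f_ge0// exprn_ge0// ltW.
have rM0 : 0 <= rho ^+ M by rewrite exprn_ge0// ltW.
have rM1 : rho ^+ M.+1 <= rho ^+ M by rewrite exprS ler_piMl// ltW.
have rM10 : 0 <= rho ^+ M.+1 by rewrite exprn_ge0// ltW.
have fal0 := f_ge0 (r + al).
have ftaal : f (r + ta) <= f (r + al) by apply: f_le; [rewrite addr_ge0|rewrite lerD2l].
have C1 : rho ^+ M * G al M + rho ^+ M.+1 * G al M.+1 <= 2 * (cutoff_err * f (r + al)).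
  rewrite /cutoff_err; set X := E `^ _ in tM tM1 *.
  have X0 : 0 <= X by exact: powR_ge0.
  have : rho ^+ M * G al M <= rho ^+ M * (X * f (r + al)) by apply: ler_wpM2l.
  have : rho ^+ M.+1 * G al M.+1 <= rho ^+ M * (X * f (r + al)).
    by apply: ler_pM => //; exact: f_ge0.
  move=> h1 h2; apply: (le_trans (lerD h2 h1)).
  by rewrite -mulr2n mulr_natl mulrA.
have ce0 : 0 <= cutoff_err by rewrite /cutoff_err mulr_ge0 ?powR_ge0.
have rsq0 : 0 <= rho ^+ 2 by rewrite exprn_ge0// ltW.
have rsq1 : rho ^+ 2 <= 1 by rewrite exprn_ile1// ltW.
have F1' : rho * G ta 1%N <= rho * G al 1%N by apply: ler_wpM2l => //; exact: ltW.
have dfr : rho ^+ 2 * (f (r + al) - f (r + ta)) <= f (r + al) - f (r + ta).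
  by rewrite ler_piMl// subr_ge0.
have C2 : cutoff_err * f (r + al) <= cutoff_err * \sum_(j < M) rho ^+ j * G al j.
  by apply: ler_wpM2l.
have C3 : 0 <= cutoff_err * (rho ^+ 2 * \sum_(j < M) rho ^+ j * G be j).
  by rewrite mulr_ge0// mulr_ge0.
rewrite mulrCA -mulrA [2^-1 * _]mulrCA ler_pM2l//.
rewrite Gal0 -addrA in B3; rewrite Gta0 in B2.
exact: (@cell_arith _ _ _ _ _ _ _ _ _ _ _ _ _ _ _ _ A1 A2 A3 A4 B3 B2 F1' C1 C2 C3).
Qed.

End cell.

(** * The discrete polymer with boundary *)

Section averages.
Context {R : realType}.
Implicit Types (mu nu : seq (R * R)) (f g : R -> R) (F G : (nat -> R) -> R).

(** A law is a finite list of pairs of a weight and a value: averages over boundary and two-point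
    noise are finite sums, free of measurability questions. *)
Definition wavg mu f := \sum_(p <- mu) p.1 * f p.2.

Definition scons (x : R) (s : nat -> R) : nat -> R :=
  fun k => if k is k'.+1 then s k' else x.

(* The coordinates of index at least [n] are set to [1]. *)
Fixpoint wavgn mu n F : R :=
  if n is n'.+1 then wavg mu (fun x => wavgn mu n' (fun s => F (scons x s)))
  else F (fun=> 1).

Definition mass mu := \sum_(p <- mu) p.1.

Definition pos_law mu := forall p, p \in mu -> 0 <= p.1 /\ 0 < p.2.

Lemma wavgD mu f g : wavg mu (fun x => f x + g x) = wavg mu f + wavg mu g.
Proof. by rewrite -big_split; apply: eq_bigr => p _; rewrite mulrDr. Qed.

Lemma wavgZ mu a f : wavg mu (fun x => a * f x) = a * wavg mu f.
Proof. by rewrite /wavg mulr_sumr; apply: eq_bigr => p _; rewrite mulrCA. Qed.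

Lemma wavg0 mu : wavg mu (fun=> 0) = 0.
Proof. by rewrite /wavg big1// => p _; rewrite mulr0. Qed.

Lemma wavg_sum mu (I : Type) (s : seq I) (f : I -> R -> R) :
  wavg mu (fun x => \sum_(i <- s) f i x) = \sum_(i <- s) wavg mu (f i).
Proof.
elim: s => [|i s IH]; first by rewrite big_nil -[RHS](wavg0 mu); congr wavg; apply/funext => x; rewrite big_nil.
by rewrite big_cons -IH -wavgD; congr wavg; apply/funext => x; rewrite big_cons.
Qed.

Lemma wavg_swap mu nu (f : R -> R -> R) :
  wavg mu (fun x => wavg nu (f x)) = wavg nu (fun y => wavg mu (fun x => f x y)).
Proof.
rewrite wavg_sum; apply: eq_bigr => p _.
by rewrite -wavgZ.
Qed.

Lemma le_wavg mu f g : pos_law mu -> (forall x, 0 < x -> f x <= g x) ->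
  wavg mu f <= wavg mu g.
Proof.
move=> mu0 fg; rewrite /wavg big_seq [leRHS]big_seq; apply: ler_sum => p pm.
by have [p1 p2] := mu0 _ pm; rewrite ler_wpM2l// fg.
Qed.

Lemma wavgnD mu n F G :
  wavgn mu n (fun s => F s + G s) = wavgn mu n F + wavgn mu n G.
Proof.
elim: n F G => [//|n IH] F G /=; rewrite -wavgD; congr wavg; apply/funext => x.
by rewrite IH.
Qed.

Lemma wavgnZ mu n a F : wavgn mu n (fun s => a * F s) = a * wavgn mu n F.
Proof.
elim: n F => [//|n IH] F /=; rewrite -wavgZ; congr wavg; apply/funext => x.
by rewrite IH.
Qed.

Lemma wavgn0 mu n : wavgn mu n (fun=> 0) = 0.
Proof. by elim: n => [//|n IH] /=; rewrite IH wavg0. Qed.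

Lemma wavgn_swap mu nu n (F : (nat -> R) -> R -> R) :
  wavgn mu n (fun s => wavg nu (F s)) = wavg nu (fun y => wavgn mu n (fun s => F s y)).
Proof.
elim: n F => [//|n IH] F /=; rewrite wavg_swap; congr wavg; apply/funext => x.
by rewrite (IH (fun s => F (scons x s))).
Qed.

Lemma wavgn_wavgn_swap mu nu n m (F : (nat -> R) -> (nat -> R) -> R) :
  wavgn mu n (fun s => wavgn nu m (F s)) = wavgn nu m (fun t => wavgn mu n (fun s => F s t)).
Proof.
elim: n F => [//|n IH] F /=; rewrite wavgn_swap; congr wavg; apply/funext => x.
by rewrite (IH (fun s => F (scons x s))).
Qed.

Lemma scons_gt0 x s : 0 < x -> (forall k, 0 < s k) -> forall k, 0 < scons x s k.
Proof. by move=> x0 s0 [|k]/=. Qed.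

Lemma le_wavgn mu n F G : pos_law mu ->
  (forall s, (forall k, 0 < s k) -> F s <= G s) -> wavgn mu n F <= wavgn mu n G.
Proof.
move=> mu0; elim: n F G => [|n IH] F G FG /=; first exact: FG.
apply: le_wavg => // x x0; apply: IH => s s0; apply: FG; exact: scons_gt0.
Qed.

Lemma wavg_cst mu a : wavg mu (fun=> a) = mass mu * a.
Proof. by rewrite /wavg -mulr_suml. Qed.

Lemma wavgn_cst mu n a : wavgn mu n (fun=> a) = mass mu ^+ n * a.
Proof.
elim: n => [|n IH] /=; first by rewrite expr0 mul1r.
by rewrite IH wavg_cst exprS mulrA.
Qed.

Lemma wavg_ge0 mu f : pos_law mu -> (forall x, 0 < x -> 0 <= f x) -> 0 <= wavg mu f.
Proof. by move=> mu0 f0; rewrite -(wavg0 mu); exact: le_wavg. Qed.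

End averages.

Section polymer.
Context {R : realType}.
Implicit Types (v : R) (e S w A : nat -> R).

(* [chain u w] is the boundary profile [u w_0, u w_0 w_1, ...]. *)
Fixpoint chain (u : R) w (k : nat) : R :=
  if k is k'.+1 then chain u w k' * w k else u * w 0%N.

(* Partition functions of the levels after one time step, renormalised by the
   partition function of the boundary level: [x] is the multiplicative increment of
   the latter, [u] its value and [c] the weight of a jump. *)
Fixpoint coln (c x u : R) e S (k : nat) : R :=
  if k is k'.+1 then e k / x * S k + c * coln c x u e S k'
  else e 0%N / x * S 0%N + c * u.

Lemma chain_scons u x w k : chain u (scons x w) k.+1 = chain (u * x) w k.
Proof. by elim: k => [//|k IH]; rewrite /= -IH. Qed.

Lemma coln_shift c x u e S k : coln c x u e S k.+1 =
  coln c x (coln c x u e S 0%N) (fun k => e k.+1) (fun k => S k.+1) k.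
Proof. by elim: k => [//|k IH]; rewrite /= -IH. Qed.

Lemma chain_gt0 u w : 0 < u -> (forall k, 0 < w k) -> forall k, 0 < chain u w k.
Proof. by move=> u0 w0; elim=> [|k IH] /=; rewrite mulr_gt0. Qed.

(** The last coordinate is its own [S] entry plus [c] times the coordinate below, so its coefficient
    can be moved down, which leaves a functional of one coordinate less. *)
Lemma coln_affine c x u e n r A : 0 <= c -> 0 < x -> 0 <= u ->
  (forall k, 0 <= e k) -> 0 <= r -> (forall k, 0 <= A k) ->
  exists r' A', [/\ 0 <= r', (forall k, 0 <= A' k) & forall S,
    r + \sum_(k < n) A k * coln c x u e S k = r' + \sum_(k < n) A' k * S k].
Proof.
move=> c0 x0 u0 e0; elim: n r A => [|n IH] r A r0 A0.
  by exists r, A; split => // S; rewrite !big_ord0.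
case: n IH => [|n] IH.
  exists (r + A 0%N * (c * u)), (fun k => A k * (e k / x)); split.
  - by rewrite addr_ge0// !mulr_ge0.
  - by move=> k; rewrite !mulr_ge0// invr_ge0 ltW.
  - by move=> S; rewrite !big_ord_recr !big_ord0/=; ring.
pose A1 k := if k == n then A n + c * A n.+1 else A k.
have A10 k : 0 <= A1 k by rewrite /A1; case: ifP => _; rewrite // addr_ge0// mulr_ge0.
have [r' [A' [r'0 A'0 E]]] := IH r A1 r0 A10.
exists r', (fun k => if k == n.+1 then A k * (e k / x) else A' k); split => //.
- by move=> k; case: ifP => _//; rewrite !mulr_ge0// invr_ge0 ltW.
move=> S; rewrite [in RHS]big_ord_recr/= eqxx.
have -> : \sum_(i < n.+1) (if i == n.+1 :> nat then A i * (e i / x) else A' i) * S i =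
   \sum_(i < n.+1) A' i * S i.
  by apply: eq_bigr => i _; rewrite ltn_eqF.
rewrite [RHS]addrA -E !big_ord_recr/= /A1 eqxx.
have -> : \sum_(i < n) (if i == n :> nat then A n + c * A n.+1 else A i) * coln c x u e S i =
   \sum_(i < n) A i * coln c x u e S i.
  by apply: eq_bigr => i _; rewrite ltn_eqF.
ring.
Qed.

Lemma coln_ge0 c x u e S : 0 <= c -> 0 < x -> 0 <= u -> (forall k, 0 <= e k) ->
  (forall k, 0 <= S k) -> forall k, 0 <= coln c x u e S k.
Proof.
move=> c0 x0 u0 e0 S0; elim=> [|k IH] /=; rewrite addr_ge0 ?mulr_ge0//; by rewrite ltW// invr_gt0.
Qed.

(* Positive combinations of the functions [(r + A . S)^v]. *)
Inductive power_cone v n : ((nat -> R) -> R) -> Prop :=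
| cone0 : power_cone v n (fun=> 0)
| cone_base r A of 0 <= r & (forall k, 0 <= A k) :
    power_cone v n (fun S => (r + \sum_(k < n) A k * S k) `^ v)
| cone_add F G of power_cone v n F & power_cone v n G :
    power_cone v n (fun S => F S + G S)
| cone_scale a F of 0 <= a & power_cone v n F :
    power_cone v n (fun S => a * F S).

Lemma power_cone_coln v n c x u e F : 0 <= c -> 0 < x -> 0 <= u ->
  (forall k, 0 <= e k) -> power_cone v n F -> power_cone v n (fun S => F (coln c x u e S)).
Proof.
move=> c0 x0 u0 e0; elim=> [|r A r0 A0|F1 F2 _ h1 _ h2|a F1 a0 _ h1].
- exact: cone0.
- have [r' [A' [r'0 A'0 E]]] := @coln_affine c x u e n r A c0 x0 u0 e0 r0 A0.
  have -> : (fun S => (r + \sum_(k < n) A k * coln c x u e S k) `^ v) =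
     (fun S => (r' + \sum_(k < n) A' k * S k) `^ v) by apply/funext => S; rewrite E.
  exact: cone_base.
- exact: cone_add.
- exact: cone_scale.
Qed.

Lemma power_cone_wavg v n mu (F : R -> (nat -> R) -> R) : pos_law mu ->
  (forall x, 0 < x -> power_cone v n (F x)) ->
  power_cone v n (fun S => wavg mu (fun x => F x S)).
Proof.
move=> mu0 hF; rewrite /wavg; elim: mu mu0 => [|p mu IH] mu0.
  rewrite (_ : (fun S => _) = fun=> 0); first exact: cone0.
  by apply/funext => S; rewrite big_nil.
rewrite (_ : (fun S => _) = fun S => p.1 * F p.2 S + \sum_(p <- mu) p.1 * F p.2 S); last first.
  by apply/funext => S; rewrite big_cons.
have [p1 p2] := mu0 p (mem_head _ _).
apply: cone_add; first by apply: cone_scale => //; exact: hF.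
by apply: IH => q qm; apply: mu0; rewrite in_cons qm orbT.
Qed.

Lemma power_cone_wavgn v n mu m (F : (nat -> R) -> (nat -> R) -> R) : pos_law mu ->
  (forall s, (forall k, 0 < s k) -> power_cone v n (F s)) ->
  power_cone v n (fun S => wavgn mu m (fun s => F s S)).
Proof.
move=> mu0; elim: m F => [|m IH] F hF /=; first exact: hF.
apply: (@power_cone_wavg _ _ _ (fun x S => wavgn mu m (fun s => F (scons x s) S))) => // x x0.
apply: (IH (fun s => F (scons x s))) => s s0; apply: hF; exact: scons_gt0.
Qed.

End polymer.

(** * Stationarity as an inequality for one time step of all levels *)

Section column.
Context {R : realType} (v E rho : R) (M : nat).
Hypotheses (v01 : 0 < v <= 1) (E1 : 1 < E) (rho01 : 0 < rho < 1) (M0 : (0 < M)%N).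

Definition bulk_law : seq (R * R) := [:: (2^-1, E); (2^-1, E^-1)].
Definition row_law : seq (R * R) := [:: (bias_up rho, E); (bias_down rho, E^-1)].
(* Truncated at [M] and not normalised. *)
Definition exit_law : seq (R * R) := [seq (rho ^+ j, E ^+ j) | j <- index_iota 0 M].

Let E0 : 0 < E. Proof. exact: lt_trans E1. Qed.

Lemma bulk_law_pos : pos_law bulk_law.
Proof.
by move=> p; rewrite !inE => /orP[]/eqP->/=; split => //; rewrite invr_gt0.
Qed.

Lemma row_law_pos : pos_law row_law.
Proof.
have [r0 _] := andP rho01.
move=> p; rewrite !inE => /orP[]/eqP->/=; split => //.
- by rewrite /bias_up invr_ge0 addr_ge0// exprn_ge0// ltW.
- by rewrite /bias_down divr_ge0 ?addr_ge0// exprn_ge0// ltW.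
- by rewrite invr_gt0.
Qed.

Lemma exit_law_pos : pos_law exit_law.
Proof.
have [r0 _] := andP rho01.
by move=> p /mapP[j _ ->] /=; rewrite exprn_ge0 ?exprn_gt0// ltW.
Qed.

Lemma cutoff_err_ge0 : 0 <= cutoff_err v E rho M.
Proof.
by have [r0 _] := andP rho01; rewrite /cutoff_err mulr_ge0 ?powR_ge0// exprn_ge0// ltW.
Qed.

Lemma wavg_exit f : wavg exit_law f = \sum_(j < M) rho ^+ j * f (E ^+ j).
Proof. by rewrite /wavg big_map big_mkord. Qed.

(** For the updated pair [w' = e * w / x + jump E rho] and [x' = w' * x / w], the integrand on the
    left is [(r + (p / x' + q) * w') ^ v]: the same function as on the right, at the new pair
    instead of the old one. *)
Lemma cell_wavg (p q r : R) : 0 <= p -> 0 <= q -> 0 <= r ->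
  wavg row_law (fun x => wavg bulk_law (fun e => wavg exit_law (fun w =>
    (r + (p + q * e) * w / x + jump E rho * q) `^ v)))
  <= (1 + cutoff_err v E rho M) *
  wavg row_law (fun x => wavg exit_law (fun w => (r + (p / x + q) * w) `^ v)).
Proof.
move=> p0 q0 r0; have := @cell_le R v E rho M v01 E1 rho01 p q r p0 q0 r0 M0.
have two (a b x y : R) f : wavg [:: (a, x); (b, y)] f = a * f x + b * f y.
  by rewrite /wavg !big_cons big_nil addr0.
rewrite /row_law /bulk_law !two !wavg_exit => h.
apply: (le_trans _ (le_trans h _)); rewrite le_eqVlt; apply/orP; left; apply/eqP.
  rewrite !mulr_sumr -?big_split/=; rewrite !mulr_sumr -!big_split/=; apply: eq_bigr => j _; ring.
by congr (_ * _); rewrite !mulr_sumr -big_split; apply: eq_bigr => j _ /=; ring.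
Qed.

Let c := jump E rho.
Let c0 : 0 <= c. Proof. by apply: ltW; exact: jump_gt0. Qed.

(** The row increment [x] stays fixed; [u] and [u'] are the values just below the [n] levels, after
    and before the time step. *)
Let Y n r (A : nat -> R) x u u' := wavgn bulk_law n (fun e => wavgn exit_law n (fun w =>
  (r + \sum_(k < n) A k * coln c x u e (chain u' w) k) `^ v)).

Let Y_rec n r A x u u' : Y n.+1 r A x u u' =
  wavg bulk_law (fun e => wavg exit_law (fun w =>
    Y n (r + A 0%N * (e / x * (u' * w) + c * u)) (fun k => A k.+1) x
      (e / x * (u' * w) + c * u) (u' * w))).
Proof.
rewrite {1}/Y /=; congr wavg; apply/funext => e0.
rewrite wavgn_swap; congr wavg; apply/funext => w0.
rewrite /Y; congr wavgn; apply/funext => e; congr wavgn; apply/funext => w.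
congr (_ `^ _); rewrite big_ord_recl addrA; congr (_ + _).
apply: eq_bigr => k _; rewrite coln_shift.
by congr (_ * coln _ _ _ _ _ _); apply/funext => j; rewrite chain_scons.
Qed.

(** Every old value is [u'] times ratios and is divided by [x], so the levels above a cell see [x]
    only through [u' / x]. This is the dependence that [cell_wavg] can treat at the level below. *)
Let Y_form n A : (forall k, 0 <= A k) ->
  exists L : seq (R * (R * R)), (forall l, l \in L -> [/\ 0 <= l.1, 0 <= l.2.1 & 0 <= l.2.2]) /\
   forall r x u u', Y n r A x u u' = \sum_(l <- L) l.1 * (r + l.2.1 * u + l.2.2 * (u' / x)) `^ v.
Proof.
elim: n A => [|n IH] A A0.
  exists [:: (1, (0, 0))]; split; first by move=> l; rewrite inE => /eqP->/=.
  by move=> r x u u'; rewrite /Y/= big_ord0 big_cons big_nil/= !mul0r !addr0 mul1r.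
have [L [L0 LE]] := IH (fun k => A k.+1) (fun k => A0 k.+1).
exists [seq (z.1.1 * (z.2.1 * l.1), ((A 0%N + l.2.1) * c,
    (A 0%N + l.2.1) * (z.1.2 * z.2.2) + l.2.2 * z.2.2)) |
   z <- [seq (pe, pw) | pe <- bulk_law, pw <- exit_law], l <- L]; split.
  move=> _ /allpairsP[[z l] [hz hl ->]].
  case/allpairsP: hz => [[pe pw] [hpe hpw ez]]; rewrite /= in ez hpe hpw hl; rewrite ez /=.
  have [pe1 pe2] := bulk_law_pos hpe; have [pw1 pw2] := exit_law_pos hpw.
  have [l1 l2 l3] := L0 _ hl; have a0 := A0 0%N.
  have pa : 0 <= A 0%N + l.2.1 by exact: addr_ge0.
  split; [exact: mulr_ge0 (mulr_ge0 _ _)|exact: mulr_ge0|].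
  by apply: addr_ge0; apply: mulr_ge0; rewrite // ltW// mulr_gt0.
move=> r x u u'; rewrite Y_rec big_allpairs_dep big_allpairs_dep /wavg.
apply: eq_bigr => pe _; rewrite mulr_sumr; apply: eq_bigr => pw _.
rewrite LE !mulr_sumr; apply: eq_bigr => l _ /=.
rewrite -!mulrA; congr (_ * (_ * (_ * _ `^ _))).
ring.
Qed.

(** Induction from the lowest level upwards: [Y_form] sums out the levels above, the cell inequality
    removes the noise of the lowest level, and the row increment is handed on, with its law
    unchanged, as the boundary of the next cell. *)
Let column_base n r A u : 0 <= r -> (forall k, 0 <= A k) -> 0 <= u ->
  wavg row_law (fun x => Y n r A x u u) <=
  (1 + cutoff_err v E rho M) ^+ n * (wavg row_law (fun=> 1) *
   wavgn exit_law n (fun w => (r + \sum_(k < n) A k * chain u w k) `^ v)).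
Proof.
have ce0 : 0 <= 1 + cutoff_err v E rho M by rewrite addr_ge0// cutoff_err_ge0.
elim: n r A u => [|n IH] r A u r0 A0 u0.
  rewrite expr0 mul1r /Y/= mulrC -wavgZ.
  rewrite le_eqVlt; apply/orP; left; apply/eqP; congr wavg; apply/funext => x.
  by rewrite mulr1 !big_ord0.
have [L [L0 LE]] := @Y_form n (fun k => A k.+1) (fun k => A0 k.+1).
have -> : (fun x => Y n.+1 r A x u u) = (fun x => \sum_(l <- L) l.1 *
   wavg bulk_law (fun e => wavg exit_law (fun w =>
    (r + (l.2.2 * u + (A 0%N + l.2.1) * u * e) * w / x + c * ((A 0%N + l.2.1) * u)) `^ v))).
  apply/funext => x; rewrite Y_rec.
  under eq_bigr do rewrite -wavgZ.
  rewrite -wavg_sum; congr wavg; apply/funext => e.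
  under eq_bigr do rewrite -wavgZ.
  rewrite -wavg_sum; congr wavg; apply/funext => w.
  by rewrite LE; apply: eq_bigr => l _; congr (_ * _ `^ _); ring.
rewrite wavg_sum.
apply: (@le_trans _ _ (\sum_(l <- L) l.1 * ((1 + cutoff_err v E rho M) *
   wavg row_law (fun x => wavg exit_law (fun w =>
    (r + (l.2.2 * u / x + (A 0%N + l.2.1) * u) * w) `^ v))))).
  rewrite big_seq [leRHS]big_seq; apply: ler_sum => l lL.
  have [l1 l2 l3] := L0 _ lL; have a0 := A0 0%N.
  rewrite wavgZ; apply: ler_wpM2l => //; apply: cell_wavg => //.
    exact: mulr_ge0.
  by rewrite mulr_ge0// addr_ge0.
under eq_bigr do rewrite mulrCA -wavgZ.
rewrite -mulr_sumr exprS -mulrA; apply: ler_wpM2l => //.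
rewrite -wavg_sum.
apply: (@le_trans _ _ (wavg exit_law (fun w => wavg row_law (fun x =>
  Y n (r + A 0%N * (u * w)) (fun k => A k.+1) x (u * w) (u * w))))).
  rewrite wavg_swap le_eqVlt; apply/orP; left; apply/eqP.
  congr wavg; apply/funext => x; under eq_bigr do rewrite -wavgZ.
  rewrite -wavg_sum; congr wavg; apply/funext => w; rewrite LE; apply: eq_bigr => l _.
  by congr (_ * _ `^ _); ring.
rewrite /= mulrCA mulrA -wavgZ; apply: le_wavg; first exact: exit_law_pos.
move=> w w0; have a0 := A0 0%N.
apply: (le_trans (IH _ _ _ _ _ _)) => //; first by rewrite addr_ge0// !mulr_ge0// ltW.
  by rewrite mulr_ge0// ltW.
rewrite mulrA le_eqVlt; apply/orP; left; apply/eqP; rewrite [_ * wavg _ _]mulrC; congr (_ * _).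
congr wavgn; apply/funext => s; rewrite big_ord_recl addrA /=; congr ((_ + _) `^ _).
by apply: eq_bigr => k _; rewrite -chain_scons.
Qed.

Lemma row_law_mass : wavg row_law (fun=> 1) = 1.
Proof.
rewrite /wavg !big_cons big_nil addr0/= !mulr1 /bias_up /bias_down -[X in X + _]mul1r -mulrDl divff//.
by rewrite gt_eqF// addr_gt0// exprn_gt0//; case/andP: rho01.
Qed.

Lemma column_le n F : power_cone v n F ->
  wavg row_law (fun x => wavgn bulk_law n (fun e =>
    wavgn exit_law n (fun w => F (coln (jump E rho) x 1 e (chain 1 w)))))
  <= (1 + cutoff_err v E rho M) ^+ n * wavgn exit_law n (fun w => F (chain 1 w)).
Proof.
elim=> [|r A r0 A0|F1 F2 _ h1 _ h2|a F1 a0 _ h1].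
- rewrite wavgn0 mulr0 (_ : (fun x => _) = fun=> 0) ?wavg0//.
  by apply/funext => x; rewrite -[RHS](wavgn0 bulk_law n); congr wavgn; apply/funext => e; rewrite wavgn0.
- by have := @column_base n r A 1 r0 A0 ler01; rewrite row_law_mass mul1r.
- rewrite wavgnD mulrDr; apply: le_trans (lerD h1 h2); rewrite -wavgD.
  rewrite le_eqVlt; apply/orP; left; apply/eqP; congr wavg; apply/funext => x.
  by rewrite -wavgnD; congr wavgn; apply/funext => e; rewrite wavgnD.
- rewrite wavgnZ mulrCA; apply: le_trans (ler_wpM2l a0 h1); rewrite -wavgZ.
  rewrite le_eqVlt; apply/orP; left; apply/eqP; congr wavg; apply/funext => x.
  by rewrite -wavgnZ; congr wavgn; apply/funext => e; rewrite wavgnZ.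
Qed.

End column.

(** * Iteration over the time steps *)

Section run.
Context {R : realType} (v c : R) (row : seq (R * R)).
Hypotheses (v01 : 0 < v <= 1) (c0 : 0 <= c) (row_pos : pos_law row).
Implicit Types (e S m : nat -> R) (F : (nat -> R) -> R) (n N : nat).

(* The noise of the [i]-th time step is [e_(n i), ..., e_(n i + n - 1)]. *)
Fixpoint run n N F S e : R :=
  if N is N'.+1 then
    wavg row (fun x => run n N' F (coln c x 1 e S) (fun k => e (n + k)%N))
  else F S.

(* The partition functions without boundary level. *)
Fixpoint bulk_run n N m e : nat -> R :=
  if N is N'.+1 then bulk_run n N' (coln c 1 0 e m) (fun k => e (n + k)%N)
  else m.

Definition upd e l y : nat -> R := fun k => if k == l then y else e k.

Definition scat n e e' : nat -> R := fun k => if (k < n)%N then e k else e' (k - n)%N.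

Lemma power_cone_ext n F S S' : power_cone v n F ->
  (forall k, (k < n)%N -> S k = S' k) -> F S = F S'.
Proof.
move=> hF SS'; elim: hF => [//|r A r0 A0|F1 F2 _ -> _ ->//|a F1 a0 _ ->//].
by congr ((_ + _) `^ _); apply: eq_bigr => k _; rewrite SS'.
Qed.

Lemma coln_ext x u e e' S S' k : (forall l, (l <= k)%N -> e l = e' l) ->
  (forall l, (l <= k)%N -> S l = S' l) ->
  coln c x u e S k = coln c x u e' S' k.
Proof.
elim: k => [|k IH] ee' SS' /=; first by rewrite ee'// SS'.
by rewrite ee'// SS'// IH// => l lk; [rewrite ee'// ltnW|rewrite SS'// ltnW].
Qed.

(** Entries of index at least [n] of a [coln] read noise that belongs to the next time step. States
    therefore agree below [n] only, and this has to suffice. *)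
Lemma run_ext n N F S S' e : power_cone v n F ->
  (forall k, (k < n)%N -> S k = S' k) -> run n N F S e = run n N F S' e.
Proof.
move=> hF; elim: N S S' e => [|N IH] S S' e SS' /=; first exact: power_cone_ext hF SS'.
congr wavg; apply/funext => x; apply: IH => k kn; apply: coln_ext => // l lk.
by rewrite SS'// (leq_ltn_trans lk).
Qed.

Lemma power_cone_run n N F e : (forall k, 0 <= e k) -> power_cone v n F ->
  power_cone v n (fun S => run n N F S e).
Proof.
move=> e0 hF; elim: N e e0 => [//|N IH] e e0 /=.
apply: (@power_cone_wavg R v n row (fun x S => run n N F (coln c x 1 e S) _)) => // x x0.
exact: (@power_cone_coln R v n c x 1 e (fun S => run n N F S _) c0 x0 ler01 e0 (IH _ _)).
Qed.

Lemma wavgn_add mu n (m : nat) (G : (nat -> R) -> R) :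
  wavgn mu (n + m) G = wavgn mu n (fun e => wavgn mu m (fun e' => G (scat n e e'))).
Proof.
elim: n G => [|n IH] G /=.
  by congr wavgn; apply/funext => e; congr G; apply/funext => k; rewrite /scat ltn0 subn0.
congr wavg; apply/funext => x; rewrite IH; congr wavgn; apply/funext => e.
congr wavgn; apply/funext => e'; congr G; apply/funext => -[|k] //.
Qed.

(** The exchange with Gaussian noise moves one variable at a time, along a line with nonnegative
    direction; only this trace of the cone is needed there. *)
Lemma power_cone_line n F S0 S1 : power_cone v n F ->
  (forall k, 0 <= S0 k) -> (forall k, 0 <= S1 k) ->
  power_cone v 1 (fun s => F (fun k => S0 k + s 0%N * S1 k)).
Proof.
move=> hF h0 h1; elim: hF => [|r A r0 A0|F1 F2 _ H1 _ H2|a F1 a0 _ H1].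
- exact: cone0.
- rewrite (_ : (fun s => _) = fun s : nat -> R =>
    (r + \sum_(k < n) A k * S0 k + \sum_(j < 1) (\sum_(k < n) A k * S1 k) * s j) `^ v).
    apply: (@cone_base R v 1 _ (fun=> _)); last first.
      by move=> _; apply: sumr_ge0 => k _; exact: mulr_ge0.
    by rewrite addr_ge0//; apply: sumr_ge0 => k _; exact: mulr_ge0.
  apply/funext => s; congr (_ `^ _); rewrite big_ord1 -addrA; congr (_ + _).
  by rewrite mulr_suml -big_split; apply: eq_bigr => k _ /=; ring.
- exact: cone_add.
- exact: cone_scale.
Qed.

Lemma coln_upd x u e S l : 0 < x -> (forall k, 0 <= e k) -> (forall k, 0 <= S k) ->
  exists2 D : nat -> R, (forall k, 0 <= D k) & forall y k,
    coln c x u (upd e l y) S k = coln c x u (upd e l 0) S k + y * D k.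
Proof.
move=> x0 e0 S0.
pose D := fix D k := (if k == l then S k / x else 0) + (if k is k'.+1 then c * D k' else 0).
have xi : 0 <= x^-1 by rewrite invr_ge0 ltW.
exists D.
  by elim=> [|k IH] /=; rewrite addr_ge0//; try (by case: ifP => // _; exact: mulr_ge0); exact: mulr_ge0.
by move=> y; elim=> [|k IH] /=; rewrite ?IH /upd; case: ifP => _; ring.
Qed.

(** A single noise entry enters one column only, affinely and with nonnegative slope ([coln_upd]),
    and the later steps preserve the cone. *)
Lemma power_cone_run_upd n N F S e l : power_cone v n F ->
  (forall k, 0 <= e k) -> (forall k, 0 <= S k) -> (l < N * n)%N ->
  power_cone v 1 (fun s => run n N F S (upd e l (s 0%N))).
Proof.
move=> hF; elim: N S e l => [//|N IH] S e l e0 S0 lN /=.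
apply: (@power_cone_wavg R v 1 row
  (fun x s => run n N F (coln c x 1 (upd e l (s 0%N)) S) (fun k => upd e l (s 0%N) (n + k)%N))) => // x x0.
have [ln|nl] := ltnP l n.
  have -> : (fun s : nat -> R => run n N F (coln c x 1 (upd e l (s 0%N)) S)
      (fun k => upd e l (s 0%N) (n + k)%N)) =
    (fun s => run n N F (coln c x 1 (upd e l (s 0%N)) S) (fun k => e (n + k)%N)).
    apply/funext => s; congr run; apply/funext => k; rewrite /upd gtn_eqF//.
    by rewrite (leq_trans ln)// leq_addr.
  have [D D0 DE] := coln_upd 1 l x0 e0 S0.
  have -> : (fun s : nat -> R => run n N F (coln c x 1 (upd e l (s 0%N)) S) (fun k => e (n + k)%N)) =
    (fun s => (fun S' => run n N F S' (fun k => e (n + k)%N))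
       (fun k => coln c x 1 (upd e l 0) S k + s 0%N * D k)).
    by apply/funext => s; congr run; apply/funext => k; rewrite DE.
  apply: (@power_cone_line n (fun S' => run n N F S' _)) => //; first by apply: power_cone_run.
  by apply: coln_ge0 => // k; rewrite /upd; case: ifP.
have -> : (fun s : nat -> R => run n N F (coln c x 1 (upd e l (s 0%N)) S)
      (fun k => upd e l (s 0%N) (n + k)%N)) =
    (fun s => run n N F (coln c x 1 (upd e l 0) S) (upd (fun k => e (n + k)%N) (l - n)%N (s 0%N))).
  apply/funext => s.
  have -> : (fun k => upd e l (s 0%N) (n + k)%N) = upd (fun k => e (n + k)%N) (l - n)%N (s 0%N).
    by apply/funext => k; rewrite /upd -[k == (l - n)%N](eqn_add2l n) subnKC.
  apply: (run_ext _ _ hF) => k kn; apply: coln_ext => // j jk.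
  by rewrite /upd !ltn_eqF// (leq_ltn_trans jk)// (leq_trans kn).
apply: IH => //; last by rewrite ltn_subLR.
by apply: coln_ge0 => // k; rewrite /upd; case: ifP.
Qed.

Lemma le_coln x u u' e S S' : 0 < x -> (forall k, 0 <= e k) -> u <= u' ->
  (forall k, S k <= S' k) -> forall k, coln c x u e S k <= coln c x u' e S' k.
Proof.
move=> x0 e0 uu SS; have xi : 0 <= x^-1 by rewrite invr_ge0 ltW.
by elim=> [|k IH] /=; rewrite lerD// ler_wpM2l// mulr_ge0.
Qed.

Lemma coln_scale x a e m k : 0 < x ->
  coln c x 0 e (fun k => a * m k) k = a / x * coln c 1 0 e m k.
Proof.
move=> x0; elim: k => [|k IH] /=; rewrite ?IH divr1; first by rewrite !mulr0 !addr0; ring.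
by rewrite mulrDr; congr (_ + _); ring.
Qed.

Lemma bulk_run_ge0 n N m e : (forall k, 0 <= e k) -> (forall k, 0 <= m k) ->
  forall k, 0 <= bulk_run n N m e k.
Proof.
elim: N m e => [//|N IH] m e e0 m0 /=.
by apply: IH => // k; exact: coln_ge0.
Qed.

(** Suppressing the boundary input [u = 1] lowers all partition functions. The boundary then acts
    through the common factor [a] alone, which is divided by [x] in each step and so contributes the
    average of [x^-1 ^ v]. *)
Lemma run_ge n N S m e a j : 0 < a ->
  (forall k, 0 <= e k) -> (forall k, 0 <= m k) -> (forall k, a * m k <= S k) ->
  wavg row (fun x => x^-1 `^ v) ^+ N * (a * bulk_run n N m e j) `^ v <=
  run n N (fun S => S j `^ v) S e.
Proof.
elim: N S m e a => [|N IH] S m e a a0 e0 m0 mS /=.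
  rewrite expr0 mul1r; apply: ge0_ler_powR => //; rewrite ?nnegrE.
  - by case/andP: v01 => /ltW.
  - by rewrite mulr_ge0// ltW.
  - by apply: le_trans (mS j); rewrite mulr_ge0// ltW.
rewrite exprS -mulrA mulrC -wavgZ; apply: le_wavg => // x x0.
have m'0 k : 0 <= coln c 1 0 e m k by apply: coln_ge0.
apply: (le_trans _ (IH _ (coln c 1 0 e m) _ (a / x) _ _ _ _)) => //; last 2 first.
- by rewrite divr_gt0.
- move=> k; rewrite -coln_scale//; apply: le_coln => //.
rewrite -mulrA; apply: ler_wpM2l.
  by apply: exprn_ge0; apply: wavg_ge0 => // y _; exact: powR_ge0.
have b0 : 0 <= bulk_run n N (coln c 1 0 e m) (fun k => e (n + k)%N) j.
  exact: bulk_run_ge0.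
rewrite -powRM; [by rewrite mulrAC|by rewrite mulr_ge0// ltW|by rewrite invr_ge0 ltW].
Qed.

(** Measurability is tested on measurable coordinates, which avoids a sigma-algebra on the space of
    sequences. *)
Definition borel (Phi : (nat -> R) -> R) := forall d (D : measurableType d) (Y : nat -> D -> R),
  (forall l, measurable_fun setT (Y l)) -> measurable_fun setT (fun w => Phi (fun l => Y l w)).

Lemma measurable_wavg d (D : measurableType d) mu (f : R -> D -> R) :
  (forall x, measurable_fun setT (f x)) -> measurable_fun setT (fun w => wavg mu (fun x => f x w)).
Proof.
move=> mf; rewrite /wavg; apply: measurable_sum => p.
by apply: measurable_funM => //; exact: measurable_cst.
Qed.

Lemma measurable_wavgn d (D : measurableType d) mu n (f : (nat -> R) -> D -> R) :
  (forall x, measurable_fun setT (f x)) -> measurable_fun setT (fun w => wavgn mu n (fun x => f x w)).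
Proof.
elim: n f => [|n IH] f mf /=; first exact: mf.
by apply: (measurable_wavg mu (f := fun x w => wavgn mu n (fun s => f (scons x s) w))) => x; exact: IH.
Qed.

Lemma measurable_run d (D : measurableType d) n N F (Y S : nat -> D -> R) : borel F ->
  (forall l, measurable_fun setT (Y l)) -> (forall l, measurable_fun setT (S l)) ->
  measurable_fun setT (fun w => run n N F (fun l => S l w) (fun l => Y l w)).
Proof.
move=> bF; elim: N Y S => [|N IH] Y S mY mS /=; first exact: bF.
apply: (measurable_wavg row (f := fun x w => run n N F (coln c x 1 (fun l => Y l w) (fun l => S l w)) _)) => x.
apply: (IH (fun k => Y (n + k)%N) (fun k w => coln c x 1 (fun l => Y l w) (fun l => S l w) k)) => //.
elim=> [|k IHk] /=; apply: measurable_funD; do ?apply: measurable_funM => //;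
  exact: measurable_cst.
Qed.

End run.

Section run_le.
Context {R : realType} (v E rho : R) (M : nat).
Hypotheses (v01 : 0 < v <= 1) (E1 : 1 < E) (rho01 : 0 < rho < 1) (M0 : (0 < M)%N).

(** The first step is split off. The remaining steps, averaged over their noise, form again a cone
    function [F'] of the profile, to which [column_le] applies. *)
Lemma run_le n N F : power_cone v n F ->
  wavgn (exit_law E rho M) n (fun w => wavgn (bulk_law E) (N * n) (fun e =>
    run (jump E rho) (row_law E rho) n N F (chain 1 w) e))
  <= (1 + cutoff_err v E rho M) ^+ (N * n) *
     wavgn (exit_law E rho M) n (fun w => F (chain 1 w)).
Proof.
have c0 : 0 <= jump E rho by apply: ltW; exact: jump_gt0.
have rp := row_law_pos E1 rho01; have bp := bulk_law_pos E1.
have ce0 : 0 <= 1 + cutoff_err v E rho M by rewrite addr_ge0// cutoff_err_ge0.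
elim: N F => [|N IH] F hF.
  by rewrite mul0n expr0 mul1r.
rewrite mulSn exprD.
pose F' S := wavgn (bulk_law E) (N * n) (fun e => run (jump E rho) (row_law E rho) n N F S e).
have hF' : power_cone v n F'.
  apply: (@power_cone_wavgn R v n _ (N * n) (fun e S => run (jump E rho) (row_law E rho) n N F S e)) => // e e0.
  by apply: power_cone_run => // k; exact: ltW.
have h := column_le v01 E1 rho01 M0 hF'.
rewrite -mulrA; apply: le_trans (ler_wpM2l _ (IH _ hF)); last exact: exprn_ge0.
apply: le_trans h; rewrite le_eqVlt; apply/orP; left; apply/eqP.
transitivity (wavgn (exit_law E rho M) n (fun w => wavg (row_law E rho) (fun x =>
    wavgn (bulk_law E) n (fun e => F' (coln (jump E rho) x 1 e (chain 1 w)))))).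
  congr wavgn; apply/funext => w; rewrite wavgn_add -wavgn_swap.
  congr wavgn; apply/funext => e; rewrite /F' -wavgn_swap.
  congr wavgn; apply/funext => e' /=; congr wavg; apply/funext => x.
  have -> : (fun k => scat n e e' (n + k)%N) = e'.
    by apply/funext => k; rewrite /scat ltnNge leq_addr/= addKn.
  apply: (@run_ext R v _ _ n N F _ _ _ hF) => k kn; apply: coln_ext => // l lk.
  by rewrite /scat (leq_ltn_trans lk).
rewrite wavgn_swap; congr wavg; apply/funext => x.
by rewrite wavgn_wavgn_swap.
Qed.

End run_le.

(** * Exchange of Gaussian and two-point noise *)

Section calculus.
Context {R : realType}.
Implicit Types (v h x y z a b : R) (f df : R -> R).

Lemma le_of_derive_ge0 f df a b : a <= b ->
  (forall x, a <= x <= b -> is_derive x 1 f (df x)) ->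
  (forall x, a <= x <= b -> 0 <= df x) -> f a <= f b.
Proof.
rewrite le_eqVlt => /predU1P[->//|ab] fdf df0.
have cf : {within `[a, b], continuous f}.
  apply: derivable_within_continuous => x; rewrite in_itv/= => xab.
  by apply: ex_derive; exact: fdf.
have fdf' x : x \in `]a, b[%R -> is_derive x 1 f (df x).
  by rewrite in_itv/= => /andP[ax xb]; apply: fdf; rewrite !ltW.
have [c cab e] := MVT ab fdf' cf.
rewrite -subr_ge0 e mulr_ge0//; last by rewrite subr_ge0 ltW.
by apply: df0; move: cab; rewrite in_itv/= => /andP[ax xb]; rewrite !ltW.
Qed.

Lemma expR_ge_quadratic x : 0 <= x -> 1 + x + x ^+ 2 / 2 <= expR x.
Proof.
move=> x0.
have := @le_of_derive_ge0 (fun x => expR x - (1 + x + x ^+ 2 / 2)) (fun x => expR x - (1 + x)) 0 x x0.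
rewrite expR0 addr0 expr0n/= mul0r addr0 subrr subr_ge0; apply.
  by move=> y _; apply: is_derive_eq => /=; rewrite !scaler1 /GRing.scale/= add0r; field.
by move=> y _; rewrite subr_ge0 expR_ge1Dx.
Qed.

Lemma expRN_le_quadratic x : 0 <= x -> expR (- x) <= 1 - x + x ^+ 2 / 2.
Proof.
move=> x0; have h := expR_ge_quadratic x0.
have e : expR x * expR (- x) = 1 by rewrite expRxMexpNx_1.
have p0 : 0 < 1 - x + x ^+ 2 / 2 by nra.
have : 1 <= (1 - x + x ^+ 2 / 2) * expR x.
  apply: le_trans (ler_wpM2l (ltW p0) h).
  have -> : (1 - x + x ^+ 2 / 2) * (1 + x + x ^+ 2 / 2) = 1 + (x ^+ 2 / 2) ^+ 2 by field.
  by rewrite lerDl sqr_ge0.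
by rewrite -ler_pdivrMr ?expR_gt0// div1r -expRN.
Qed.

Lemma expR_le_quadratic y : 0 <= y <= 2^-1 -> expR y <= 1 + y + 2 * y ^+ 2.
Proof.
move=> /andP[y0 y1].
have h := expR_ge1Dx (- y).
have e : expR y * expR (- y) = 1 by rewrite expRxMexpNx_1.
have q0 : 0 <= 1 + y + 2 * y ^+ 2 by nra.
have h1 : (1 + y + 2 * y ^+ 2) * (1 - y) >= 1.
  have -> : (1 + y + 2 * y ^+ 2) * (1 - y) = 1 + y ^+ 2 * (1 - 2 * y) by ring.
  by rewrite lerDl mulr_ge0 ?sqr_ge0//; lra.
have h2 : (1 + y + 2 * y ^+ 2) * expR (- y) >= 1 by apply: le_trans h1 _; apply: ler_wpM2l.
by rewrite -[leLHS]mulr1 -[leRHS]mulr1 -{2}e mulrCA mulrC -subr_ge0; have := expR_gt0 y; nra.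
Qed.

Lemma cosh_ge h : 0 <= h -> 1 + h ^+ 2 / 2 <= 2^-1 * expR h + 2^-1 * expR (- h).
Proof.
move=> h0.
have d (t : R) : 0 <= t -> 2 * t <= expR t - expR (- t).
  by move=> t0; have := expR_ge_quadratic t0; have := expRN_le_quadratic t0; lra.
have h20 : 0 <= h / 2 by rewrite divr_ge0.
have := d _ h20; set s := expR (h / 2); set s' := expR (- (h / 2)) => ds.
have ss : s * s' = 1 by rewrite expRxMexpNx_1.
have -> : expR h = s * s by rewrite -expRD; congr expR; field.
have -> : expR (- h) = s' * s' by rewrite -expRD; congr expR; field.
have sq : h * h <= (s - s') * (s - s').
  have : h <= s - s' by apply: le_trans ds; rewrite mulrC divfK.
  by move=> hs; apply: ler_pM.
have e : (s - s') * (s - s') = s * s + s' * s' - 2 * (s * s') by ring.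
rewrite e ss in sq; rewrite expr2; move: sq; move: (s * s) (s' * s') (h * h) => A B C; lra.
Qed.

(** Both bounds are Bernoulli's inequality with exponent [1 - v], for the bases [1 + y] and
    [(1 + y)^-1]. *)
Lemma powR_neg_bernoulli v y : 0 < v <= 1 -> -1 < y ->
  1 - (1 - v) * y <= (1 + y) `^ (v - 1) <= 1 - (1 - v) * (y / (1 + y)).
Proof.
move=> /andP[v0 v1] y1; have y0 : 0 < 1 + y by lra.
have -> : v - 1 = - (1 - v) by ring.
have [->|vn1] := eqVneq v 1; first by rewrite subrr oppr0 powRr0 !mul0r subr0 lexx.
have k01 : 0 < 1 - v <= 1 by rewrite subr_gt0 lt_neqAle vn1 v1/=; lra.
apply/andP; split.
  have h := @powR_bernoulli R (1 - v) y k01 (ltW y1).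
  have [n0|p0] := lerP (1 - (1 - v) * y) 0; first exact: le_trans n0 (powR_ge0 _ _).
  rewrite powRN -[leRHS]mul1r ler_pdivlMr ?powR_gt0//.
  apply: le_trans (ler_wpM2l (ltW p0) h) _.
  have -> : (1 - (1 - v) * y) * (1 + (1 - v) * y) = 1 - ((1 - v) * y) ^+ 2 by ring.
  by rewrite gerBl sqr_ge0.
have u1 : -1 <= - (y / (1 + y)).
  rewrite lerN2 ler_pdivrMr// mul1r; lra.
have := @powR_bernoulli R (1 - v) (- (y / (1 + y))) k01 u1.
have -> : 1 + - (y / (1 + y)) = (1 + y)^-1 by field; rewrite gt_eqF.
by rewrite -(powR_inv1 (ltW y0)) -powRrM mulN1r mulrN.
Qed.

Let rem v y := (1 + y) `^ v - (1 + v * y - v * (1 - v) / 2 * y ^+ 2).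
Let drem v y := v * ((1 + y) `^ (v - 1) - 1 + (1 - v) * y).

Let is_derive_rem v y : -1 < y -> is_derive y 1 (rem v) (drem v y).
Proof.
move=> y1; have y0 : 0 < 1 + y by lra.
have dp : is_derive (1 + y) 1 (fun x : R => x `^ v) (v * (1 + y) `^ (v - 1)) by exact: is_derive1_powR.
have d1 : is_derive y 1 (fun y : R => (1 + y)) 1.
  by have := is_deriveD (is_derive_cst (1 : R^o) (y : R^o) 1) (is_derive_id (y : R^o) 1); rewrite add0r.
have dc := @is_derive1_comp R (fun x : R => x `^ v) (fun y : R => 1 + y) y _ _ dp d1.
rewrite /rem; apply: is_derive_eq.
by rewrite /drem /GRing.scale/=; field.
Qed.

Let drem_bounds v y : 0 < v <= 1 -> -1 < y -> 0 <= drem v y <= y ^+ 2 / (1 + y).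
Proof.
move=> v01 y1; have /andP[v0 v1] := v01; have /andP[l u] := powR_neg_bernoulli v01 y1.
have y0 : 0 < 1 + y by lra.
rewrite /drem; apply/andP; split; first by apply: mulr_ge0; [exact: ltW|lra].
have q0 : 0 <= y ^+ 2 / (1 + y) by rewrite divr_ge0 ?sqr_ge0// ltW.
have e : 1 - (1 - v) * (y / (1 + y)) - 1 + (1 - v) * y = (1 - v) * (y ^+ 2 / (1 + y)).
  by field; rewrite gt_eqF.
apply: (@le_trans _ _ (v * ((1 - v) * (y ^+ 2 / (1 + y))))).
  by rewrite -e; apply: ler_wpM2l; [exact: ltW|lra].
by rewrite mulrA; apply: ler_piMl => //; nra.
Qed.

Let rem0 v : rem v 0 = 0.
Proof. by rewrite /rem addr0 powR1 !mulr0 expr0n/= mulr0; ring. Qed.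

Let rem_mono v a b : 0 < v <= 1 -> -1 < a -> a <= b -> rem v a <= rem v b.
Proof.
move=> v01 a1 ab; apply: (le_of_derive_ge0 ab (df := drem v)).
  by move=> x /andP[ax _]; apply: is_derive_rem; exact: lt_le_trans ax.
by move=> x /andP[ax _]; have /andP[] := drem_bounds v01 (lt_le_trans a1 ax).
Qed.

Let cube_rem_mono v a b : 0 < v <= 1 -> - 2^-1 <= a -> a <= b ->
  a ^+ 3 - rem v a <= b ^+ 3 - rem v b.
Proof.
move=> v01 a1 ab.
apply: (le_of_derive_ge0 ab (f := fun x => x ^+ 3 - rem v x) (df := fun x => 3 * x ^+ 2 - drem v x)).
  move=> x /andP[ax _]; have x1 : -1 < x by lra.
  have dr := is_derive_rem v x1; apply: is_derive_eq.
  by rewrite /GRing.scale/=; congr (_ - _); ring.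
move=> x /andP[ax _]; have x1 : -1 < x by lra.
have /andP[_ u] := drem_bounds v01 x1.
rewrite subr_ge0; apply: (le_trans u).
rewrite ler_pdivrMr; last by lra.
have := sqr_ge0 x; nra.
Qed.

(** [rem] is increasing on its whole range and [y ^+ 3 - rem v y] from [-1/2] on; both vanish at
    [0], so one derivative suffices for a cubic bound. For negative [y] the upper bound uses only
    the sign of [rem] and holds down to [-1], unlike the lower bound. *)
Lemma powR_taylor_le v y : 0 < v <= 1 -> -1 < y ->
  (1 + y) `^ v <= 1 + v * y - v * (1 - v) / 2 * y ^+ 2 + `|y| ^+ 3.
Proof.
move=> v01 y1; rewrite -lerBlDl -/(rem v y).
have [y0|y0] := leP 0 y.
  have h : - 2^-1 <= 0 :> R by lra.
  by have := cube_rem_mono v01 h y0; rewrite rem0 expr0n/= ger0_norm//; lra.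
by have := rem_mono v01 y1 (ltW y0); rewrite rem0 => h; rewrite (le_trans h).
Qed.

Lemma powR_taylor_ge v y : 0 < v <= 1 -> - 2^-1 <= y ->
  1 + v * y - v * (1 - v) / 2 * y ^+ 2 - `|y| ^+ 3 <= (1 + y) `^ v.
Proof.
move=> v01 y1; suff : - `|y| ^+ 3 <= rem v y by rewrite /rem; move: (v * (1 - v) / 2 * y ^+ 2) (v * y) => A B; lra.
have [y0|y0] := leP 0 y.
  have h : -1 < 0 :> R by lra.
  by have := rem_mono v01 h y0; rewrite rem0; apply: le_trans; rewrite oppr_le0 exprn_ge0.
have := cube_rem_mono v01 y1 (ltW y0); rewrite rem0 expr0n/= ltr0_norm//.
by rewrite exprNn; move: (rem v y) (y ^+ 3) => r c; rewrite -signr_odd/= expr1; lra.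
Qed.

End calculus.

(** * Gaussian moments against the two-point law *)

Section gaussian.
Context {R : realType}.
Implicit Types (v h x y z a b g s beta : R).

Lemma ge0_integral_normal_prob m s (f : measurableTypeR R -> \bar R) :
  measurable_fun setT f -> (forall x, 0 <= f x)%E ->
  (\int[normal_prob m s]_x f x = \int[lebesgue_measure]_x (f x * (normal_pdf m s x)%:E))%E.
Proof.
move=> mf f0; have dom := normal_prob_dominates m s.
rewrite -(Radon_Nikodym_SigmaFinite.change_of_variables dom)//.
have intf := Radon_Nikodym_SigmaFinite.f_integrable dom.
have mpdf : measurable_fun setT (fun x => (normal_pdf m s x)%:E).
  by apply/measurable_EFinP; exact: measurable_normal_pdf.
apply: ae_eq_integral => //.
- by apply: emeasurable_funM => //; exact: measurable_int intf.
- exact: emeasurable_funM.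
- apply: ae_eqe_mul2l; apply: integral_ae_eq => // A _ mA.
  by rewrite -Radon_Nikodym_SigmaFinite.f_integral.
Qed.

Lemma measurable_expRM k : measurable_fun setT (fun x : measurableTypeR R => expR (k * x)).
Proof. exact: measurableT_comp. Qed.

Lemma normal_mgf k s : s != 0 ->
  (\int[normal_prob 0 s]_x (expR (k * x))%:E = (expR (k ^+ 2 * s ^+ 2 / 2))%:E)%E.
Proof.
move=> s0; rewrite ge0_integral_normal_prob; last 2 first.
- by apply/measurable_EFinP; exact: measurable_expRM.
- by move=> x; rewrite lee_fin expR_ge0.
have shift x : ((expR (k * x))%:E * (normal_pdf 0 s x)%:E =
    (expR (k ^+ 2 * s ^+ 2 / 2))%:E * (normal_pdf (k * s ^+ 2) s x)%:E)%E.
  rewrite -!EFinM; congr EFin; rewrite !normal_pdfE// [LHS]mulrCA [RHS]mulrCA; congr (_ * _).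
  by rewrite /normal_fun -!expRD; congr expR; field.
under eq_integral do rewrite shift.
rewrite ge0_integralZl//; last 2 first.
- by apply/measurable_EFinP; exact: measurable_normal_pdf.
- by move=> x _; rewrite lee_fin normal_pdf_ge0.
by rewrite integral_normal_pdf mule1.
Qed.

(** Polynomials in [expR (beta * x)] have explicit Gaussian means, so powers are bounded by such
    polynomials before integrating. *)
Lemma normal_poly_exp n (a : nat -> R) beta s : s != 0 ->
  let f := fun x : measurableTypeR R => (\sum_(k < n) a k * expR (beta * x) ^+ k)%:E in
  (normal_prob 0 s).-integrable setT f /\
  (\int[normal_prob 0 s]_x f x =
   (\sum_(k < n) a k * expR ((beta * s) ^+ 2 / 2) ^+ (k ^ 2))%:E)%E.
Proof.
move=> s0 /=; elim: n => [|n [IH1 IH2]].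
  split.
    apply: (eq_integrable _ (cst 0)%E) => //=; last exact: integrable0.
    by move=> x _; rewrite big_ord0.
  by under eq_integral do rewrite big_ord0; rewrite integral0 big_ord0.
have mexp : measurable_fun setT (fun x : measurableTypeR R => (expR (beta * x) ^+ n)%:E).
  by apply/measurable_EFinP; apply: measurable_funX; exact: measurable_expRM.
have val : (\int[normal_prob 0 s]_x (expR (beta * x) ^+ n)%:E =
    (expR ((beta * s) ^+ 2 / 2) ^+ (n ^ 2))%:E)%E.
  have e x : expR (beta * x) ^+ n = expR (n%:R * beta * x) by rewrite -mulrA expRM_natl.
  under eq_integral do rewrite e.
  by rewrite normal_mgf// -expRM_natl natrX; congr (expR _)%:E; field.
have int1 : (normal_prob 0 s).-integrable setT (fun x : measurableTypeR R => (expR (beta * x) ^+ n)%:E).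
  apply/integrableP; split => //.
  under eq_integral do rewrite gee0_abs ?lee_fin ?exprn_ge0 ?expR_ge0//.
  by rewrite val ltry.
have int2 : (normal_prob 0 s).-integrable setT
   (fun x : measurableTypeR R => ((a n)%:E * (expR (beta * x) ^+ n)%:E)%E).
  exact: integrableZl.
have e x : (\sum_(k < n.+1) a k * expR (beta * x) ^+ k)%:E =
  ((\sum_(k < n) a k * expR (beta * x) ^+ k)%:E + (a n)%:E * (expR (beta * x) ^+ n)%:E)%E.
  by rewrite big_ord_recr EFinD EFinM.
split.
  rewrite (_ : (fun x => _) = ((fun x : measurableTypeR R =>
      (\sum_(k < n) a k * expR (beta * x) ^+ k)%:E) \+
      (fun x => (a n)%:E * (expR (beta * x) ^+ n)%:E))%E); first exact: integrableD.
  by apply/funext => x; rewrite e.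
under eq_integral do rewrite e.
by rewrite integralD// IH2 integralZl// val -EFinM -EFinD big_ord_recr.
Qed.

Let sub_exp (t : R) : 0 <= t <= 2^-1 -> t <= expR t - 1 <= t + 2 * t ^+ 2.
Proof.
move=> t01; have := expR_le_quadratic t01; have := expR_ge1Dx t.
by move=> h1 h2; apply/andP; split; lra.
Qed.

Let error_balance (x A2 A4 Sp Sm n1 n2 a b c y3 y4 y5 h3 h4 : R) :
  1 + y4 - a - n1 <= Sp -> 1 + y5 - b - n2 <= Sm -> a <= c + 5 * h3 -> b <= c ->
  y3 <= 2^-1 * y4 + 2^-1 * y5 -> x <= y3 + h4 / 2 -> - A2 <= - c + h4 + h3 ->
  A4 <= 88 * h3 -> n1 <= 4 * h3 -> n2 <= h3 -> h4 <= 4^-1 * h3 -> 0 < h3 ->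
  1 + x - A2 + A4 <= 2^-1 * Sp + 2^-1 * Sm + 96 * h3.
Proof. clear; lra. Qed.

(** If [Z] is the exponential of a centred Gaussian of standard deviation [h], then [Z ^ k] has mean
    [X ^ (k ^ 2)]. The left-hand side is thus the mean of [1 + v * y - (v * (1 - v) / 2 - h / 2) * y
    ^ 2 + y ^ 4 / (2 * h)] at [y = g * (Z - 1)], a polynomial above [(1 + y) ^ v]. It agrees with
    the two-point mean up to order [h ^ 2]. *)
Lemma two_point_vs_gaussian v h g : 0 < v <= 1 -> 0 < h <= 4^-1 -> 0 <= g <= 1 ->
  forall X, X = expR (h ^+ 2 / 2) ->
  1 + v * g * (X - 1) - (v * (1 - v) / 2 - h / 2) * g ^+ 2 * (X ^+ 4 - 2 * X + 1)
    + g ^+ 4 / (2 * h) * (X ^+ 16 - 4 * X ^+ 9 + 6 * X ^+ 4 - 4 * X + 1) <=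
  (1 + 128 * h ^+ 3) *
  (2^-1 * (1 + g * (expR h - 1)) `^ v + 2^-1 * (1 + g * (expR (- h) - 1)) `^ v).
Proof.
move=> v01 /andP[h0 h1] /andP[g0 g1] X Xdef; have /andP[v0 v1] := v01.
have [c2 c2E] : exists c, c = v * (1 - v) / 2 by eexists.
rewrite -c2E.
have c20 : 0 <= c2 by rewrite c2E divr_ge0// mulr_ge0//; lra.
have c21 : c2 <= 1.
  have : v * (1 - v) <= 1 by apply: mulr_ile1; lra.
  by rewrite c2E; move: (v * (1 - v)) => z; lra.
have hh1 : h ^+ 2 <= 16^-1.
  have -> : 16^-1 = 4^-1 ^+ 2 :> R by field.
  by rewrite lerXn2r ?nnegrE// ltW.
have hh0 : 0 < h ^+ 2 by rewrite exprn_gt0.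
have h3 : h ^+ 3 = h * h ^+ 2 by rewrite exprS.
have h4 : h ^+ 4 = h ^+ 2 * h ^+ 2 by rewrite -exprD.
have hc0 : 0 < h ^+ 3 by rewrite exprn_gt0.
have h43 : h ^+ 4 <= 4^-1 * h ^+ 3 by rewrite exprS ler_wpM2r// ltW.
have h42 : h ^+ 4 <= 16^-1 * h ^+ 2 by rewrite h4 ler_wpM2r// ltW.
have XE k : X ^+ k = expR (k%:R * (h ^+ 2 / 2)) by rewrite Xdef expRM_natl.
have Xb k : k%:R * (h ^+ 2 / 2) <= 2^-1 ->
   k%:R * (h ^+ 2 / 2) <= X ^+ k - 1 <= k%:R * (h ^+ 2 / 2) + k%:R ^+ 2 * h ^+ 4 / 2.
  move=> kh; have k0 : 0 <= k%:R * (h ^+ 2 / 2) by rewrite mulr_ge0// divr_ge0// ltW.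
  rewrite XE; have : 0 <= k%:R * (h ^+ 2 / 2) <= 2^-1 by rewrite k0.
  move=> /sub_exp/andP[-> /= h']; apply: (le_trans h').
  by rewrite h4 le_eqVlt; apply/orP; left; apply/eqP; field.
have /andP[X1l X1u] : 1%:R * (h ^+ 2 / 2) <= X ^+ 1 - 1 <= 1%:R * (h ^+ 2 / 2) + 1%:R ^+ 2 * h ^+ 4 / 2.
  by apply: Xb; lra.
have /andP[X4l X4u] : 4%:R * (h ^+ 2 / 2) <= X ^+ 4 - 1 <= 4%:R * (h ^+ 2 / 2) + 4%:R ^+ 2 * h ^+ 4 / 2.
  by apply: Xb; lra.
have /andP[X16l X16u] : 16%:R * (h ^+ 2 / 2) <= X ^+ 16 - 1 <= 16%:R * (h ^+ 2 / 2) + 16%:R ^+ 2 * h ^+ 4 / 2.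
  by apply: Xb; lra.
have /andP[X9l X9u] : 9%:R * (h ^+ 2 / 2) <= X ^+ 9 - 1 <= 9%:R * (h ^+ 2 / 2) + 9%:R ^+ 2 * h ^+ 4 / 2.
  by apply: Xb; lra.
rewrite expr1 in X1l X1u; rewrite !expr1n in X1u.
have n4 : (4%:R : R) ^+ 2 = 16 by ring.
have n16 : (16%:R : R) ^+ 2 = 256 by ring.
have n9 : (9%:R : R) ^+ 2 = 81 by ring.
rewrite n4 in X4u; rewrite n16 in X16u; rewrite n9 in X9u.
set B := X ^+ 4 - 2 * X + 1; set D := X ^+ 16 - 4 * X ^+ 9 + 6 * X ^+ 4 - 4 * X + 1.
have Bl : h ^+ 2 - h ^+ 4 <= B by rewrite /B; move: (X ^+ 4) (h ^+ 2) (h ^+ 4) X4l X4u X1l X1u => *; lra.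
have Bu : B <= 3 / 2 * h ^+ 2 by rewrite /B; move: (X ^+ 4) (h ^+ 2) (h ^+ 4) X4l X4u X1l X1u h42 => *; lra.
(* The terms of order [h ^ 2] cancel, as [16 - 4 * 9 + 6 * 4 - 4 = 0]. *)
have Du : D <= 176 * h ^+ 4.
  by rewrite /D; move: (X ^+ 4) (X ^+ 9) (X ^+ 16) (h ^+ 2) (h ^+ 4) X4l X4u X1l X1u X16u X9l => *; lra.
have B0 : 0 <= B by apply: le_trans Bl; clear -hh0 h42; lra.
have g20 : 0 <= g ^+ 2 by rewrite exprn_ge0.
have g21 : g ^+ 2 <= 1 by rewrite exprn_ile1.
have vg0 : 0 <= v * g by rewrite mulr_ge0// ltW.
have vg1 : v * g <= 1 by rewrite mulr_ile1// ltW.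
have t1 : v * g * (X - 1) <= v * g * (h ^+ 2 / 2) + h ^+ 4 / 2.
  apply: (@le_trans _ _ (v * g * (h ^+ 2 / 2 + h ^+ 4 / 2))).
    by apply: ler_wpM2l => //; clear -X1u; lra.
  by rewrite mulrDr lerD2l ler_piMl// divr_ge0// exprn_ge0// ltW.
clearbody B D; clear Xb XE X4l X4u X16l X16u X9l X9u X1l X1u n4 n16 n9.
have t2 : - ((c2 - h / 2) * g ^+ 2 * B) <= - (c2 * g ^+ 2 * h ^+ 2) + h ^+ 4 + h ^+ 3.
  have -> : - ((c2 - h / 2) * g ^+ 2 * B) = - (c2 * g ^+ 2 * B) + h / 2 * (g ^+ 2 * B) by ring.
  apply: lerD.
    have : c2 * g ^+ 2 * (h ^+ 2 - h ^+ 4) <= c2 * g ^+ 2 * B by apply: ler_wpM2l => //; rewrite mulr_ge0.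
    have : c2 * g ^+ 2 * h ^+ 4 <= h ^+ 4.
      by apply: ler_piMl; [exact: exprn_ge0 (ltW h0)|exact: mulr_ile1].
    rewrite mulrBr; move: (c2 * g ^+ 2 * _) (c2 * g ^+ 2 * _) (c2 * g ^+ 2 * _) => x1 x2 x3; lra.
  have : g ^+ 2 * B <= 3 / 2 * h ^+ 2 by apply: le_trans Bu; rewrite ler_piMl.
  move=> gB; apply: (@le_trans _ _ (h / 2 * (3 / 2 * h ^+ 2))).
    by apply: ler_wpM2l => //; rewrite divr_ge0// ltW.
  have -> : h / 2 * (3 / 2 * h ^+ 2) = 3 / 4 * (h * h ^+ 2) by field.
  by rewrite -h3; clear -hc0; lra.
have t3 : g ^+ 4 / (2 * h) * D <= 88 * h ^+ 3.
  apply: (@le_trans _ _ (g ^+ 4 / (2 * h) * (176 * h ^+ 4))).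
    by apply: ler_wpM2l => //; rewrite divr_ge0 ?exprn_ge0 ?mulr_ge0// ltW.
  have -> : g ^+ 4 / (2 * h) * (176 * h ^+ 4) = g ^+ 4 * (88 * h ^+ 3).
    by rewrite [h ^+ 4]exprS; field; rewrite gt_eqF.
  by rewrite ler_piMl ?exprn_ile1// mulr_ge0// ltW.
set up := expR h - 1; set um := 1 - expR (- h).
have umE : expR (- h) - 1 = - um by rewrite /um opprB.
have up0 : h <= up by rewrite /up; have := expR_ge1Dx h; lra.
have up00 : 0 <= up by exact: le_trans (ltW h0) up0.
have up1 : up <= h + 2 * h ^+ 2.
  have hh : 0 <= h <= 2^-1 by apply/andP; split; lra.
  by have := expR_le_quadratic hh; rewrite /up; lra.
have up2 : up <= 3 / 2 * h.
  have : h ^+ 2 <= 4^-1 * h by rewrite expr2 ler_wpM2r// ltW.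
  by lra.
have um1 : um <= h by rewrite /um; have := expR_ge1Dx (- h); lra.
have um0 : 0 <= um by rewrite /um subr_ge0 -expR0 ler_expR oppr_le0 ltW.
have upq : up ^+ 2 <= h ^+ 2 + 5 * h ^+ 3.
  apply: (@le_trans _ _ ((h + 2 * h ^+ 2) ^+ 2)).
    by rewrite lerXn2r ?nnegrE// (le_trans up00).
  have -> : (h + 2 * h ^+ 2) ^+ 2 = h ^+ 2 + 4 * h ^+ 3 + 4 * h ^+ 4 by ring.
  lra.
have umq : um ^+ 2 <= h ^+ 2 by rewrite lerXn2r ?nnegrE// ltW.
have upc : up ^+ 3 <= 4 * h ^+ 3.
  apply: (@le_trans _ _ ((3 / 2 * h) ^+ 3)).
    by rewrite lerXn2r ?nnegrE// (le_trans up00).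
  have -> : (3 / 2 * h) ^+ 3 = 27 / 8 * h ^+ 3 by field.
  lra.
have umc : um ^+ 3 <= h ^+ 3 by rewrite lerXn2r ?nnegrE// ltW.
have g3 : g ^+ 3 <= 1 by rewrite exprn_ile1.
have gp : - 2^-1 <= g * up.
  by apply: le_trans (mulr_ge0 g0 up00); rewrite oppr_le0 invr_ge0.
have gm : - 2^-1 <= g * - um.
  rewrite mulrN lerN2; apply: (@le_trans _ _ um); first exact: ler_piMl.
  by apply: (le_trans um1); apply: (le_trans h1); rewrite lef_pV2 ?posrE// ler_nat.
have Lp := powR_taylor_ge v01 gp; have Lm := powR_taylor_ge v01 gm.
rewrite umE.
set Sp := (1 + g * up) `^ v in Lp *; set Sm := (1 + g * - um) `^ v in Lm *.
have np : `|g * up| ^+ 3 <= 4 * h ^+ 3.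
  rewrite ger0_norm; last by rewrite mulr_ge0.
  by rewrite exprMn; apply: le_trans upc; rewrite ler_piMl// exprn_ge0.
have nm : `|g * - um| ^+ 3 <= h ^+ 3.
  rewrite mulrN normrN ger0_norm; last by rewrite mulr_ge0.
  by rewrite exprMn; apply: le_trans umc; rewrite ler_piMl// exprn_ge0.
have ch := cosh_ge (ltW h0).
(* The mean of the two-point factor exceeds [1] by at least the leading term of [X - 1]. *)
have chd : h ^+ 2 / 2 <= 2^-1 * (up - um) by rewrite /up /um; clear -ch; lra.
clearbody up um.
have Spl : 1 <= Sp.
  have gup : 0 <= g * up by rewrite mulr_ge0// (le_trans (ltW h0)).
  rewrite /Sp [leLHS](_ : 1 = 1 `^ v); last by rewrite powR1.
  by apply: ge0_ler_powR; rewrite ?nnegrE ?lerDl ?addr_ge0// ltW.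
have Sml : 2^-1 <= Sm.
  have gum0 : 0 <= g * um by exact: mulr_ge0.
  have gum2 : g * um <= 2^-1 by move: gm; rewrite mulrN lerN2.
  have z1 : 2^-1 <= 1 - g * um by clear -gum2; lra.
  rewrite /Sm mulrN; apply: (le_trans z1); apply: ger1_powR => //.
  by rewrite gerBl gum0 andbT; apply: lt_le_trans z1.
clearbody Sp Sm.
(* This lower bound turns the additive error [96 * h ^+ 3] into the factor with
   [128 = 96 / (3 / 4)]. *)
have S0 : 3 / 4 <= 2^-1 * Sp + 2^-1 * Sm by clear -Spl Sml; lra.
have key : 1 + v * (g * (X - 1)) - (c2 - h / 2) * g ^+ 2 * B + g ^+ 4 / (2 * h) * D <=
   2^-1 * Sp + 2^-1 * Sm + 96 * h ^+ 3.
  have q1 : c2 * (g * up) ^+ 2 <= c2 * g ^+ 2 * h ^+ 2 + 5 * h ^+ 3.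
    rewrite exprMn mulrA; apply: (@le_trans _ _ (c2 * g ^+ 2 * (h ^+ 2 + 5 * h ^+ 3))).
      by apply: ler_wpM2l => //; rewrite mulr_ge0.
    rewrite mulrDr lerD2l ler_piMl//; last exact: mulr_ile1.
    by rewrite mulr_ge0// ltW.
  have q2 : c2 * (g * - um) ^+ 2 <= c2 * g ^+ 2 * h ^+ 2.
    rewrite mulrN sqrrN exprMn mulrA; apply: ler_wpM2l => //; by rewrite mulr_ge0.
  have q3 : v * (g * (h ^+ 2 / 2)) <= 2^-1 * (v * (g * up)) + 2^-1 * (v * (g * - um)).
    have -> : 2^-1 * (v * (g * up)) + 2^-1 * (v * (g * - um)) = v * g * (2^-1 * (up - um)) by field.
    rewrite mulrA; exact: ler_wpM2l.
  rewrite -c2E in Lp Lm; rewrite -mulrA in t1; rewrite -[v * g * (h ^+ 2 / 2)]mulrA in t1.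
  exact: (error_balance Lp Lm q1 q2 q3 t1 t2 t3 np nm h43 hc0).
rewrite -[v * g * (X - 1)]mulrA; apply: (le_trans key); rewrite [leRHS]mulrDl mul1r lerD2l.
have -> : 96 * h ^+ 3 = 128 * h ^+ 3 * (3 / 4) by field.
by apply: ler_wpM2l => //; rewrite mulr_ge0// ltW.
Qed.

End gaussian.

Section gaussian_step.
Context {R : realType}.
Implicit Types (v s beta al ga : R).

Let sum5 (a0 a1 a2 a3 a4 z : R) (k : nat -> nat) :
  \sum_(i < 5) nth 0 [:: a0; a1; a2; a3; a4] i * z ^+ k i =
  a0 * z ^+ k 0 + a1 * z ^+ k 1 + a2 * z ^+ k 2 + a3 * z ^+ k 3 + a4 * z ^+ k 4.
Proof. by rewrite !big_ord_recr big_ord0 /= add0r. Qed.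

Lemma measurable_affine_powR v al ga beta :
  measurable_fun setT (fun x : measurableTypeR R => (al + ga * expR (beta * x)) `^ v).
Proof.
apply: (@measurableT_comp _ _ _ _ _ _ (fun y : R => y `^ v)); first exact: measurable_powR.
apply: measurable_funD => //; apply: measurable_funM => //.
exact: measurable_expRM.
Qed.

Lemma exchange_factor_ge0 (h : R) : 0 <= h -> 0 <= 1 + 128 * h ^+ 3.
Proof. by move=> h0; rewrite addr_ge0 ?mulr_ge0 ?ler0n ?ler01 ?exprn_ge0. Qed.

(* The error is cubic in [h = beta * s], so that it disappears over [N] time steps
   as soon as [N * h ^ 3] tends to [0]. *)
Lemma gaussian_step_affine v s beta al ga : 0 < v <= 1 -> 0 < s ->
  0 < beta * s <= 4^-1 -> 0 <= al -> 0 <= ga ->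
  (\int[normal_prob 0 s]_x ((al + ga * expR (beta * x)) `^ v)%:E <=
   ((1 + 128 * (beta * s) ^+ 3) *
    (2^-1 * (al + ga * expR (beta * s)) `^ v + 2^-1 * (al + ga * expR (- (beta * s))) `^ v))%:E)%E.
Proof.
move=> v01 s0 h01 al0 ga0; set h := beta * s in h01 *; have /andP[h0 h1] := h01.
have sn0 : s != 0 by rewrite gt_eqF.
have [v0 v1] := andP v01.
have [e0|n0] := eqVneq (al + ga) 0.
  have [-> ->] : al = 0 /\ ga = 0 by split; lra.
  under eq_integral do rewrite mul0r addr0 powR0 ?gt_eqF//.
  by rewrite integral0 !mul0r !addr0 powR0 ?gt_eqF// !mulr0 addr0 mulr0.
have sg0 : 0 < al + ga by rewrite lt_def n0 addr_ge0.
set sg := al + ga in n0 sg0.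
have [g gE] : exists g, g = ga / sg by eexists.
have g0 : 0 <= g by rewrite gE divr_ge0// ltW.
have g1 : g <= 1 by rewrite gE ler_pdivrMr// mul1r /sg lerDr.
have gaE : ga = sg * g by rewrite gE mulrC divfK.
have alE : al = sg * (1 - g) by rewrite mulrBr mulr1 -gaE /sg addrK.
have nrm z : 0 < z -> (al + ga * z) `^ v = sg `^ v * (1 + g * (z - 1)) `^ v.
  move=> z0; have z1 : 0 <= 1 + g * (z - 1).
    have -> : 1 + g * (z - 1) = (1 - g) + g * z by ring.
    by rewrite addr_ge0 ?subr_ge0// mulr_ge0// ltW.
  rewrite -powRM//; last exact: ltW.
  by congr (_ `^ _); rewrite alE gaE; ring.
have c20 : 0 <= v * (1 - v) / 2 by rewrite divr_ge0// mulr_ge0// ?subr_ge0// ltW.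
pose A2 := (v * (1 - v) / 2 - h / 2) * g ^+ 2; pose A4 := g ^+ 4 / (2 * h).
pose a := nth 0 [:: 1 - v * g - A2 + A4; v * g + 2 * A2 - 4 * A4; - A2 + 6 * A4; - (4 * A4); A4].
pose poly z := \sum_(k < 5) a k * z ^+ k.
have polyE z : poly z = 1 + v * (g * (z - 1)) - A2 * (z - 1) ^+ 2 + A4 * (z - 1) ^+ 4.
  by rewrite /poly /a (sum5 _ _ _ _ _ z id); ring.
have powR_le_poly z : 0 < z -> (1 + g * (z - 1)) `^ v <= poly z.
  move=> z0; have y1 : -1 < g * (z - 1).
    have [->|gp] := eqVneq g 0; first by rewrite mul0r ltrN10.
    have {}gp : 0 < g by rewrite lt_def gp.
    have : 0 < g * z by rewrite mulr_gt0.
    by rewrite mulrBr mulr1; move: (g * z) => w; clear -g1; lra.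
  apply: (le_trans (powR_taylor_le v01 y1)).
  rewrite polyE; set y := g * (z - 1).
  have -> : A2 * (z - 1) ^+ 2 = v * (1 - v) / 2 * y ^+ 2 - h / 2 * y ^+ 2.
    by rewrite /A2 /y; ring.
  have -> : A4 * (z - 1) ^+ 4 = y ^+ 4 / (2 * h) by rewrite /A4 /y; field; rewrite gt_eqF.
  (* The cubic Taylor error is not a polynomial in [z]; the inequality between arithmetic and
     geometric means replaces it by one. The weight [h] balances both terms, since [y] is typically
     of size [h]. *)
  have y3 : `|y| ^+ 3 <= h / 2 * y ^+ 2 + y ^+ 4 / (2 * h).
    have y2 : y ^+ 2 = `|y| ^+ 2 by rewrite real_normK ?num_real.
    have y4 : y ^+ 4 = `|y| ^+ 4 by rewrite -[4%N]/(2 * 2)%N !exprM y2.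
    rewrite y2 y4 -subr_ge0.
    have -> : h / 2 * `|y| ^+ 2 + `|y| ^+ 4 / (2 * h) - `|y| ^+ 3 =
       `|y| ^+ 2 * (h - `|y|) ^+ 2 / (2 * h) by field; rewrite gt_eqF.
    apply: divr_ge0; first by rewrite mulr_ge0 ?sqr_ge0.
    by rewrite mulr_ge0// ltW.
  move: (`|y| ^+ 3) (h / 2 * y ^+ 2) (y ^+ 4 / (2 * h)) (v * y) (v * (1 - v) / 2 * y ^+ 2) y3.
  by clear=> *; lra.
have [intp valp] := normal_poly_exp 5 a beta sn0.
have mpoly : measurable_fun setT (fun x : measurableTypeR R => (poly (expR (beta * x)))%:E).
  exact: measurable_int intp.
apply: (@le_trans _ _ (\int[normal_prob 0 s]_x ((sg `^ v)%:E * (poly (expR (beta * x)))%:E))%E).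
  apply: ge0_le_integral => //.
  - by move=> x _; rewrite lee_fin powR_ge0.
  - by apply/measurable_EFinP; exact: measurable_affine_powR.
  - by apply: emeasurable_funM.
  - move=> x _; rewrite -EFinM lee_fin nrm ?expR_gt0//.
    by rewrite ler_wpM2l ?powR_ge0// powR_le_poly ?expR_gt0.
rewrite integralZl// valp -EFinM lee_fin !nrm ?expR_gt0//.
have -> : forall K x y z : R, K * (2^-1 * (x * y) + 2^-1 * (x * z)) = x * (K * (2^-1 * y + 2^-1 * z)).
  by move=> K x y z; ring.
apply: ler_wpM2l; first exact: powR_ge0.
rewrite /a (sum5 _ _ _ _ _ _ (fun k => k ^ 2)%N) /=.
have := @two_point_vs_gaussian R v h g v01 h01 _ _ erefl.
rewrite g0 g1 => /(_ erefl); apply: le_trans; rewrite le_eqVlt; apply/orP; left; apply/eqP.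
by rewrite /A2 /A4; ring.
Qed.

End gaussian_step.

(** * Replacing independent Gaussian variables one after the other *)

Section independence_step.
Context d (T : measurableType d) (R : realType) (P : probability T R).

(* [G] is a pi-system independent of [X], and [f] depends on [w] through the
   sigma-algebra generated by [G] only. *)
Lemma fubini_independent (G : set_system T) (X : {mfun T >-> R})
    (mu : probability (measurableTypeR R) R)
    (f : g_sigma_algebraType G * measurableTypeR R -> \bar R)
    (g : g_sigma_algebraType G -> \bar R) :
  G `<=` measurable -> setI_closed G -> G setT ->
  (forall V, measurable V -> P (X @^-1` V) = mu V) ->
  (forall A V, G A -> measurable V -> P (A `&` X @^-1` V) = (P A * P (X @^-1` V))%E) ->
  measurable_fun setT f -> (forall z, 0 <= f z)%E ->
  measurable_fun setT g ->
  (forall w, \int[mu]_x f (w, x) <= g w)%E ->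
  (\int[P]_w f (w, X w) <= \int[P]_w g w)%E.
Proof.
move=> Gm GI GT Xmu hind mf f0 mg fg.
(* The identity is read as a random variable with values in [T] under the smaller sigma-algebra. Its
   joint law with [X] turns out to be a product measure, so Tonelli's theorem takes the place of
   conditioning. *)
have mid : measurable_fun setT (idfun : T -> g_sigma_algebraType G).
  move=> _ A mA; rewrite setTI preimage_id.
  exact: (smallest_sub (@sigma_algebra_measurable _ T) Gm).
pose iD : {mfun T >-> g_sigma_algebraType G} :=
  HB.pack (idfun : T -> g_sigma_algebraType G) (isMeasurableFun.Build _ _ _ _ _ mid).
have mpsi : measurable_fun setT (fun w : T => ((w : g_sigma_algebraType G), (X w : measurableTypeR R))).
  by apply: measurable_fun_pair; [exact: mid|exact (measurable_funPT X)].
pose psi : {mfun T >-> (g_sigma_algebraType G * measurableTypeR R)%type} :=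
  HB.pack (fun w : T => ((w : g_sigma_algebraType G), (X w : measurableTypeR R)))
   (isMeasurableFun.Build _ _ _ _ _ mpsi).
have rect (A : set (g_sigma_algebraType G)) (V : set (measurableTypeR R)) :
    measurable A -> measurable V ->
    distribution P psi (A `*` V) = (distribution P iD A * mu V)%E.
  move=> mA mV; rewrite /distribution /pushforward /=.
  have mXV : measurable (X @^-1` V) by rewrite -[Y in measurable Y]setTI; exact (measurable_funPT X measurableT V mV).
  have -> : psi @^-1` (A `*` V) = A `&` X @^-1` V by [].
  rewrite preimage_id -Xmu//.
  have pfin : (0 <= fine (P (X @^-1` V))) by rewrite fine_ge0// measure_ge0.
  have PXE : P (X @^-1` V) = (fine (P (X @^-1` V)))%:E by rewrite fineK// fin_num_measure.
  (* For fixed [V] these are two finite measures in [A] that agree on the pi-system [G], hence on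
     the sigma-algebra it generates. *)
  pose m1 := mrestr P mXV; pose m2 := mscale (NngNum pfin) P.
  have h := @g_sigma_algebra_measure_unique d R T G Gm (fun=> setT) (fun=> GT) _ m1 m2 GI.
  transitivity (m1 A); first by [].
  transitivity (m2 A); last first.
    by transitivity ((fine (P (X @^-1` V)))%:E * P A)%E; [|rewrite -PXE muleC].
  apply: h => //.
  - by apply/seteqP; split => // x _; exists 0%N.
  - move=> C GC; transitivity (P C * P (X @^-1` V))%E; first exact (hind C V GC mV).
    by transitivity ((fine (P (X @^-1` V)))%:E * P C)%E; [rewrite -PXE muleC|].
  - move=> _; have h1 : (P (setT `&` X @^-1` V) < +oo)%E by rewrite setTI PXE ltry.
    exact: h1.
have uniq := @product_measure_unique _ _ _ _ R (distribution P iD) mu (distribution P psi) rect.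
have -> : (\int[P]_w f (w, X w) = \int[distribution P psi]_z f z)%E.
  by rewrite ge0_integral_distribution.
have -> : (\int[distribution P psi]_z f z = \int[distribution P iD \x mu]_z f z)%E.
  by apply: eq_measure_integral => A mA _; rewrite -uniq.
rewrite fubini_tonelli1//.
have -> : (\int[P]_w g w = \int[distribution P iD]_w g w)%E.
  rewrite ge0_integral_distribution// => w.
  by apply: le_trans (fg w); apply: integral_ge0.
apply: ge0_le_integral => //.
- by move=> w _; apply: integral_ge0.
- exact: measurable_fun_fubini_tonelli_F.
- by move=> w _; exact: fg.
Qed.

Lemma gaussian_step_cone v s beta H : 0 < v <= 1 -> 0 < s -> 0 < beta * s <= 4^-1 ->
  power_cone v 1 H ->
  [/\ forall y, 0 <= y -> 0 <= H (fun=> y),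
      measurable_fun setT (fun x : measurableTypeR R => H (fun=> expR (beta * x))) &
      (\int[normal_prob 0 s]_x (H (fun=> expR (beta * x)))%:E <=
       ((1 + 128 * (beta * s) ^+ 3) *
        wavg (bulk_law (expR (beta * s))) (fun y => H (fun=> y)))%:E)%E].
Proof.
move=> v01 s0 h01.
have K0 : 0 <= 1 + 128 * (beta * s) ^+ 3.
  by case/andP: h01 => h _; exact: exchange_factor_ge0 (ltW h).
elim=> [|r A r0 A0|F1 F2 _ [p1 m1 h1] _ [p2 m2 h2]|a F a0 _ [p m h]].
- by split => //; rewrite integral0 wavg0 mulr0.
- split.
  + by move=> y y0; exact: powR_ge0.
  + under eq_fun do rewrite big_ord1.
    exact: measurable_affine_powR.
  + under eq_integral do rewrite big_ord1.
    apply: (le_trans (gaussian_step_affine v01 s0 h01 r0 (A0 0%N))).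
    by rewrite /wavg !big_cons big_nil/= !big_ord1 addr0 expRN.
- split.
  + by move=> y y0; rewrite addr_ge0// ?p1 ?p2.
  + exact: measurable_funD.
  + under eq_integral do rewrite EFinD.
    rewrite ge0_integralD//; first last.
    * exact/measurable_EFinP.
    * by move=> x _; rewrite lee_fin p2// expR_ge0.
    * exact/measurable_EFinP.
    * by move=> x _; rewrite lee_fin p1// expR_ge0.
    by rewrite wavgD mulrDr EFinD leeD.
- split.
  + by move=> y y0; rewrite mulr_ge0// p.
  + by apply: measurable_funM => //; exact: measurable_cst.
  + under eq_integral do rewrite EFinM.
    rewrite ge0_integralZl//; last first.
    * by move=> x _; rewrite lee_fin p// expR_ge0.
    * exact/measurable_EFinP.
    by rewrite wavgZ mulrCA EFinM lee_wpmul2l// lee_fin.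
Qed.

(** Variable [0] is exchanged first, the others being frozen, at the cost of one factor [K]. The
    induction hypothesis is then applied to [Psi], the two-point average of [Phi] in that variable,
    which still lies in the cone in every remaining variable. *)
Lemma gaussian_swap v s beta m (X : nat -> {RV P >-> R}) Phi :
  0 < v <= 1 -> 0 < s -> 0 < beta * s <= 4^-1 ->
  (forall V : nat -> set R, (forall l, measurable (V l)) ->
    P (\big[setI/setT]_(l < m) X l @^-1` V l) = (\prod_(l < m) P (X l @^-1` V l))%E) ->
  (forall l V, (l < m)%N -> measurable V -> P (X l @^-1` V) = normal_prob 0 s V) ->
  borel Phi -> (forall e, (forall k, 0 <= e k) -> 0 <= Phi e) ->
  (forall l e, (l < m)%N -> (forall k, 0 <= e k) ->
    power_cone v 1 (fun t => Phi (upd e l (t 0%N)))) ->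
  (\int[P]_w (Phi (fun l => if (l < m)%N then expR (beta * X l w) else 1))%:E <=
   ((1 + 128 * (beta * s) ^+ 3) ^+ m * wavgn (bulk_law (expR (beta * s))) m Phi)%:E)%E.
Proof.
move=> v01 s0 h01; set K := 1 + _; set bulk := bulk_law _.
have K0 : 0 <= K by case/andP: h01 => h _; exact: exchange_factor_ge0 (ltW h).
have b0 : pos_law bulk by apply: bulk_law_pos; rewrite expR_gt1; case/andP: h01.
elim: m X Phi => [|m IH] X Phi prodX lawX bPhi Phi0 conePhi.
  rewrite (_ : (fun w => _) = cst (Phi (fun=> 1))%:E)//.
  have -> : (\int[P]_w cst (Phi (fun=> 1%R))%:E w = (Phi (fun=> 1%R))%:E * P setT)%E by exact: integral_cst.
  by rewrite probability_setT mule1 expr0 mul1r.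
pose Z w l := if (l < m)%N then expR (beta * X l.+1 w) else 1.
have Z0 w l : 0 <= Z w l by rewrite /Z; case: ifP => _; rewrite ?expR_ge0.
have -> : (fun w => (Phi (fun l => if (l < m.+1)%N then expR (beta * X l w) else 1))%:E) =
    (fun w => (Phi (scons (expR (beta * X 0%N w)) (Z w)))%:E).
  by apply/funext => w; congr (Phi _)%:E; apply/funext => -[|l].
have prodX' (V : nat -> set R) : (forall l, measurable (V l)) ->
    P (\big[setI/setT]_(l < m) X l.+1 @^-1` V l) = (\prod_(l < m) P (X l.+1 @^-1` V l))%E.
  move=> mV; have := prodX (fun k => if k is l.+1 then V l else setT).
  rewrite !big_ord_recl/= preimage_setT setTI probability_setT mul1e.
  by apply => -[|l].
pose G : set_system T := [set A | exists V : nat -> set R, (forall l, measurable (V l)) /\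
  A = \big[setI/setT]_(l < m) X l.+1 @^-1` V l].
have mXV l (V : set R) : measurable V -> measurable (X l @^-1` V).
  by move=> mV; rewrite -[Y in measurable Y]setTI; exact (measurable_funPT (X l) measurableT V mV).
have GX l (V : set R) : (l < m)%N -> measurable V -> G (X l.+1 @^-1` V).
  move=> lm mV; exists (fun k => if k == l then V else setT); split.
    by move=> k; case: ifP.
  rewrite (bigD1 (Ordinal lm))//= eqxx big1 ?setIT// => k.
  by rewrite -val_eqE/= => /negbTE ->; rewrite preimage_setT.
have Gm : G `<=` measurable.
  move=> _ [V [mV ->]]; apply: big_ind => //; first exact: measurableI.
  by move=> l _; exact: mXV.
have GI : setI_closed G.
  move=> _ _ [V [mV ->]] [W [mW ->]]; exists (fun l => V l `&` W l); split.
    by move=> l; exact: measurableI.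
  by rewrite -big_split; apply: eq_bigr => l _ /=; rewrite preimage_setI.
have GT : G setT.
  exists (fun=> setT); split => //; rewrite big1// => l _; exact: preimage_setT.
have mZ l : measurable_fun setT (fun w : g_sigma_algebraType G => Z w l).
  rewrite /Z; case: ltnP => lm; last exact: measurable_cst.
  apply: (@measurableT_comp _ _ _ _ _ _ (fun x : measurableTypeR R => expR (beta * x))).
    exact: measurable_expRM.
  move=> _ V mV; rewrite setTI; apply: sub_sigma_algebra; exact: GX.
pose f (z : g_sigma_algebraType G * measurableTypeR R) :=
  (Phi (scons (expR (beta * z.2)) (Z z.1)))%:E.
pose Psi e := wavg bulk (fun y => Phi (scons y e)).
have bPsi : borel Psi.
  move=> d' D Y mY; apply: (@measurable_wavg R d' D bulk (fun y w => Phi (scons y (Y^~ w)))) => y.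
  have -> : (fun w => Phi (scons y (Y^~ w))) =
    (fun w => Phi (fun l => (fun l w => if l is k.+1 then Y k w else y) l w)).
    by apply/funext => w; congr Phi; apply/funext => -[|k].
  by apply: bPhi => -[|k] //; exact: measurable_cst.
have scons0 (y : R) e : 0 <= y -> (forall k, 0 <= e k) -> forall k, 0 <= scons y e k.
  by move=> y0 e0 [|k]/=.
have Psi0 e : (forall k, 0 <= e k) -> 0 <= Psi e.
  by move=> e0; apply: wavg_ge0 => // y y0; apply: Phi0 => k; apply: scons0 => //; exact: ltW.
have conePsi l e : (l < m)%N -> (forall k, 0 <= e k) ->
    power_cone v 1 (fun t => Psi (upd e l (t 0%N))).
  move=> lm e0; apply: (@power_cone_wavg R v 1 bulk (fun y t => Phi (scons y (upd e l (t 0%N))))) => // y y0.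
  have -> : (fun t : nat -> R => Phi (scons y (upd e l (t 0%N)))) =
      (fun t => Phi (upd (scons y e) l.+1 (t 0%N))).
    by apply/funext => t; congr Phi; apply/funext => -[|k].
  by apply: conePhi => // k; apply: scons0 => //; exact: ltW.
have IHm := IH (fun l => X l.+1) Psi prodX' (fun l V lm => lawX l.+1 V lm) bPsi Psi0 conePsi.
have mPsi : measurable_fun setT (fun w : g_sigma_algebraType G => (Psi (Z w))%:E).
  by apply/measurable_EFinP; exact (bPsi _ (g_sigma_algebraType G) (fun l w => Z w l) mZ).
have mPsiT : measurable_fun setT (fun w : T => (Psi (Z w))%:E).
  apply/measurable_EFinP; apply: (bPsi _ T (fun l w => Z w l)) => l.
  rewrite /Z; case: ltnP => lm; last exact: measurable_cst.
  apply: (@measurableT_comp _ _ _ _ _ _ (fun x : measurableTypeR R => expR (beta * x))).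
    exact: measurable_expRM.
  exact (measurable_funPT (X l.+1)).
apply: (@le_trans _ _ (\int[P]_w (K%:E * (Psi (Z w))%:E))%E).
  apply: (@fubini_independent G (X 0%N) (normal_prob 0 s) f (fun w => K%:E * (Psi (Z w))%:E)%E) => //.
  - by move=> V mV; exact: lawX.
  - move=> _ V [W [mW ->]] mV; rewrite prodX'// muleC setIC.
    have := prodX (fun k => if k is l.+1 then W l else V).
    by rewrite !big_ord_recl/=; apply => -[|l].
  - apply/measurable_EFinP.
    have -> : (fun z : g_sigma_algebraType G * measurableTypeR R => Phi (scons (expR (beta * z.2)) (Z z.1))) =
      (fun z => Phi (fun l => (fun l z => if l is k.+1 then Z z.1 k else expR (beta * z.2)) l z)).
      by apply/funext => z; congr Phi; apply/funext => -[|k].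
    apply: bPhi => -[|k].
    + apply: (@measurableT_comp _ _ _ _ _ _ (fun x : measurableTypeR R => expR (beta * x))) => //.
      exact: measurable_expRM.
    + exact (measurableT_comp (mZ k) (@measurable_fst _ _ (g_sigma_algebraType G) (measurableTypeR R))).
  - move=> z; rewrite lee_fin Phi0// => k; apply: scons0 => //; exact: expR_ge0.
  - by apply: emeasurable_funM => //; exact: measurable_cst.
  - move=> w; rewrite -EFinM.
    have := conePhi 0%N (scons 1 (Z w)) (ltn0Sn m) (scons0 1 (Z w) ler01 (Z0 w)).
    have -> : (fun t : nat -> R => Phi (upd (scons 1 (Z w)) 0 (t 0%N))) =
       (fun t => Phi (scons (t 0%N) (Z w))).
      by apply/funext => t; congr Phi; apply/funext => -[|k].
    by move=> /(gaussian_step_cone v01 s0 h01)[_ _].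
rewrite ge0_integralZl//; first last.
- by move=> w _; rewrite lee_fin Psi0.
rewrite exprS -mulrA EFinM lee_wpmul2l// ?lee_fin//.
apply: (le_trans IHm); rewrite lee_fin ler_wpM2l ?exprn_ge0//=.
by rewrite /Psi (wavgn_swap bulk bulk m (fun e y => Phi (scons y e))).
Qed.

End independence_step.

(** * Brownian increments on a grid *)

Section path_bound.
Context {R : realType} (c : R).
Hypothesis c0 : 0 <= c.
Implicit Types (e m : nat -> R) (n N k : nat).

Lemma bulk_runSr n N m e k : bulk_run c n N.+1 m e k =
  coln c 1 0 (fun k => e (N * n + k)%N) (bulk_run c n N m e) k.
Proof.
elim: N m e k => [//|N IH] m e k; rewrite [LHS]IH.
by congr coln; apply/funext => j; rewrite mulSn addnA.
Qed.

Lemma bulk_run_jump n N m e k : (forall l, 0 <= e l) -> (forall k, 0 <= m k) -> (0 < N)%N ->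
  c * bulk_run c n N m e k <= bulk_run c n N m e k.+1.
Proof.
case: N => // N e0 m0 _; rewrite !bulk_runSr /= divr1 ler_wpDl// mulr_ge0//.
exact: bulk_run_ge0.
Qed.

Lemma bulk_run_stay n i N m e k : (forall l, 0 <= e l) -> (forall k, 0 <= m k) -> (i <= N)%N ->
  bulk_run c n i m e k * \prod_(i <= j < N) e (j * n + k)%N <= bulk_run c n N m e k.
Proof.
move=> e0 m0; elim: N => [|N IH] iN.
  by move: iN; rewrite leqn0 => /eqP->; rewrite big_geq// mulr1.
move: iN; rewrite leq_eqVlt => /orP[/eqP->|iN]; first by rewrite big_geq// mulr1.
rewrite big_nat_recr// mulrA; apply: (le_trans (ler_wpM2r (e0 _) (IH iN))).
have h0 l : 0 <= bulk_run c n N m e l by exact: bulk_run_ge0.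
rewrite bulk_runSr; case: k IH => [|k] IH /=; rewrite divr1 [_ * e _]mulrC.
  by rewrite mulr0 addr0.
rewrite ler_wpDr// mulr_ge0//; exact: coln_ge0.
Qed.

(** The partition function is a sum of nonnegative path weights, and only the path [q] is kept.
    Jumps take place after a time step, with level [0] alone occupied initially; this is why [q 1]
    must be positive. *)
Lemma bulk_run_path n e (q : nat -> nat) k : (forall l, 0 <= e l) ->
  q 0%N = 0%N -> (0 < q 1%N)%N -> (forall j, (j <= k)%N -> (q j <= q j.+1)%N) ->
  c ^+ k * \prod_(j < k.+1) \prod_(q j <= i < q j.+1) e (i * n + j)%N <=
  bulk_run c n (q k.+1) (fun k => (k == 0%N)%:R) e k.
Proof.
move=> e0 q0 q1 qm; pose m k : R := (k == 0%N)%:R.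
have m0 j : 0 <= m j by rewrite ler0n.
have p0 j : 0 <= \prod_(q j <= i < q j.+1) e (i * n + j)%N by rewrite prodr_ge0.
elim: k qm => [|k IH] qm.
  rewrite big_ord1 expr0 mul1r; apply: le_trans (bulk_run_stay n 0 e0 m0 (qm 0%N _)) => //.
  by rewrite [X in bulk_run c n X]q0 mul1r.
have q1k : (0 < q k.+1)%N.
  elim: k {IH} qm => [//|k IH] qm; apply: leq_trans (IH _) (qm _ _) => //.
  by move=> j jk; apply: qm; exact: leqW.
rewrite big_ord_recr/= exprS mulrA -[c * _ * _]mulrA.
apply: (le_trans _ (bulk_run_stay n k.+1 e0 m0 (qm k.+1 _))) => //.
apply: ler_wpM2r => //.
apply: (le_trans _ (bulk_run_jump _ _ e0 m0 q1k)).
apply: ler_wpM2l => //; apply: IH => j jk; apply: qm; exact: leqW.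
Qed.

End path_bound.

(** Noise is numbered time step by time step, whereas independence is given motion by motion. *)
Lemma big_ord_mul (A : Type) (idx : A) (op : Monoid.com_law idx) (n N : nat) (F : nat -> A) :
  \big[op/idx]_(l < N * n) F l = \big[op/idx]_(k < n) \big[op/idx]_(i < N) F (i * n + k)%N.
Proof.
rewrite exchange_big/= -(big_mkord xpredT F).
rewrite -(big_mkord xpredT (fun i => \big[op/idx]_(k < n) F (i * n + k)%N)).
elim: N => [|N IH]; first by rewrite !big_geq.
rewrite big_nat_recr//= -IH mulSn addnC (@big_cat_nat _ _ _ (N * n))//= ?leq_addr//.
congr (op _ _); rewrite -[X in \big[op/idx]_(X <= _ < _) _]add0n big_addn addKn big_mkord.
by apply: eq_bigr => k _; rewrite addnC.
Qed.

Section grid.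
Context d (T : measurableType d) (R : realType) (P : probability T R).
Variables (B : nat -> R -> {RV P >-> R}).
Hypothesis hB : iid_two_sided_brownian_motions B.

Definition grid_point (t : R) (N i : nat) : R := t * i%:R / N%:R.

Definition grid_incr t n N l : {RV P >-> R} :=
  process_incr (B (l %% n).+1) (grid_point t N (l %/ n)) (grid_point t N (l %/ n).+1).

Lemma grid_point_lt t N i : 0 < t -> (0 < N)%N -> grid_point t N i < grid_point t N i.+1.
Proof.
by move=> t0 N0; rewrite /grid_point ltr_pM2r ?invr_gt0 ?ltr0n// ltr_pM2l// ltr_nat.
Qed.

Lemma grid_incr_law t n N l V : 0 < t -> (0 < N)%N -> measurable V ->
  P (grid_incr t n N l @^-1` V) = normal_prob 0 (Num.sqrt (t / N%:R)) V.
Proof.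
move=> t0 N0 mV; have [_ _ _ law] := hB.1 (l %% n).+1.
have := law _ _ (grid_point_lt (l %/ n) t0 N0) V mV.
rewrite /distribution /pushforward => ->; congr (normal_prob 0 (Num.sqrt _) V).
by rewrite /grid_point -mulrBl -mulrBr -natr1 addrAC subrr add0r mulr1.
Qed.

Lemma sigma_process_incr (X : R -> {RV P >-> R}) s t V : measurable V ->
  sigma_process X (process_incr X s t @^-1` V).
Proof.
move=> mV; rewrite /sigma_process; set G := [set A | _].
have mX u : measurable_fun setT (fun w : g_sigma_algebraType G => (X u w : measurableTypeR R)).
  by move=> _ W mW; rewrite setTI; apply: sub_sigma_algebra; exists u, W.
have mI : measurable_fun setT (fun w : g_sigma_algebraType G => (X t w - X s w : measurableTypeR R)).
  exact (measurable_funB (mX t) (mX s)).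
have := mI measurableT V mV; rewrite setTI.
by congr (<<s _ >> _).
Qed.

(** Independence of the motions factors the event by level, and independence of the increments of
    each motion factors it by time. *)
Lemma grid_incr_indep t n N (V : nat -> set R) : 0 < t -> (0 < n)%N -> (0 < N)%N ->
  (forall l, measurable (V l)) ->
  P (\big[setI/setT]_(l < N * n) grid_incr t n N l @^-1` V l) =
  (\prod_(l < N * n) P (grid_incr t n N l @^-1` V l))%E.
Proof.
move=> t0 n0 N0 mV; rewrite (@big_ord_mul _ _ setI n N (fun l => grid_incr t n N l @^-1` V l)).
rewrite (@big_ord_mul _ _ *%E n N (fun l => P (grid_incr t n N l @^-1` V l))).
pose Y j i := process_incr (B j) (grid_point t N i) (grid_point t N i.+1).
pose E j := \big[setI/setT]_(i < N) Y j i @^-1` V (i * n + j.-1)%N.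
have gY (k : 'I_n) (i : nat) : grid_incr t n N (i * n + k) = Y k.+1 i.
  by rewrite /grid_incr /Y modnMDl modn_small// divnMDl// divn_small// addn0.
have PE j : P (E j) = (\prod_(i < N) P (Y j i @^-1` V (i * n + j.-1)%N))%E.
  have [_ _ ind _] := hB.1 j.
  apply: (ind N (grid_point t N) (fun i _ => grid_point_lt i t0 N0) (index_enum 'I_N)
    (fun i : 'I_N => Y j i @^-1` V (i * n + j.-1)%N)).
    exact: index_enum_uniq.
  move=> i _; apply: sub_sigma_algebra; exists tt, (V (i * n + j.-1)%N); split => //.
have EP j : sigma_process (B j) (E j).
  rewrite /sigma_process; set G := [set A | _].
  have : measurable (E j : set (g_sigma_algebraType G)).
    apply: big_ind => [|A1 A2 m1 m2|i _].
    - exact: measurableT.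
    - exact: measurableI.
    - exact (@sigma_process_incr (B j) _ _ _ (mV _)).
  by [].
transitivity (P (\big[setI/setT]_(j <- iota 1 n) E j)).
  congr (P _); rewrite -[1%N]addn0 iotaDl big_map -[n in iota 0 n]subn0 -/(index_iota 0 n) big_mkord.
  by apply: eq_bigr => k _; apply: eq_bigr => i _; rewrite gY.
rewrite hB.2//; last exact: iota_uniq.
rewrite -[1%N]addn0 iotaDl big_map -[n in iota 0 n]subn0 -/(index_iota 0 n) big_mkord.
by apply: eq_bigr => k _; rewrite add1n PE; apply: eq_bigr => i _; rewrite gY.
Qed.

End grid.

Section moments.
Context {R : realType}.
Implicit Types (mu : seq (R * R)).

Lemma mass_ge0 mu : pos_law mu -> 0 <= mass mu.
Proof. by move=> mu0; rewrite /mass big_seq sumr_ge0// => p /mu0[]. Qed.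

Lemma le_wavgn_chain mu v u n : pos_law mu -> 0 < u ->
  wavgn mu n.+1 (fun w => chain u w n `^ v) <= u `^ v * wavg mu (fun x => x `^ v) ^+ n.+1.
Proof.
move=> mu0 u0; elim: n u u0 => [|n IH] u u0.
  rewrite expr1 -wavgZ /=; apply: le_wavg => // x x0.
  by rewrite powRM// ltW.
have E x : (fun s => chain u (scons x s) n.+1 `^ v) = (fun s => chain (u * x) s n `^ v).
  by apply/funext => s; rewrite chain_scons.
change (wavg mu (fun x => wavgn mu n.+1 (fun s => chain u (scons x s) n.+1 `^ v)) <=
  u `^ v * wavg mu (fun x => x `^ v) ^+ n.+2).
rewrite exprSr mulrA -wavgZ; apply: le_wavg => // x x0.
rewrite E; apply: (le_trans (IH _ _)); first exact: mulr_gt0.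
by rewrite powRM; [rewrite mulrAC|exact: ltW|exact: ltW].
Qed.

Lemma wavgn_head mu n f : wavgn mu n.+1 (fun w => f (w 0%N)) = mass mu ^+ n * wavg mu f.
Proof.
by rewrite -wavgZ /=; congr wavg; apply/funext => x; rewrite wavgn_cst.
Qed.

End moments.

(** * Markov's inequality on a fixed grid *)

Section grid_event.
Context d (T : measurableType d) (R : realType) (P : probability T R).
Variables (B : nat -> R -> {RV P >-> R}).

Definition grid_sum t N n (q : nat -> nat) (w : T) : R :=
  \sum_(j < n) process_incr (B j.+1) (grid_point t N (q j)) (grid_point t N (q j.+1)) w.

Definition grid_path N n (q : nat -> nat) :=
  [/\ q 0%N = 0%N, q n = N & forall j, (j < n)%N -> (q j < q j.+1)%N].

(* Paths are coded by finite sequences to keep the union countable. *)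
Definition grid_event t N n x : set T :=
  [set w | exists q : seq nat, grid_path N n (nth 0%N q) /\ x < grid_sum t N n (nth 0%N q) w].

Lemma measurable_grid_sum t N n q : measurable_fun setT (grid_sum t N n q : T -> measurableTypeR R).
Proof.
apply: measurable_sum => j.
exact (measurable_funPT (process_incr (B j.+1) (grid_point t N (q j)) (grid_point t N (q j.+1)))).
Qed.

Lemma measurable_grid_event t N n x : measurable (grid_event t N n x).
Proof.
have -> : grid_event t N n x = \bigcup_(q : seq nat)
    [set w | grid_path N n (nth 0%N q) /\ x < grid_sum t N n (nth 0%N q) w].
  by apply/seteqP; split => [w [q h]|w [q _ h]]; exists q.
apply: countable_bigcupT_measurable => [|q]; first exact: countableP.
have [h|h] := pselect (grid_path N n (nth 0%N q)); last first.
  rewrite (_ : [set w | _] = set0); first exact: measurable0.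
  by apply/seteqP; split => w // [].
rewrite (_ : [set w | _] = grid_sum t N n (nth 0%N q) @^-1` `]x, +oo[); last first.
  by apply/seteqP; split => w /=; rewrite in_itv/= andbT; [by move=> []|by move=> ?].
rewrite -[X in measurable X]setTI.
exact (measurable_grid_sum t N n (nth 0%N q) measurableT (measurable_itv `]x, +oo[)).
Qed.

Definition grid_weights beta t N n w l : R :=
  if (l < N * n)%N then expR (beta * grid_incr B t n N l w) else 1.

Lemma grid_weights_ge0 beta t N n w l : 0 <= grid_weights beta t N n w l.
Proof. by rewrite /grid_weights; case: ifP => _; rewrite ?expR_ge0. Qed.

Lemma grid_event_bound c beta t N n x w : 0 <= c -> 0 <= beta ->
  grid_event t N n.+1 x w ->
  c ^+ n * expR (beta * x) <=
  bulk_run c n.+1 N (fun k => (k == 0%N)%:R) (grid_weights beta t N n.+1 w) n.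
Proof.
move=> c0 b0 [qs []]; set q := nth 0%N qs => -[q0 qn qm] xq.
have q1 : (0 < q 1)%N by rewrite -[X in (X < _)%N]q0 qm.
have e0 := grid_weights_ge0 beta t N n.+1 w.
have qm' j : (j <= n)%N -> (q j <= q j.+1)%N by move=> jn; apply: ltnW; exact: qm.
have := bulk_run_path c0 n.+1 (k := n) e0 q0 q1 qm'; rewrite qn; apply: le_trans.
apply: ler_wpM2l; first exact: exprn_ge0.
have qN j : (j <= n)%N -> (q j.+1 <= N)%N.
  have mono i : (j + i <= n)%N -> (q j.+1 <= q (j + i).+1)%N.
    elim: i => [|i IH]; first by rewrite addn0.
    by rewrite addnS => ji; apply: leq_trans (IH (ltnW ji)) (qm' _ _).
  by move=> jn; have := mono (n - j)%N; rewrite subnKC// qn; apply.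
apply: (@le_trans _ _ (expR (beta * grid_sum t N n.+1 q w))).
  by rewrite ler_expR ler_wpM2l// ltW.
rewrite le_eqVlt; apply/orP; left; apply/eqP.
rewrite /grid_sum mulr_sumr expR_sum; apply: eq_bigr => j _.
have -> : process_incr (B j.+1) (grid_point t N (q j)) (grid_point t N (q j.+1)) w =
    \sum_(q j <= i < q j.+1) grid_incr B t n.+1 N (i * n.+1 + j) w.
  rewrite (eq_bigr (fun i => B j.+1 (grid_point t N i.+1) w - B j.+1 (grid_point t N i) w)).
    by rewrite telescope_sumr// qm'// -ltnS.
  move=> i _; rewrite /grid_incr modnMDl modn_small// divnMDl// divn_small// addn0.
  by [].
rewrite mulr_sumr expR_sum; apply: eq_big_nat => i /andP[_ iq].
rewrite /grid_weights ifT//.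
have iN : (i < N)%N by apply: leq_trans iq (qN _ _); rewrite -ltnS.
rewrite (@leq_trans (i.+1 * n.+1))// ?leq_mul2r ?iN ?orbT//.
by rewrite mulSn addnC ltn_add2r.
Qed.

Hypothesis hB : iid_two_sided_brownian_motions B.

(** Markov's inequality for [Phi], the boundary average of the power of the top partition function:
    [Phi] is at least the constant [C] on the event, and its mean is bounded by the exchange
    followed by stationarity. *)
Lemma grid_event_inequality v beta t N n x rho M : let s := Num.sqrt (t / N%:R) in
  let E := expR (beta * s) in
  let row := row_law E rho in let exit := exit_law E rho M in
  0 < v <= 1 -> 0 < t -> (0 < N)%N -> 0 < beta -> beta * s <= 4^-1 -> 0 < rho < 1 -> (0 < M)%N ->
  fine (P (grid_event t N n.+1 x)) *
    (wavg row (fun y => y^-1 `^ v) ^+ N * (jump E rho ^+ n * expR (beta * x)) `^ v * mass exit ^+ n) <=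
  (1 + 128 * (beta * s) ^+ 3) ^+ (N * n.+1) *
    ((1 + cutoff_err v E rho M) ^+ (N * n.+1) * wavg exit (fun y => y `^ v) ^+ n).
Proof.
move=> s E row exit v01 t0 N0 b0 h1 rho01 M0.
have s0 : 0 < s by rewrite sqrtr_gt0 divr_gt0// ltr0n.
have h01 : 0 < beta * s <= 4^-1 by rewrite mulr_gt0.
have E1 : 1 < E by rewrite expR_gt1 mulr_gt0.
have v0 : 0 < v by case/andP: v01.
set c := jump E rho; have c0 : 0 <= c by apply: ltW; exact: jump_gt0.
have rp : pos_law row := row_law_pos E1 rho01.
have bp := bulk_law_pos E1.
have ep : pos_law exit by exact: exit_law_pos.
pose F (S : nat -> R) := S n `^ v.
have hF : power_cone v n.+1 F.
  have := @cone_base R v n.+1 0 (fun k => (k == n)%:R) (lexx 0) (fun k => ler0n _ _).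
  congr power_cone; apply/funext => S; rewrite /F add0r big_ord_recr/= eqxx mul1r big1 ?add0r// => k _.
  by rewrite ltn_eqF// mul0r.
have mF : borel F.
  move=> d' D Y mY; apply: (@measurableT_comp _ _ _ _ _ _ (fun y : R => y `^ v)); last exact: mY.
  exact: measurable_powR.
pose Phi e := wavgn exit n.+1 (fun w => run c row n.+1 N F (chain 1 w) e).
pose delta (k : nat) : R := (k == 0%N)%:R.
have d0 k : 0 <= delta k by rewrite ler0n.
set W := wavg exit (fun y => y `^ v).
set Z := wavg row (fun y => y^-1 `^ v).
have Z0 : 0 <= Z by apply: wavg_ge0 => // y _; exact: powR_ge0.
have PhiGe e : (forall k, 0 <= e k) ->
    Z ^+ N * bulk_run c n.+1 N delta e n `^ v * (mass exit ^+ n * W) <= Phi e.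
  move=> e0; rewrite -wavgn_head -wavgnZ; apply: le_wavgn => // w w0.
  (* Starting from [a = w 0] keeps the moment [W] of the first ratio, which finally cancels one of
     the [n + 1] factors [W] of the upper bound; the other ratios contribute [mass exit]. *)
  have := @run_ge R v c row v01 c0 rp n.+1 N (chain 1 w) delta e (w 0%N) n (w0 _) e0 d0.
  rewrite powRM ?bulk_run_ge0 ?(ltW (w0 _))// => h; rewrite -mulrA [X in _ * X]mulrC; apply: h.
  case=> [|k]; rewrite /delta /= ?mulr1 ?mulr0; first by rewrite mul1r.
  by rewrite ltW// mulr_gt0// chain_gt0.
have bul e : (forall k, 0 <= e k) -> 0 <= bulk_run c n.+1 N delta e n.
  by move=> e0; exact: bulk_run_ge0.
have mW0 : 0 <= mass exit ^+ n * W.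
  apply: mulr_ge0; first by rewrite exprn_ge0// mass_ge0.
  by apply: wavg_ge0 => // y _; exact: powR_ge0.
have Phi0 e : (forall k, 0 <= e k) -> 0 <= Phi e.
  by move=> e0; apply: le_trans (PhiGe e e0); rewrite mulr_ge0// mulr_ge0// ?exprn_ge0// ?powR_ge0.
have bPhi : borel Phi.
  move=> d' D Y mY; apply: (@measurable_wavgn R d' D exit n.+1 (fun w z => run c row n.+1 N F (chain 1 w) (Y^~ z))) => w.
  by apply: (@measurable_run R c row d' D n.+1 N F Y (fun k _ => chain 1 w k)).
have cPhi l e : (l < N * n.+1)%N -> (forall k, 0 <= e k) ->
    power_cone v 1 (fun z => Phi (upd e l (z 0%N))).
  move=> lN e0; apply: (@power_cone_wavgn R v 1 exit n.+1
    (fun w z => run c row n.+1 N F (chain 1 w) (upd e l (z 0%N)))) => // w w0.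
  by apply: power_cone_run_upd => // k; rewrite ltW// chain_gt0.
have N1 : (0 < n.+1)%N by [].
have gs := @gaussian_swap d T R P v s beta (N * n.+1) (grid_incr B t n.+1 N) Phi v01 s0 h01
  (fun V mV => grid_incr_indep hB t0 N1 N0 mV) (fun l V _ mV => grid_incr_law hB n.+1 l t0 N0 mV) bPhi Phi0 cPhi.
set A := c ^+ n * expR (beta * x).
have A0 : 0 <= A by rewrite mulr_ge0 ?exprn_ge0 ?expR_ge0.
set p := P _.
have mE := measurable_grid_event t N n.+1 x.
have mPhi : measurable_fun setT (fun w => (Phi (grid_weights beta t N n.+1 w))%:E).
  apply/measurable_EFinP; apply: (bPhi _ T (fun l w => grid_weights beta t N n.+1 w l)) => l.
  rewrite /grid_weights; case: ltnP => _; last exact: measurable_cst.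
  apply: (@measurableT_comp _ _ _ _ _ _ (fun x : measurableTypeR R => expR (beta * x))).
    exact: measurable_expRM.
  exact (measurable_funPT (grid_incr B t n.+1 N l)).
set C := Z ^+ N * A `^ v * (mass exit ^+ n * W).
have low : (C%:E * p <= \int[P]_w (Phi (grid_weights beta t N n.+1 w))%:E)%E.
  have -> : (C%:E * p = \int[P]_(w in grid_event t N n.+1 x) cst C%:E w)%E.
    by apply/esym; exact: integral_cst.
  apply: (@le_trans _ _ (\int[P]_(w in grid_event t N n.+1 x) (Phi (grid_weights beta t N n.+1 w))%:E)%E).
    apply: ge0_le_integral => //.
    - by move=> w _; rewrite lee_fin /C mulr_ge0// mulr_ge0// ?exprn_ge0// ?powR_ge0.
    - exact: measurable_funTS.
    - move=> w Ew; rewrite lee_fin; apply: (le_trans _ (PhiGe _ _)); last exact: grid_weights_ge0.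
      apply: ler_wpM2r => //; apply: ler_wpM2l; first exact: exprn_ge0.
      apply: ge0_ler_powR; rewrite ?nnegrE//; first exact: ltW.
      + by apply: bul; exact: grid_weights_ge0.
      + by apply: grid_event_bound => //; exact: ltW.
  apply: ge0_subset_integral => // w _; rewrite lee_fin; apply: Phi0; exact: grid_weights_ge0.
have {}low := le_trans low gs.
have pE : p = (fine p)%:E by rewrite fineK// fin_num_measure.
have {}low : C * fine p <= (1 + 128 * (beta * s) ^+ 3) ^+ (N * n.+1) *
    wavgn (bulk_law E) (N * n.+1) Phi.
  by move: low; rewrite pE -EFinM lee_fin.
have K0 : 0 <= (1 + 128 * (beta * s) ^+ 3) ^+ (N * n.+1).
  by case/andP: h01 => h _; apply: exprn_ge0; exact: exchange_factor_ge0 (ltW h).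
have up := run_le v01 E1 rho01 M0 N hF.
have up2 := @le_wavgn_chain R exit v 1 n ep ltr01.
have ce0 : 0 <= 1 + cutoff_err v E rho M by rewrite addr_ge0// cutoff_err_ge0.
have fin : C * fine p <= (1 + 128 * (beta * s) ^+ 3) ^+ (N * n.+1) *
    ((1 + cutoff_err v E rho M) ^+ (N * n.+1) * W ^+ n.+1).
  apply: (le_trans low); apply: ler_wpM2l => //.
  rewrite /Phi -wavgn_wavgn_swap; apply: (le_trans up); apply: ler_wpM2l; first exact: exprn_ge0.
  by move: up2; rewrite powR1 mul1r.
have W0 : 0 < W.
  rewrite /W wavg_exit; case: (M) M0 => // M' _; rewrite big_ord_recl/= !expr0 mul1r powR1.
  rewrite ltr_pwDl// sumr_ge0// => j _; rewrite mulr_ge0 ?powR_ge0// exprn_ge0//.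
  by case/andP: rho01 => /ltW.
rewrite -(ler_pM2r W0); apply: le_trans (le_trans fin _).
  by rewrite le_eqVlt; apply/orP; left; apply/eqP; rewrite /C; ring.
by rewrite [W ^+ n.+1]exprSr !mulrA.
Qed.

End grid_event.

(** * The continuum limit *)

Section asymptotics.
Context {R : realType}.
Implicit Types (a b s t v x y q : R).

Lemma expR_powR x v : expR x `^ v = expR (v * x).
Proof. by rewrite /powR gt_eqF ?expR_gt0// expRK. Qed.

Lemma sinh_le x : 0 <= x -> expR x - expR (- x) <= x * (expR x + expR (- x)).
Proof.
move=> x0; rewrite -subr_ge0.
have := @le_of_derive_ge0 R (fun x => x * (expR x + expR (- x)) - (expR x - expR (- x)))
  (fun x => x * (expR x - expR (- x))) 0 x x0.
rewrite oppr0 !expR0 !subrr mul0r subrr; apply.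
  by move=> y _; apply: is_derive_eq => /=; rewrite /GRing.scale/=; ring.
by move=> y /andP[y0 _]; rewrite mulr_ge0// subr_ge0 ler_expR; lra.
Qed.

Lemma cosh_le x : 0 <= x -> 2^-1 * expR x + 2^-1 * expR (- x) <= expR (x ^+ 2 / 2).
Proof.
move=> x0; rewrite -[leRHS]mul1r -ler_pdivrMr ?expR_gt0// -expRN -lerN2.
have := @le_of_derive_ge0 R (fun x => - ((2^-1 * expR x + 2^-1 * expR (- x)) * expR (- (x ^+ 2 / 2))))
  (fun x => 2^-1 * (x * (expR x + expR (- x)) - (expR x - expR (- x))) * expR (- (x ^+ 2 / 2))) 0 x x0.
rewrite expr0n/= mul0r !oppr0 !expR0.
rewrite (_ : - ((2^-1 * 1 + 2^-1 * 1) * 1) = -1 :> R); last by field.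
apply.
  by move=> y _; apply: is_derive_eq => /=; rewrite /GRing.scale/=; field.
move=> y /andP[y0 _]; rewrite mulr_ge0 ?expR_ge0// mulr_ge0// subr_ge0; exact: sinh_le.
Qed.

Lemma expR_le_1D y : 0 <= y -> expR (y - y ^+ 2) <= 1 + y.
Proof.
move=> y0; have y1 : 0 < 1 + y by lra.
have := expR_ge1Dx (- (y / (1 + y))).
have -> : 1 + - (y / (1 + y)) = (1 + y)^-1 by field; rewrite gt_eqF.
rewrite expRN lef_pV2 ?posrE ?expR_gt0//; apply: le_trans; rewrite ler_expR.
rewrite ler_pdivlMr//; have := exprn_ge0 3 y0; nra.
Qed.

(** The contribution of the boundary in one time step: over [N] steps with [s ^ 2 = t / N] it
    becomes [exp((b ^ 2 - a ^ 2) t / 2)], up to an error of order [1 / N] in the exponent. *)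
Lemma cosh_ratio_ge a b s : 0 <= a * s -> 0 <= b * s ->
  expR ((b ^+ 2 - a ^+ 2) * s ^+ 2 / 2 - (b * s) ^+ 4 / 4) <=
  (expR (b * s) + expR (- (b * s))) / (expR (a * s) + expR (- (a * s))).
Proof.
move=> as0 bs0; have ca := cosh_le as0; have cb := cosh_ge bs0.
have e0 : 0 < expR (a * s) + expR (- (a * s)) by rewrite addr_gt0// expR_gt0.
rewrite ler_pdivlMr//.
have hb := @expR_le_1D ((b * s) ^+ 2 / 2) (divr_ge0 (sqr_ge0 _) (ler0n _ _)).
have -> : (b ^+ 2 - a ^+ 2) * s ^+ 2 / 2 - (b * s) ^+ 4 / 4 =
  ((b * s) ^+ 2 / 2 - ((b * s) ^+ 2 / 2) ^+ 2) + - ((a * s) ^+ 2 / 2) by field.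
rewrite expRD expRN mulrAC ler_pdivrMr ?expR_gt0//.
have -> : expR (a * s) + expR (- (a * s)) = 2 * (2^-1 * expR (a * s) + 2^-1 * expR (- (a * s))) by field.
have -> : expR (b * s) + expR (- (b * s)) = 2 * (2^-1 * expR (b * s) + 2^-1 * expR (- (b * s))) by field.
rewrite mulrCA -[leRHS]mulrA; apply: ler_wpM2l => //.
apply: ler_pM; [exact: expR_ge0|by lra|exact: le_trans cb|exact: ca].
Qed.

(** The quotient of the total masses of the geometric laws with ratios [exp(- b s)] and
    [exp(- a s)], which is the origin of the factor [a / b]. It is Bernoulli's inequality with
    exponent [b / a]. *)
Lemma ratio_le a b s : 0 < b < a -> 0 < s ->
  (1 - expR (- (a * s))) / (1 - expR (- (b * s))) <= a / b.
Proof.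
move=> /andP[b0 ba] s0; have a0 : 0 < a by lra.
have u0 : 0 < 1 - expR (- (b * s)).
  by rewrite subr_gt0 -[ltRHS]expR0 ltr_expR oppr_lt0 mulr_gt0.
rewrite ler_pdivrMr// mulrAC ler_pdivlMr//.
have v01 : 0 < b / a <= 1 by rewrite divr_gt0//= ler_pdivrMr// mul1r ltW.
have u1 : -1 <= expR (- (a * s)) - 1 by have := expR_ge0 (- (a * s)); lra.
have := powR_bernoulli v01 u1; rewrite addrC subrK expR_powR.
have -> : b / a * - (a * s) = - (b * s) by field; rewrite gt_eqF.
move=> h; have : a * expR (- (b * s)) <= a * (1 + b / a * (expR (- (a * s)) - 1)) by rewrite ler_wpM2l// ltW.
have -> : a * (1 + b / a * (expR (- (a * s)) - 1)) = a + b * (expR (- (a * s)) - 1) by field; rewrite gt_eqF.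
lra.
Qed.

Lemma jump_ge a s h : 0 <= a * s <= 1 -> 0 <= h <= 4^-1 ->
  a * s * h / 16 <= jump (expR h) (expR (- (a * s))).
Proof.
move=> /andP[u0 u1] /andP[h0 h1]; rewrite /jump; set u := a * s in u0 u1 *.
have e2 : (expR h) ^- 2 = expR (- (2 * h)) by rewrite -expRM_natl expRN.
have := expRN_le_quadratic u0; have h20 : 0 <= 2 * h by lra.
have := expRN_le_quadratic h20; have := expR_ge1Dx (- (2 * h)).
rewrite e2; set p := expR (- u); set q := expR (- (2 * h)) => q0 q1 p1.
have pu : u / 2 <= 1 - p by nra.
have qh : h <= 1 - q by nra.
have q2 : 2^-1 <= q by lra.
rewrite (_ : u * h / 16 = u / 2 * h * 2^-1 / 4); last by field.
have u2 : 0 <= u / 2 by rewrite divr_ge0.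
apply: ler_wpM2r => //; apply: ler_pM; [exact: mulr_ge0|by []| |exact: q2].
exact: ler_pM.
Qed.

Lemma sum_geometric q M : q != 1 -> \sum_(j < M) q ^+ j = (1 - q ^+ M) / (1 - q).
Proof.
move=> q1; have := subrX1 q M; move=> /(congr1 -%R); rewrite -mulNr !opprB => ->.
by rewrite [_ * \sum_(_ < _) _]mulrC mulfK// subr_eq0 eq_sym.
Qed.

End asymptotics.

Section grid_event_exponential_bound.
Context d (T : measurableType d) (R : realType) (P : probability T R).
Variables (B : nat -> R -> {RV P >-> R}).
Hypothesis hB : iid_two_sided_brownian_motions B.

(** With [rho = exp(- a s)], the variable [log w / beta] approximates an exponential one of rate
    [a], and the sums of [log x / beta] a Brownian motion with drift [a]. Weighting by [w ^ v]
    changes the rate to [b], because [rho * E ^ v = exp(- b s)]. Here [N] is fixed and the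
    truncation [M] tends to infinity. *)
Lemma grid_event_limit v beta t N n x a b : let s := Num.sqrt (t / N%:R) in
  0 < v <= 1 -> 0 < t -> (0 < N)%N -> 0 < beta -> beta * s <= 4^-1 -> 0 < b < a ->
  v * beta = a - b ->
  fine (P (grid_event B t N n.+1 x)) *
    (((expR (b * s) + expR (- (b * s))) / (expR (a * s) + expR (- (a * s)))) ^+ N *
    (jump (expR (beta * s)) (expR (- (a * s))) ^+ n * expR (beta * x)) `^ v) <=
  (1 + 128 * (beta * s) ^+ 3) ^+ (N * n.+1) * (a / b) ^+ n.
Proof.
move=> s v01 t0 N0 b0 h1 ba vb; set p := fine _; set Z := _ / _; set A := _ * expR _.
have s0 : 0 < s by rewrite sqrtr_gt0 divr_gt0// ltr0n.
have /andP[bp ab] := ba; have ap : 0 < a by lra.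
set E := expR (beta * s); set rho := expR (- (a * s)); set q := expR (- (b * s)).
have rho01 : 0 < rho < 1 by rewrite expR_gt0 /= -[ltRHS]expR0 ltr_expR oppr_lt0 mulr_gt0.
have q01 : 0 < q < 1 by rewrite expR_gt0 /= -[ltRHS]expR0 ltr_expR oppr_lt0 mulr_gt0.
have Ev : E `^ v = expR ((a - b) * s) by rewrite expR_powR mulrA vb.
have rE : rho * E `^ v = q by rewrite Ev -expRD; congr expR; ring.
have ZE : wavg (row_law E rho) (fun y => y^-1 `^ v) = Z.
  rewrite /wavg !big_cons big_nil/= addr0 invrK Ev -expRN expR_powR.
  have -> : v * - (beta * s) = - ((a - b) * s) by rewrite mulrN mulrA vb.
  rewrite /bias_up /bias_down /Z.
  have -> : expR ((a - b) * s) = expR (a * s) * q by rewrite -expRD; congr expR; ring.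
  have -> : expR (- ((a - b) * s)) = rho * expR (b * s) by rewrite -expRD; congr expR; ring.
  have ar : expR (a * s) = rho^-1 by rewrite -expRN opprK.
  have e0 : 0 < rho by case/andP: rho01.
  rewrite ar -/q -/rho; field; rewrite !gt_eqF//.
  by rewrite addr_gt0// mulr_gt0.
have fin M := @grid_event_inequality d T R P B hB v beta t N n x rho M.+1 v01 t0 N0 b0 h1 rho01 (ltn0Sn M).
set K := 1 + 128 * _ in fin *.
have K0 : 0 <= K ^+ (N * n.+1).
  by apply: exprn_ge0; apply: exchange_factor_ge0; rewrite mulr_ge0// ltW.
have [r0 r1] := andP rho01; have [q0 q1] := andP q01.
have step M : p * (Z ^+ N * A `^ v * ((1 - rho ^+ M.+1) / (1 - rho)) ^+ n) <=
    K ^+ (N * n.+1) * ((1 + q ^+ M.+1 * E `^ v) ^+ (N * n.+1) * (1 - q)^-1 ^+ n).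
  have := fin M; rewrite -/p -/s -/E ZE -/A.
  have -> : mass (exit_law E rho M.+1) = (1 - rho ^+ M.+1) / (1 - rho).
    by rewrite -sum_geometric ?lt_eqF// /mass /exit_law big_map big_mkord.
  have pw j : E `^ (j%:R * v) = (E `^ v) ^+ j.
    by rewrite mulrC powRrM powR_mulrn// powR_ge0.
  have -> : wavg (exit_law E rho M.+1) (fun y => y `^ v) = (1 - q ^+ M.+1) / (1 - q).
    rewrite -sum_geometric ?lt_eqF// wavg_exit; apply: eq_bigr => j _.
    by rewrite -[E ^+ j]powR_mulrn ?expR_ge0// -powRrM pw -exprMn rE.
  have -> : cutoff_err v E rho M.+1 = q ^+ M.+1 * E `^ v.
    by rewrite /cutoff_err pw [(E `^ v) ^+ _]exprSr mulrA -exprMn rE.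
  move=> /le_trans; apply; apply: ler_wpM2l => //; apply: ler_wpM2l.
    by rewrite exprn_ge0// addr_ge0// mulr_ge0 ?powR_ge0// exprn_ge0// ltW.
  have q1' : 0 < 1 - q by rewrite subr_gt0.
  apply: lerXn2r; rewrite ?nnegrE ?invr_ge0 ?(ltW q1')//.
    by rewrite divr_ge0 ?(ltW q1')// subr_ge0 exprn_ile1// ltW.
  by rewrite ler_pdivrMr// mulVf ?gt_eqF// lerBlDr lerDl exprn_ge0// ltW.
have cX (z : R) : 0 < z < 1 -> z ^+ M.+1 @[M --> \oo] --> (0 : R).
  move=> /andP[z0 z1]; have := @cvg_expr R z; rewrite gtr0_norm// => /(_ z1).
  by rewrite -(cvg_shiftS (fun M => z ^+ M)).
have cE (f : nat -> R) (l : R) k : f M @[M --> \oo] --> l -> f M ^+ k @[M --> \oo] --> l ^+ k.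
  move=> h; elim: k => [|k IH]; first exact: cvg_cst.
  by under eq_fun do rewrite exprS; rewrite exprS; exact: cvgM.
have cR : ((1 - rho ^+ M.+1) / (1 - rho)) ^+ n @[M --> \oo] --> (1 - rho)^-1 ^+ n.
  apply: (cE (fun M => (1 - rho ^+ M.+1) / (1 - rho))).
  rewrite -[X in _ --> X]mul1r; apply: cvgMl; rewrite -[X in _ --> X]subr0.
  by apply: cvgB; [exact: cvg_cst|exact: cX].
have cQ : (1 + q ^+ M.+1 * E `^ v) ^+ (N * n.+1) @[M --> \oo] --> (1 : R).
  rewrite -[X in _ --> X](expr1n _ (N * n.+1)); apply: (cE (fun M => 1 + q ^+ M.+1 * E `^ v)).
  rewrite -[X in _ --> X]addr0; apply: cvgD; first exact: cvg_cst.
  by rewrite -[X in _ --> X](mul0r (E `^ v)); apply: cvgMl; exact: cX.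
have lim : p * (Z ^+ N * A `^ v * (1 - rho)^-1 ^+ n) <=
    K ^+ (N * n.+1) * (1 * (1 - q)^-1 ^+ n).
  apply: (@ler_cvg_to _ \oo _ _
    (fun M => p * (Z ^+ N * A `^ v * ((1 - rho ^+ M.+1) / (1 - rho)) ^+ n))
    (fun M => K ^+ (N * n.+1) * ((1 + q ^+ M.+1 * E `^ v) ^+ (N * n.+1) * (1 - q)^-1 ^+ n))).
  - by apply: cvgMr; apply: cvgMr.
  - by apply: cvgMr; apply: cvgMl.
  - by apply: nearW => M; exact: step.
have r1' : 0 < 1 - rho by rewrite subr_gt0.
rewrite -(ler_pM2r (exprn_gt0 n (_ : 0 < (1 - rho)^-1))) ?invr_gt0//.
rewrite -mulrA; apply: (le_trans lim); rewrite mul1r -mulrA; apply: ler_wpM2l => //.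
rewrite -exprMn; apply: lerXn2r; rewrite ?nnegrE ?invr_ge0 ?subr_ge0 ?(ltW q1)//.
  by rewrite mulr_ge0 ?invr_ge0 ?(ltW r1')// divr_ge0// ltW.
rewrite -(ler_pM2l r1') [_ * (_ / _ * _)]mulrC mulfVK ?gt_eqF//.
exact: ratio_le.
Qed.

End grid_event_exponential_bound.

Section grid_limit.
Context d (T : measurableType d) (R : realType) (P : probability T R).
Variables (B : nat -> R -> {RV P >-> R}).
Hypothesis hB : iid_two_sided_brownian_motions B.

Lemma succ_le_exprn m : m.+1%:R <= 2 * (3 / 2) ^+ m :> R.
Proof.
elim: m => [|m IH]; first by rewrite expr0; lra.
have h : 1 <= (3 / 2) ^+ m :> R by rewrite exprn_ege1//; lra.
by rewrite exprS -natr1; lra.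
Qed.

Lemma ln2_le1 : ln 2 <= 1 :> R.
Proof.
rewrite -[leRHS]expRK ler_ln ?posrE ?expR_gt0//.
by have := @expR_ge1Dx R 1; lra.
Qed.

Let jump_exponent_arith (l u y : R) : - l <= `|l| -> 0 <= u -> 0 <= y -> y <= 1 ->
  - (l - 7 * (u * y)) <= (`|l| + 7) * (u + 1).
Proof.
move=> zl u0 y0 y1; have zu := mulr_ge0 (normr_ge0 l) u0.
have uy : u * y <= u by rewrite ler_piMr.
by have := normr_ge0 l; nra.
Qed.

(* With [N = 256 ^ m] time steps and inverse temperature [beta = 2 ^ m], the noise
   scale is [h = Num.sqrt t / 8 ^ m]: the Gaussian error [N * h ^ 3] is of order
   [2 ^- m], and the jump weight, a power of [2 ^- m], has exponent
   [v = (a - b) / 2 ^ m]. *)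
Lemma grid_event_decay t n x a b : 0 < t -> 0 < b < a -> exists C : R, \forall m \near \oo,
  fine (P (grid_event B t (256 ^ m) n.+1 x)) * expR ((b ^+ 2 - a ^+ 2) * t / 2 + (a - b) * x) <=
  (a / b) ^+ n * expR (C * (3 / 4) ^+ m).
Proof.
move=> t0 ba; have /andP[b0 ab] := ba; have a0 : 0 < a by lra.
pose r := Num.sqrt t; have r0 : 0 < r by rewrite sqrtr_gt0.
have r2 : r ^+ 2 = t by rewrite sqr_sqrtr// ltW.
pose l := ln (a * t / 16).
exists (2 * (b ^+ 4 * t ^+ 2 / 4 + (a - b) * n%:R * (`|l| + 7) + 128 * r ^+ 3 * n.+1%:R)).
(* Once [2 ^ m] exceeds [G], one has [v <= 1], [h <= 1/4] and [a * s <= 1]. *)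
pose G := 1 + (a - b) + 4 * r + a * r.
exists (Num.bound G) => // m /= Gm.
pose g : R := 2 ^+ m.
have gG : G <= g.
  apply: (@le_trans _ _ m%:R).
    apply: (@le_trans _ _ (Num.bound G)%:R); last by rewrite ler_nat.
    by apply: ltW; apply: archi_boundP; rewrite /G; have := mulr_gt0 a0 r0; lra.
  by rewrite /g -natrX ler_nat ltnW// ltn_expl.
have ar0 : 0 < a * r by exact: mulr_gt0.
have [g1 gt gr gar] : [/\ 1 <= g, a - b <= g, 4 * r <= g & a * r <= g].
  by move: gG; rewrite /G; split; lra.
have g0 : 0 < g by lra.
have gn0 : g != 0 by rewrite gt_eqF.
have [aw bw rw gw] : [/\ 0 <= a, 0 <= b, 0 <= r & 0 <= g] by split; apply: ltW.
have tw : 0 <= t by exact: ltW.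
have giw : 0 <= g^-1 by rewrite invr_ge0.
have abw : 0 <= a - b by lra.
have abn : 0 <= (a / b) ^+ n by rewrite exprn_ge0// divr_ge0.
have NE : (256 ^ m)%:R = g ^+ 8 :> R.
  by rewrite natrX /g -!exprM mulnC exprM; congr (_ ^+ m); ring.
set N := (256 ^ m)%N in NE *; have N0 : (0 < N)%N by rewrite expn_gt0.
pose s := Num.sqrt (t / N%:R).
have sE : s = r / g ^+ 4.
  rewrite /s NE -r2 (_ : _ / _ = (r / g ^+ 4) ^+ 2); last by field.
  by rewrite sqrtr_sqr ger0_norm// divr_ge0// exprn_ge0.
have hE : g * s = r / g ^+ 3 by rewrite sE; field.
have gk k : g <= g ^+ k.+1.
  by rewrite exprS; apply: ler_peMr => //; exact: exprn_ege1.
have gk0 k : 0 < g ^+ k by exact: exprn_gt0.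
have h1 : g * s <= 4^-1.
  by rewrite hE ler_pdivrMr//; have := gk 2; lra.
have as1 : 0 <= a * s <= 1.
  have as0 : 0 <= a * s by rewrite sE mulr_ge0// divr_ge0// exprn_ge0.
  rewrite as0/= sE mulrA ler_pdivrMr// mul1r; exact: le_trans (gk 3).
have h01 : 0 <= g * s <= 4^-1 by rewrite h1 hE divr_ge0// exprn_ge0.
have v01 : 0 < (a - b) / g <= 1 by rewrite divr_gt0 ?subr_gt0//= ler_pdivrMr// mul1r.
have vg : (a - b) / g * g = a - b by field.
have := grid_event_limit hB n x v01 t0 N0 g0 h1 ba vg.
rewrite -/s; set p := fine _; set Z := (expR (b * s) + _) / _; set v := (a - b) / g in v01 vg *.
set c := jump _ _; set K := 1 + _ => main.
have p0 : 0 <= p by rewrite fine_ge0// measure_ge0.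
have [v0 v1] := andP v01.
have [as0 _] := andP as1; have [h0 _] := andP h01.
have bs0 : 0 <= b * s.
  by rewrite mulr_ge0// sE divr_ge0// exprn_ge0.
have Zge : expR (N%:R * ((b ^+ 2 - a ^+ 2) * s ^+ 2 / 2 - (b * s) ^+ 4 / 4)) <= Z ^+ N.
  rewrite expRM_natl; apply: lerXn2r; rewrite ?nnegrE ?expR_ge0//.
    by apply: divr_ge0; rewrite addr_ge0 ?expR_ge0.
  exact: cosh_ratio_ge.
(* The exponent is [7 = 4 + 3], from [s = r / g ^+ 4] and [h = r / g ^+ 3]. *)
have cE : a * s * (g * s) / 16 = a * t / 16 / g ^+ 7 by rewrite sE -r2; field.
have at0 : 0 < a * t / 16 by rewrite divr_gt0// mulr_gt0.
have c0 : 0 < a * t / 16 / g ^+ 7 by rewrite divr_gt0.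
have cge := jump_ge as1 h01; rewrite cE -/c in cge.
have cw : 0 <= c by apply: le_trans cge; exact: ltW.
have cp : 0 < c by exact: lt_le_trans cge.
have Age : expR (v * (n%:R * (l - (7 * m)%:R * ln 2) + g * x)) <= (c ^+ n * expR (g * x)) `^ v.
  rewrite -(expR_powR (n%:R * (l - (7 * m)%:R * ln 2) + g * x) v); apply: ge0_ler_powR; rewrite ?nnegrE ?expR_ge0//; first exact: ltW.
    by rewrite mulr_ge0 ?expR_ge0// exprn_ge0.
  rewrite expRD; apply: ler_wpM2r; first exact: expR_ge0.
  rewrite expRM_natl; apply: lerXn2r; rewrite ?nnegrE ?expR_ge0//.
  have -> : l - (7 * m)%:R * ln 2 = ln (a * t / 16 / g ^+ 7).
    rewrite ln_div ?posrE//; congr (_ - _).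
    by rewrite /g -exprM mulnC lnXn// mulr_natl.
  by rewrite lnK ?posrE.
have Kle : K ^+ (N * n.+1) <= expR (128 * r ^+ 3 * n.+1%:R / g).
  have K0 : 0 <= K by exact: exchange_factor_ge0.
  apply: (@le_trans _ _ (expR (128 * (g * s) ^+ 3) ^+ (N * n.+1))).
    by apply: lerXn2r; rewrite ?nnegrE ?expR_ge0//; exact: expR_ge1Dx.
  rewrite -expRM_natl ler_expR natrM NE hE le_eqVlt; apply/orP; left; apply/eqP; field.
  by [].
have {}main : p * (expR (N%:R * ((b ^+ 2 - a ^+ 2) * s ^+ 2 / 2 - (b * s) ^+ 4 / 4)) *
    expR (v * (n%:R * (l - (7 * m)%:R * ln 2) + g * x))) <=
    expR (128 * r ^+ 3 * n.+1%:R / g) * (a / b) ^+ n.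
  apply: (@le_trans _ _ (p * (Z ^+ N * (c ^+ n * expR (g * x)) `^ v))).
    by apply: ler_wpM2l => //; apply: ler_pM => //; exact: expR_ge0.
  by apply: (le_trans main); apply: ler_wpM2r.
pose eps := b ^+ 4 * t ^+ 2 / 4 / g ^+ 8 - v * n%:R * (l - (7 * m)%:R * ln 2) +
  128 * r ^+ 3 * n.+1%:R / g.
have ex1 : expR (N%:R * ((b ^+ 2 - a ^+ 2) * s ^+ 2 / 2 - (b * s) ^+ 4 / 4)) *
    expR (v * (n%:R * (l - (7 * m)%:R * ln 2) + g * x)) =
  expR ((b ^+ 2 - a ^+ 2) * t / 2 + (a - b) * x) *
  expR (- (eps - 128 * r ^+ 3 * n.+1%:R / g)).
  rewrite -!expRD; congr expR.
  have vx : v * (g * x) = (a - b) * x by rewrite mulrA vg.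
  rewrite /eps NE sE -r2 [v * (_ + _)]mulrDr vx; set y := l - _; field.
  by [].
have {}main : p * expR ((b ^+ 2 - a ^+ 2) * t / 2 + (a - b) * x) <= (a / b) ^+ n * expR eps.
  rewrite -(ler_pM2r (expR_gt0 (- (eps - 128 * r ^+ 3 * n.+1%:R / g)))) -[leLHS]mulrA -ex1.
  apply: (le_trans main).
  by rewrite -[leRHS]mulrA -expRD opprB [eps + _]addrC subrK mulrC.
apply: (le_trans main); apply: ler_wpM2l; first by [].
rewrite ler_expR.
(* All errors are of order [m.+1 / 2 ^ m]; the factor [m.+1] is due to the logarithm of the jump
   weight. *)
have gm : m.+1%:R / g <= 2 * (3 / 4) ^+ m.
  rewrite ler_pdivrMr// -mulrA /g -exprMn (_ : 3 / 4 * 2 = 3 / 2); last by field.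
  exact: succ_le_exprn.
have b4 : 0 <= b ^+ 4 * t ^+ 2 / 4 by rewrite divr_ge0// mulr_ge0// exprn_ge0.
have r3 : 0 <= 128 * r ^+ 3 * n.+1%:R by rewrite mulr_ge0// mulr_ge0// exprn_ge0.
have m1 : 1 <= m.+1%:R :> R by rewrite ler1n.
have e1 : b ^+ 4 * t ^+ 2 / 4 / g ^+ 8 <= b ^+ 4 * t ^+ 2 / 4 * (m.+1%:R / g).
  apply: ler_wpM2l => //; apply: (@le_trans _ _ g^-1); first by rewrite lef_pV2 ?posrE.
  by apply: ler_peMl.
have e3 : 128 * r ^+ 3 * n.+1%:R / g <= 128 * r ^+ 3 * n.+1%:R * (m.+1%:R / g).
  by apply: ler_wpM2l => //; apply: ler_peMl.
have e2 : - (v * n%:R * (l - (7 * m)%:R * ln 2)) <= (a - b) * n%:R * (`|l| + 7) * (m.+1%:R / g).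
  have -> : (a - b) * n%:R * (`|l| + 7) * (m.+1%:R / g) = v * n%:R * ((`|l| + 7) * m.+1%:R).
    by rewrite /v; field.
  rewrite -mulrN; have vw : 0 <= v by exact: ltW.
  apply: ler_wpM2l; first exact: mulr_ge0.
  rewrite natrM -[m.+1%:R]natr1.
  have y1 := ln2_le1; have zl := ler_norm (- l); rewrite normrN in zl.
  have y0 : 0 <= ln 2 :> R by rewrite ln_ge0 ?ler1n.
  by rewrite -mulrA; exact: (jump_exponent_arith zl (ler0n R m) y0 y1).
apply: (@le_trans _ _ ((b ^+ 4 * t ^+ 2 / 4 + (a - b) * n%:R * (`|l| + 7) + 128 * r ^+ 3 * n.+1%:R) * (m.+1%:R / g))).
  rewrite [leRHS]mulrDl [X in _ <= X + _]mulrDl.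
  by apply: lerD e3; exact: lerD e1 e2.
have -> u w : 2 * u * w = u * (2 * w) :> R by ring.
apply: ler_wpM2l => //; rewrite addr_ge0// addr_ge0//.
by rewrite mulr_ge0 ?addr_ge0// mulr_ge0.
Qed.

End grid_limit.

(** * From grid paths to the last passage time *)

Section passage_event.
Context d (T : measurableType d) (R : realType) (P : probability T R).
Variables (B : nat -> R -> {RV P >-> R}).
Hypothesis hB : iid_two_sided_brownian_motions B.

(** Finer grids contain the coarser ones, so the events for [256 ^ m] increase with [m] and their
    probabilities converge to that of the union. *)
Lemma grid_event_subset t N n x k : (0 < N)%N -> (0 < k)%N ->
  grid_event B t N n x `<=` grid_event B t (k * N) n x.
Proof.
move=> N0 k0 w [q [[q0 qn qm] xq]]; exists [seq (k * i)%N | i <- q].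
have nE j : nth 0%N [seq (k * i)%N | i <- q] j = (k * nth 0%N q j)%N.
  have [jq|qj] := ltnP j (size q); first by rewrite (nth_map 0%N).
  by rewrite !nth_default ?size_map// muln0.
split; first split; rewrite ?nE ?q0 ?muln0 ?qn//.
  by move=> j jn; rewrite !nE ltn_pmul2l// qm.
have gE i : grid_point t (k * N) (k * i) = grid_point t N i.
  by rewrite /grid_point !natrM; field; rewrite !pnatr_eq0 -!lt0n N0 k0.
rewrite /grid_sum in xq *; under eq_bigr do rewrite !nE !gE.
exact: xq.
Qed.

Lemma cvg_expR_comp (f : nat -> R) (l : R) :
  f m @[m --> \oo] --> l -> expR (f m) @[m --> \oo] --> expR l.
Proof. by move=> h; exact: (cvg_comp _ _ h (@continuous_expR R l)). Qed.

Lemma cvg_grid_point (t u : R) : 0 < t -> 0 <= u ->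
  grid_point t (256 ^ m) (Num.trunc (u * (256 ^ m)%:R / t)) @[m --> \oo] --> u.
Proof.
move=> t0 u0; apply: (@squeeze_cvgr _ _ _ _ (fun m => u - t * 256^-1 ^+ m) (fun=> u)); last 2 first.
- rewrite -[X in _ --> X]subr0; apply: cvgB; first exact: cvg_cst.
  rewrite -[X in _ --> X](mulr0 t); apply: cvgMr; apply: cvg_expr.
  by rewrite gtr0_norm ?invr_gt0 ?ltr0n ?invf_lt1 ?ltr0n ?ltr1n.
- exact: cvg_cst.
apply: nearW => m; rewrite /grid_point; set N : R := (256 ^ m)%:R.
have N0 : 0 < N by rewrite ltr0n expn_gt0.
have y0 : 0 <= u * N / t by apply: divr_ge0; [apply: mulr_ge0 => //|]; exact: ltW.
have /andP[] := truncn_itv y0; rewrite -natr1; set k : R := _%:R => h1 h2.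
have -> : t * 256^-1 ^+ m = t / N by rewrite /N natrX exprVn.
apply/andP; split.
  rewrite lerBlDr -mulrDl ler_pdivlMr//.
  by move: h2; rewrite ltr_pdivrMr// => /ltW /le_trans; apply; rewrite mulrDl mul1r mulrC.
by rewrite ler_pdivrMr// mulrC -ler_pdivlMr.
Qed.

(** Jump times are rounded down to the grid. By continuity of the sample paths the strict inequality
    for the sum persists on fine grids, and so does the strict order of the times. Measurability of
    the event is obtained at the same time. *)
Lemma last_passage_gt t n x : 0 < t -> (0 < n)%N ->
  [set w | (x%:E < last_passage_time B n t w)%E] = \bigcup_m grid_event B t (256 ^ m) n x.
Proof.
move=> t0 n0.
have sumE (s : nat -> R) w : \sum_(1 <= j < n.+1) process_incr (B j) (s j.-1) (s j) w =
    \sum_(j < n) process_incr (B j.+1) (s j) (s j.+1) w.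
  by rewrite big_add1 big_mkord.
apply/seteqP; split => w /=; last first.
  move=> [m _ [q [[q0 qn qm] xq]]].
  have N0 : (0 < 256 ^ m)%N by rewrite expn_gt0.
  pose s j := grid_point t (256 ^ m) (nth 0%N q j).
  have lt_s : (x%:E < (\sum_(1 <= j < n.+1) process_incr (B j) (s j.-1) (s j) w)%:E)%E.
    by rewrite lte_fin sumE.
  apply: (lt_le_trans lt_s); apply: ereal_sup_ubound => /=; exists s => //; split.
  - by rewrite /s q0 /grid_point mulr0 mul0r.
  - by rewrite /s qn /grid_point; apply: mulfK; rewrite pnatr_eq0 -lt0n.
  - move=> j /qm qq; rewrite /s /grid_point ltr_pM2r ?invr_gt0 ?ltr0n//.
    by rewrite ltr_pM2l// ltr_nat.
move=> /ereal_sup_gt[_ [s [s0 sn sm] <-]]; rewrite lte_fin sumE => xs.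
have sge j : (j <= n)%N -> 0 <= s j.
  elim: j => [|j IH] jn; first by rewrite s0.
  by apply: (le_trans (IH (ltnW jn))); apply: ltW; exact: sm.
pose q m j := Num.trunc (s j * (256 ^ m)%:R / t).
have cs j : (j <= n)%N -> grid_point t (256 ^ m) (q m j) @[m --> \oo] --> s j.
  by move=> jn; apply: cvg_grid_point => //; exact: sge.
have csum k : (k <= n)%N -> grid_sum B t (256 ^ m) k (q m) w @[m --> \oo] -->
    \sum_(j < k) process_incr (B j.+1) (s j) (s j.+1) w.
  elim: k => [|k IH] kn.
    by rewrite big_ord0 /grid_sum; under eq_fun do rewrite big_ord0; exact: cvg_cst.
  rewrite big_ord_recr /grid_sum; under eq_fun do rewrite big_ord_recr.
  apply: cvgD; first exact: IH (ltnW kn).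
  have [_ cont _ _] := hB.1 k.+1.
  apply: cvgB; first exact: (cvg_comp _ _ (cs k.+1 kn) (cont w (s k.+1))).
  exact: (cvg_comp _ _ (cs k (ltnW kn)) (cont w (s k))).
have near1 : \forall m \near \oo, x < grid_sum B t (256 ^ m) n (q m) w.
  by apply: cvgr_gt xs; exact: csum.
have near2 : \forall m \near \oo, forall j : 'I_n, (q m j < q m j.+1)%N.
  apply: filter_forall => j.
  have cd : grid_point t (256 ^ m) (q m j.+1) - grid_point t (256 ^ m) (q m j) @[m --> \oo] -->
      s j.+1 - s j.
    by apply: cvgB; apply: cs => //; exact: ltnW.
  have d0 : 0 < s j.+1 - s j by rewrite subr_gt0 sm.
  have : \forall m \near \oo, 0 < grid_point t (256 ^ m) (q m j.+1) - grid_point t (256 ^ m) (q m j).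
    by apply: cvgr_gt d0; exact: cd.
  apply: filterS => m.
  rewrite subr_gt0 /grid_point ltr_pM2r ?invr_gt0 ?ltr0n ?expn_gt0//.
  by rewrite ltr_pM2l// ltr_nat.
have [m [h1 h2]] := filter_ex (filterI near1 near2).
have nE j : (j <= n)%N -> nth 0%N (mkseq (q m) n.+1) j = q m j by move=> jn; rewrite nth_mkseq.
exists m => //; exists (mkseq (q m) n.+1); split; first split.
- by rewrite nE// /q s0 !mul0r truncn0.
- by rewrite nE// /q sn mulrAC mulfV ?gt_eqF// mul1r natrK.
- by move=> j jn; rewrite !nE// ?(ltnW jn)//; exact: (h2 (Ordinal jn)).
rewrite /grid_sum (eq_bigr (fun j : 'I_n => process_incr (B j.+1)
  (grid_point t (256 ^ m) (q m j)) (grid_point t (256 ^ m) (q m j.+1)) w)); first exact: h1.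
by move=> j _; rewrite !nE// ltnW.
Qed.

Lemma last_passage_gt_le t n x a b : 0 < t -> 0 < b < a ->
  (P [set w | (x%:E < last_passage_time B n.+1 t w)%E] <=
   ((a / b) ^+ n * expR (- ((b ^+ 2 - a ^+ 2) * t / 2 + (a - b) * x)))%:E)%E.
Proof.
move=> t0 ba; rewrite last_passage_gt//; set z := _ * t / 2 + _; set D := (a / b) ^+ n.
pose E m := grid_event B t (256 ^ m) n.+1 x.
have mE m : measurable (E m) by exact: measurable_grid_event.
have mU : measurable (\bigcup_m E m) by exact: bigcupT_measurable.
have incE : nondecreasing_seq E.
  apply/nondecreasing_seqP => m; apply/subsetPset; rewrite /E expnS.
  by apply: grid_event_subset; rewrite ?expn_gt0.
have PU : P (\bigcup_m E m) = (fine (P (\bigcup_m E m)))%:E by rewrite fineK// fin_num_measure.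
have cP := @nondecreasing_cvg_mu _ _ _ P E mE mU incE.
have cE : (fine \o (P \o E)) m @[m --> \oo] --> fine (P (\bigcup_m E m)).
  by apply: fine_cvg; rewrite -PU; exact: cP.
have [C hC] := grid_event_decay hB n x t0 ba.
have cR : D * expR (C * (3 / 4) ^+ m) @[m --> \oo] --> D.
  rewrite -[X in _ --> X]mulr1; apply: cvgMr; rewrite -[X in _ --> X]expR0.
  apply: cvg_expR_comp; rewrite -[X in _ --> X](mulr0 C).
  by apply: cvgMr; apply: cvg_expr; rewrite ger0_norm//; lra.
have h : fine (P (\bigcup_m E m)) * expR z <= D.
  apply: (@ler_cvg_to _ \oo _ _ (fun m => fine (P (E m)) * expR z)
    (fun m => D * expR (C * (3 / 4) ^+ m))) => //.
  by apply: cvgMl; exact: cE.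
by rewrite PU lee_fin expRN ler_pdivlMr ?expR_gt0.
Qed.

(** Grid paths detect strict inequalities only, so the closed event is reached by lowering the
    threshold. *)
Lemma last_passage_ge t n x : [set w | (x%:E <= last_passage_time B n t w)%E] =
  \bigcap_k [set w | ((x - k.+1%:R^-1)%:E < last_passage_time B n t w)%E].
Proof.
apply/seteqP; split => w /=.
  by move=> h k _ /=; apply: lt_le_trans h; rewrite lte_fin ltrBlDr ltrDl invr_gt0.
move=> h; have {}h k : ((x - k.+1%:R^-1)%:E < last_passage_time B n t w)%E := h k I.
case: (last_passage_time B n t w) h => [y||] h; last 2 first.
- by rewrite leey.
- by have := h 0%N.
rewrite lee_fin; apply/ler_addgt0Pr => e e0.
have [k ke] : exists k : nat, k.+1%:R^-1 < e by have [k] := ltr_add_invr (e0 : 0 < e); rewrite add0r; exists k.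
by move: (h k) ke; rewrite lte_fin; set u := _^-1 => *; lra.
Qed.

Lemma measurable_last_passage_ge t n x : 0 < t -> (0 < n)%N ->
  measurable [set w | (x%:E <= last_passage_time B n t w)%E].
Proof.
move=> t0 n0; rewrite last_passage_ge; apply: bigcapT_measurable => k.
rewrite last_passage_gt//; apply: bigcupT_measurable => m; exact: measurable_grid_event.
Qed.

Lemma last_passage_ge_le t n x a b : 0 < t -> 0 < b < a ->
  (P [set w | (x%:E <= last_passage_time B n.+1 t w)%E] <=
   ((a / b) ^+ n * expR (- ((b ^+ 2 - a ^+ 2) * t / 2 + (a - b) * x)))%:E)%E.
Proof.
move=> t0 ba; set S := [set w | _].
have mS : measurable S by exact: measurable_last_passage_ge.
have PS : P S = (fine (P S))%:E by rewrite fineK// fin_num_measure.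
rewrite PS lee_fin.
pose y k : R := x - k.+1%:R^-1.
apply: (@ler_cvg_to _ \oo _ _ (fun=> fine (P S))
  (fun k => (a / b) ^+ n * expR (- ((b ^+ 2 - a ^+ 2) * t / 2 + (a - b) * y k)))).
- exact: cvg_cst.
- apply: cvgMr.
  apply: cvg_expR_comp.
  apply: cvgN; apply: cvgD; first exact: cvg_cst.
  apply: cvgMr; rewrite -[X in _ --> X]subr0; apply: cvgB; first exact: cvg_cst.
  exact: cvg_harmonic.
apply: nearW => k; rewrite -lee_fin -PS.
apply: le_trans (last_passage_gt_le n (y k) t0 ba).
apply: le_measure; rewrite ?inE//.
  rewrite last_passage_gt//; apply: bigcupT_measurable => m; exact: measurable_grid_event.
by rewrite /S last_passage_ge => w; apply.
Qed.

End passage_event.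

(** * The rate function *)

Section rate_function.
Context {R : realType}.
Implicit Types x r : R.

Let S x := Num.sqrt (x * (x + 2)).
(** The substitution [1 + x = cosh z] turns the integrand into [sinh z ^ 2]; the logarithm is [z]
    itself. *)
Let F x := 2^-1 * ((1 + x) * S x - ln (1 + x + S x)).

Let S_continuous : continuous S.
Proof.
move=> x; apply: continuous_comp; last exact: sqrt_continuous.
by apply: cvgM; [exact: cvg_id|apply: cvgD; [exact: cvg_id|exact: cvg_cst]].
Qed.

Let F_continuous x : 0 <= x -> {for x, continuous F}.
Proof.
move=> x0; have s0 : 0 <= S x by exact: sqrtr_ge0.
apply: cvgMr; apply: cvgB.
  apply: cvgM; last exact: S_continuous.
  by apply: cvgD; [exact: cvg_cst|exact: cvg_id].
apply: (@continuous_comp _ _ _ (fun x => 1 + x + S x) (@ln R)).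
  apply: cvgD; last exact: S_continuous.
  by apply: cvgD; [exact: cvg_cst|exact: cvg_id].
by apply: continuous_ln; lra.
Qed.

Let F_derive x : 0 < x -> is_derive x 1 F (S x).
Proof.
move=> x0; have p0 : 0 < x * (x + 2) by rewrite mulr_gt0//; lra.
have s0 : 0 < S x by rewrite sqrtr_gt0.
have s2 : S x ^+ 2 = x * (x + 2) by rewrite sqr_sqrtr// ltW.
have dS : is_derive x 1 S ((1 + x) / S x).
  have d1 := is_derive1_sqrt p0.
  have d2 : is_derive x 1 (fun x : R => x * (x + 2)) (2 + 2 * x).
    by apply: is_derive_eq => /=; rewrite /GRing.scale/=; ring.
  rewrite (_ : (1 + x) / S x = (2 * S x)^-1 * (2 + 2 * x)).
    exact: (@is_derive1_comp R Num.sqrt (fun x : R => x * (x + 2)) x _ _ d1 d2).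
  by field; rewrite gt_eqF.
have u0 : 0 < 1 + x + S x by lra.
have dl : is_derive x 1 (fun x => ln (1 + x + S x)) (S x)^-1.
  have d1 := is_derive1_ln u0.
  have d2 : is_derive x 1 (fun x : R => 1 + x + S x) (1 + (1 + x) / S x).
    by apply: is_derive_eq; rewrite add0r.
  rewrite (_ : (S x)^-1 = (1 + x + S x)^-1 * (1 + (1 + x) / S x)).
    exact: (@is_derive1_comp R (@ln R) (fun x : R => 1 + x + S x) x _ _ d1 d2).
  by field; rewrite !gt_eqF.
apply: is_derive_eq => /=; rewrite /GRing.scale/=.
have : (1 + x) ^+ 2 = S x ^+ 2 + 1 by rewrite s2; ring.
move=> h.
rewrite (_ : (1 + x) * ((1 + x) / S x) = (S x ^+ 2 + 1) / S x); last by rewrite mulrA -expr2 h.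
by field; rewrite gt_eqF.
Qed.

Lemma J_GUE_closed_form r : 0 < r -> J_GUE r =
  2 * (1 + r) * Num.sqrt (r * (r + 2)) - 2 * ln (1 + r + Num.sqrt (r * (r + 2))).
Proof.
move=> r0; rewrite /J_GUE /Rintegral.
rewrite (@continuous_FTC2 R S F 0 r r0).
- by rewrite -EFinB /= /F /S add0r mul0r sqrtr0 !addr0 ln1 mulr0 subrr mulr0 subr0; field.
- by apply: continuous_subspaceT => x; exact: S_continuous.
(* [F_derive] divides by [S x], which vanishes at [0]; at the endpoints one-sided continuity is
   enough. *)
- split.
  + by move=> x; rewrite in_itv/= => /andP[x0 _]; have [] := F_derive x0.
  + by apply: cvg_at_right_filter; exact: F_continuous.
  + by apply: cvg_at_left_filter; apply: F_continuous; exact: ltW.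
- move=> x; rewrite in_itv/= => /andP[x0 _]; rewrite derive1E.
  by have [_] := F_derive x0.
Qed.

Lemma J_GUE0 : J_GUE 0 = 0 :> R.
Proof. by rewrite /J_GUE set_itv1 Rintegral_set1 mulr0. Qed.

End rate_function.

Theorem corollary1p2 (d : measure_display) (T : measurableType d)
    (R : realType) (P : probability T R) (B : nat -> R -> {RV P >-> R})
    (hB : iid_two_sided_brownian_motions B)
    (n : nat) (hn : (0 < n)%N) (r : R) (hr : 0 <= r) :
  (P [set w | (2 * (1 + r))%:E <= (n%:R^-1)%:E * last_passage_time B n n%:R w]
    <= (expR (- (n%:R * J_GUE r)))%:E)%E.
Proof.
have n0 : 0 < n%:R :> R by rewrite ltr0n.
have -> : [set w | ((2 * (1 + r))%:E <= (n%:R^-1)%:E * last_passage_time B n n%:R w)%E] =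
    [set w | ((n%:R * (2 * (1 + r)))%:E <= last_passage_time B n n%:R w)%E].
  by apply/seteqP; split => w /=; rewrite lee_pdivlMl.
(* At [r = 0] the choice below degenerates to [a = b], but the claimed bound is then [1]. *)
move: hr; rewrite le_eqVlt => /predU1P[<-|r0].
  rewrite J_GUE0 mulr0 oppr0 expR0; apply: probability_le1.
  exact: measurable_last_passage_ge.
rewrite J_GUE_closed_form//; set S := Num.sqrt (r * (r + 2)).
have p0 : 0 < r * (r + 2) by rewrite mulr_gt0//; lra.
have s0 : 0 < S by rewrite sqrtr_gt0.
have s2 : S ^+ 2 = r * (r + 2) by rewrite sqr_sqrtr// ltW.
(* Stationarity of the exponent in [a] and in [b] gives the same equation [z + 1 / z = 2 * (1 + r)],
   and these are its two roots. *)
pose a := 1 + r + S; pose b := 1 + r - S.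
have ab1 : a * b = 1 by transitivity ((1 + r) ^+ 2 - S ^+ 2); [rewrite /a /b; ring|rewrite s2; ring].
have a0 : 0 < a by rewrite /a; lra.
have b0 : 0 < b by rewrite -(pmulr_rgt0 _ a0) ab1.
have ba : 0 < b < a by rewrite b0 /a /b; lra.
case: n hn n0 => // n _ n0.
apply: (le_trans (last_passage_ge_le hB n (n.+1%:R * (2 * (1 + r))) n0 ba)).
rewrite lee_fin; have abE : a / b = a ^+ 2.
  by rewrite -[a / b]mulr1 -ab1; field; rewrite gt_eqF.
have a1 : 1 <= a ^+ 2 by rewrite exprn_ege1// /a; lra.
(* The estimate carries one factor [a / b] less than there are levels. Since this factor is at least
   [1] it may be restored, which makes the exponent exactly proportional to [n.+1]. *)
apply: (@le_trans _ _ ((a / b) ^+ n.+1 * expR (- ((b ^+ 2 - a ^+ 2) * n.+1%:R / 2 +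
    (a - b) * (n.+1%:R * (2 * (1 + r))))))).
  apply: ler_wpM2r; first exact: expR_ge0.
  by rewrite abE [leRHS]exprS ler_peMl// exprn_ge0// exprn_ge0// ltW.
rewrite abE -[a in a ^+ 2 ^+ _]lnK ?posrE// -!expRM_natl -expRD ler_expR.
rewrite le_eqVlt; apply/orP; left; apply/eqP; rewrite -/a.
by set l := ln a; rewrite /b /a; field.
Qed.
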